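(* Let $2<p<\infty$. Then the space $H^p$ is a first category subset of $\mathcal D^p_{p-1}$.
   Context: $\mathbb D$ is the open unit disc in $\mathbb C$, $dm(\theta)=\frac{1}{2\pi}d\theta$, and $dA=\frac1\pi dx\,dy$ is normalized area measure on $\mathbb D$. $H^p$ is the classical Hardy space of analytic functions $f$ on $\mathbb D$ with $\lim_{r\to1}\big(\int_0^{2\pi}|f(re^{i\theta})|^p\,dm(\theta)\big)^{1/p}<\infty$. For $\alpha>-1$ and $p\ge1$, $\mathcal A^p_\alpha$ is the weighted Bergman space of analytic functions $h$ on $\mathbb D$ with $$\|h\|_{\mathcal A^p_\alpha}=\Big((\alpha+1)\int_{\mathbb D}(1-|z|^2)^\alpha|h(z)|^p\,dA(z)\Big)^{1/p}<\infty,$$ and $\mathcal D^p_\alpha=\{f \text{ analytic on }\mathbb D: f'\in\mathcal A^p_\alpha\}$ is a Banach space with norm $\|f\|_{\mathcal D^p_\alpha}=|f(0)|+\|f'\|_{\mathcal A^p_\alpha}$. Here $\alpha=p-1$. For $p>2$ one has $H^p\subset\mathcal D^p_{p-1}$ (Littlewood–Paley). A first category subset is a countable union of nowhere dense sets (in the norm topology of $\mathcal D^p_{p-1}$). *)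

(* Defs.v *)
From HB Require Import structures.
From mathcomp Require Import all_boot all_order all_algebra.
From mathcomp Require Import all_classical all_reals all_analysis.
From mathcomp.real_closed Require Import complex.

Set Implicit Arguments.
Unset Strict Implicit.
Unset Printing Implicit Defensive.

Import Order.TTheory GRing.Theory Num.Theory.
Import numFieldNormedType.Exports.

Local Open Scope classical_set_scope.
Local Open Scope ring_scope.
Local Open Scope complex_scope.

Definition disc (R : realType) : Type := {z : R[i] | `|z| < 1}.

(* Functions on the disc are values of [disc R -> R[i]], so that equality of
   functions is equality on the disc.  The extension by zero is only used to
   evaluate and differentiate them: the disc being open, the values outside
   play no role in the (complex) derivative at a point of the disc. *)
Definition extend0 (R : realType) (f : disc R -> R[i]) (z : R[i]) : R[i] :=
  oapp f 0 (insub z).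

(* [derivable] is taken with respect to the field R[i], with increments h in
   R[i]: this is complex differentiability. *)
Definition analytic (R : realType) : set (disc R -> R[i]) :=
  [set f | forall z : disc R, derivable (extend0 f : R[i]^o -> R[i]^o) (val z) 1].

Definition disc_derive (R : realType) (f : disc R -> R[i]) : disc R -> R[i] :=
  fun z => derive1 (extend0 f : R[i]^o -> R[i]^o) (val z).

Section norms.
Context {R : realType}.
Implicit Types (f h : disc R -> R[i]) (p a r : R).

(* The modulus as an element of R; [`|z|] lives in R[i]. *)
Local Notation modulus := ComplexField.Normc.normc.

Local Open Scope ereal_scope.

(* \int_D F dA, with dA = dx dy / pi *)
Definition area_integral (F : R[i] -> \bar R) : \bar R :=
  (pi^-1)%:E *
  \int[lebesgue_measure \x lebesgue_measure]_(xy in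
      [set xy : R * R | (modulus (xy.1 +i* xy.2) < 1)%R])
    F (xy.1 +i* xy.2).

Definition bergman_norm p a h : \bar R :=
  poweR ((a + 1)%:E *
         area_integral (fun z => ((1 - modulus z ^+ 2) `^ a *
                                  modulus (extend0 h z) `^ p)%:E))
        p^-1.

Definition bergman p a : set (disc R -> R[i]) :=
  [set h | analytic h /\ bergman_norm p a h < +oo].

Definition dirichlet p a : set (disc R -> R[i]) :=
  [set f | analytic f /\ bergman p a (disc_derive f)].

Definition dirichlet_norm p a f : \bar R :=
  (modulus (extend0 f 0))%:E + bergman_norm p a (disc_derive f).

Definition circle_mean p f r : \bar R :=
  poweR (((2 * pi)^-1)%:E *
         \int[lebesgue_measure]_(t in `[0%R, (2 * pi)%R])
           (modulus (extend0 f ((r * cos t) +i* (r * sin t))) `^ p)%:E)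
        p^-1.

Definition hardy p : set (disc R -> R[i]) :=
  [set f | analytic f /\
     exists l : R, circle_mean p f r @[r --> (1%R : R)^'-] --> l%:E].

End norms.

Record dirichlet_space (R : realType) (p a : R) := DirichletSpace {
  dirichlet_fun :> disc R -> R[i];
  dirichlet_funP : dirichlet p a dirichlet_fun }.

HB.instance Definition _ (R : realType) (p a : R) :=
  gen_eqMixin (dirichlet_space p a).
HB.instance Definition _ (R : realType) (p a : R) :=
  gen_choiceMixin (dirichlet_space p a).

(* The norm topology, given by its open sets. *)
Section dirichlet_topology.
Context {R : realType} (p a : R).
Local Notation T := (dirichlet_space p a).

Definition dirichlet_ball (f : T) (e : R) : set T :=
  [set g : T | (dirichlet_norm p a (dirichlet_fun g \- dirichlet_fun f)%R < e%:E)%E].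

Definition dirichlet_open (U : set T) : Prop :=
  forall f, U f -> exists2 e : R, 0 < e & dirichlet_ball f e `<=` U.

Let dirichlet_openT : dirichlet_open setT.
Proof. by move=> f _; exists 1. Qed.

Let dirichlet_openI (U V : set T) :
  dirichlet_open U -> dirichlet_open V -> dirichlet_open (U `&` V).
Proof.
move=> oU oV f [/oU[d d0 dU] /oV[e e0 eV]].
exists (Num.min d e); first by rewrite lt_min d0 e0.
move=> g fg; split; [apply: dU|apply: eV]; apply: lt_le_trans fg _;
  by rewrite lee_fin ge_min lexx ?orbT.
Qed.

Let dirichlet_open_bigcup (I : Type) (F : I -> set T) :
  (forall i, dirichlet_open (F i)) -> dirichlet_open (\bigcup_i F i).
Proof.
move=> oF f [i _ /oF[e e0 eF]]; exists e => // g /eF Fg.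
by exists i.
Qed.

HB.instance Definition _ := isOpenTopological.Build T
  dirichlet_openT dirichlet_openI dirichlet_open_bigcup.

End dirichlet_topology.

Definition nowhere_dense (T : topologicalType) (A : set T) : Prop :=
  (closure A)° = set0.

Definition first_category (T : topologicalType) (A : set T) : Prop :=
  exists2 N : nat -> set T,
    forall n, nowhere_dense (N n) & A = \bigcup_n N n.

(* Main.v *)
(* Write M(r) for the mean of |f|^p over the circle |z| = r.  Clarkson's
   inequality |a + b|^p + |a - b|^p >= 2 (|a|^p + |b|^p), averaged over small
   circles and then over rotations, gives for r < s < 1
     2 ((s - r) / 2)^p * (mean of |f'|^p over |z| = r) <= M(s) - M(r).
   Summed over the annuli 1 - 2^-n <= |z| < 1 - 2^-(n+1), where the right-hand
   sides telescope, this bounds the integral of (1 - |z|^2)^(p-1) |f'|^p by a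
   multiple of sup M: this is the Littlewood-Paley inclusion.

   H^p is the union of the sets N_n = {M <= n}.  They are closed, because the
   Dirichlet norm controls f' locally in L^p, hence locally uniformly.  They
   have empty interior because of the lacunary polynomials
   g_K = z + z^2 + z^4 + ... + z^(2^(K-1)): since (1 - |z|^2) |g_K'| <= 4, the
   inequality above with exponent 2 bounds the p-th power of the Dirichlet norm
   of g_K by a multiple of K, whereas by Parseval and Jensen the p-th means of
   g_K reach (K/2)^(p/2).  If N_n contained a ball around f, it would contain
   f + d g_K and f - d g_K with d^p of order 1/K, and convexity would bound
   K^(p/2 - 1) independently of K. *)

From HB Require Import structures.
Require Import Defs.
From mathcomp Require Import all_boot all_order all_algebra.
From mathcomp Require Import all_classical all_reals all_analysis.
From mathcomp.real_closed Require Import complex.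
From mathcomp Require Import measurable_realfun ring lra.

Import Order.TTheory GRing.Theory Num.Theory.
Import numFieldNormedType.Exports.
Import ComplexField.Normc.
Local Open Scope classical_set_scope.
Local Open Scope ring_scope.
Local Open Scope complex_scope.

Set Implicit Arguments.
Unset Strict Implicit.
Unset Printing Implicit Defensive.

(** The mean inequality needs no second derivative of M. Clarkson's inequality is applied to F(z)
    and F(c) on a circle of radius r around c: the averages of F and of F times [conjc (cis t)] over
    it are F(c) and r F'(c), so Jensen's inequality turns the half sum and the half difference into
    |F(c)| and r |F'(c)| / 2. Both averages come from Goursat's bisection, done on polar rectangles
    so that circles appear as sides.

    The factor ((s - r) / 2)^p is too small when s - r is small against 1 - r. Each dyadic annulus
    is therefore tested against a circle beyond its outer rim, and the sum telescopes by two steps.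

    Rotation invariance replaces polar coordinates: on a rotation invariant set the integrand may be
    replaced by its average over rotations, and an annulus then contributes at most a constant times
    its area.

    For g_K the exponent 2 is essential: exponent p would bound the norm by the p-th means, which
    already reach (K/2)^(p/2), and nothing would be gained. The bound (1 - |z|^2) |g_K'| <= 4 pays
    for the remaining power p - 2. *)

Local Notation modulus := (@normc _).
Local Notation Re := (@complex.Re _).
Local Notation Im := (@complex.Im _).

(** * Complex differentiability *)

Section complex_plane.
Context {R : realType}.
Local Notation C := (R[i]^o).
Implicit Types (z w : R[i]).

Lemma modulusE z : modulus z = Num.sqrt (Re z ^+ 2 + Im z ^+ 2).
Proof. by case: z. Qed.

Lemma modulus_ge0 z : 0 <= modulus z.
Proof. by rewrite modulusE sqrtr_ge0. Qed.
Hint Resolve modulus_ge0 : core.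

Lemma sqr_modulus z : modulus z ^+ 2 = Re z ^+ 2 + Im z ^+ 2.
Proof. by rewrite modulusE sqr_sqrtr// addr_ge0// sqr_ge0. Qed.

Lemma normcE_modulus z : `|z| = (modulus z)%:C.
Proof. by []. Qed.

Lemma Re_le_modulus z : `|Re z| <= modulus z.
Proof.
rewrite -(@ler_pXn2r _ 2)// ?nnegrE//; rewrite sqr_modulus real_normK ?num_real//.
by rewrite lerDl sqr_ge0.
Qed.

Lemma Im_le_modulus z : `|Im z| <= modulus z.
Proof.
rewrite -(@ler_pXn2r _ 2)// ?nnegrE//; rewrite sqr_modulus real_normK ?num_real//.
by rewrite lerDr sqr_ge0.
Qed.

Lemma modulus_real (x : R) : modulus x%:C = `|x|.
Proof. by rewrite modulusE /= expr0n/= addr0 sqrtr_sqr. Qed.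

Lemma modulus_le z : modulus z <= `|Re z| + `|Im z|.
Proof.
rewrite -(@ler_pXn2r _ 2)// ?nnegrE ?addr_ge0//.
rewrite sqr_modulus sqrrD !real_normK ?num_real// addrAC lerDl.
by rewrite mulrn_wge0// mulr_ge0.
Qed.

Lemma ReD z w : Re (z + w) = Re z + Re w. Proof. by case: z w => [? ?] []. Qed.
Lemma ImD z w : Im (z + w) = Im z + Im w. Proof. by case: z w => [? ?] []. Qed.
Lemma ReN z : Re (- z) = - Re z. Proof. by case: z. Qed.
Lemma ImN z : Im (- z) = - Im z. Proof. by case: z. Qed.
Lemma ReB z w : Re (z - w) = Re z - Re w. Proof. by rewrite ReD ReN. Qed.
Lemma ImB z w : Im (z - w) = Im z - Im w. Proof. by rewrite ImD ImN. Qed.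
Lemma ReM z w : Re (z * w) = Re z * Re w - Im z * Im w.
Proof. by case: z w => [? ?] []. Qed.
Lemma ImM z w : Im (z * w) = Re z * Im w + Im z * Re w.
Proof. by case: z w => [? ?] []. Qed.
Lemma Re_conj z : Re (conjc z) = Re z. Proof. by case: z. Qed.
Lemma Im_conj z : Im (conjc z) = - Im z. Proof. by case: z. Qed.

Definition complexE2 := (ReD, ImD, ReN, ImN, ReM, ImM, Re_conj, Im_conj).

Lemma complex_ext z w : Re z = Re w -> Im z = Im w -> z = w.
Proof. by case: z w => [? ?] [? ?] /= -> ->. Qed.

Lemma modulus_conj z : modulus (conjc z) = modulus z.
Proof. by rewrite !modulusE Re_conj Im_conj sqrrN. Qed.

Lemma mul_conj z : conjc z * z = (modulus z ^+ 2)%:C.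
Proof. by apply: complex_ext; rewrite !complexE2 ?sqr_modulus /=; ring. Qed.

Lemma modulusB z w : modulus (z - w) = modulus (w - z).
Proof. by rewrite -normcN opprB. Qed.

Lemma modulus_eq0 z : modulus z = 0 -> z = 0.
Proof. exact: eq0_normc. Qed.

Lemma modulus0 : modulus (0 : R[i]) = 0. Proof. exact: normc0. Qed.

Lemma modulus_dist z w : `|modulus z - modulus w| <= modulus (z - w).
Proof.
have H a b : modulus a - modulus b <= modulus (a - b).
  by rewrite lerBlDr -[X in modulus X <= _](subrK b) le_normcD.
by rewrite ler_norml H andbT lerNl opprB modulusB H.
Qed.

(** A positive element of [R[i]] has imaginary part zero, so neighbourhoods can be tested with radii
    in [R]. *)
Lemma cvg_modulusP (T : Type) (F : set_system T) {FF : Filter F} (g : T -> C) (l : C) :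
  g @ F --> l <-> forall e : R, 0 < e -> \forall x \near F, modulus (g x - l) < e.
Proof.
split=> [/cvgrPdist_lt H e e0|H].
  have /H : (0 : R[i]) < e%:C by rewrite ltcR.
  by apply: filterS => x; rewrite normcE_modulus ltcR modulusB.
apply/cvgrPdist_lt => e; rewrite ltcE => /andP[/eqP e1 /= e2].
have /H : 0 < Re e by [].
apply: filterS => x; rewrite modulusB => xe.
by rewrite normcE_modulus ltcE /= xe e1 eqxx.
Qed.

Lemma near_modulus z (e : R) : 0 < e -> \forall w \near (z : C), modulus (w - z) < e.
Proof.
move=> e0; apply/nbhs_normP; exists (e%:C); first by rewrite /= ltcR.
by move=> w; rewrite /ball_/= normcE_modulus ltcR modulusB.
Qed.

Lemma continuous_Re : continuous (Re : C -> R).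
Proof.
move=> z; apply/(@cvgrPdist_lt R R C (nbhs (z : C)) _ Re) => e e0.
apply: (@filterS C (nbhs (z : C)) _ _ _ _ (near_modulus z e0)) => w; apply: le_lt_trans.
by rewrite -ReB modulusB Re_le_modulus.
Qed.

Lemma continuous_Im : continuous (Im : C -> R).
Proof.
move=> z; apply/(@cvgrPdist_lt R R C (nbhs (z : C)) _ Im) => e e0.
apply: (@filterS C (nbhs (z : C)) _ _ _ _ (near_modulus z e0)) => w; apply: le_lt_trans.
by rewrite -ImB modulusB Im_le_modulus.
Qed.

Lemma continuous_modulus : continuous (modulus : C -> R).
Proof.
move=> z; apply/(@cvgrPdist_lt R R C (nbhs (z : C)) _ modulus) => e e0.
apply: (@filterS C (nbhs (z : C)) _ _ _ _ (near_modulus z e0)) => w; apply: le_lt_trans.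
by rewrite modulusB modulus_dist.
Qed.

Lemma cvg_complex (T : Type) (F : set_system T) {FF : Filter F} (f g : T -> R) (a b : R) :
  f @ F --> a -> g @ F --> b -> ((f x +i* g x) : C) @[x --> F] --> (a +i* b : C).
Proof.
move=> /cvgrPdist_lt fa /cvgrPdist_lt gb; apply/cvg_modulusP => e e0.
have e2 : 0 < e / 2 by rewrite divr_gt0.
near=> x.
apply: le_lt_trans (modulus_le _) _.
rewrite [e]splitr ltrD//.
- rewrite ReB /= distrC; near: x; exact: fa.
- rewrite ImB /= distrC; near: x; exact: gb.
Unshelve. all: by end_near. Qed.

Lemma continuous_complex (T : topologicalType) (f g : T -> R) x :
  {for x, continuous f} -> {for x, continuous g} ->
  {for x, continuous (fun y => f y +i* g y : C)}.
Proof. by move=> cf cg; exact: cvg_complex. Qed.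

Lemma near_dnbhs_modulus (P : R[i] -> Prop) (r : R) : 0 < r ->
  (forall h, h != 0 -> modulus h < r -> P h) -> \forall h \near (0 : C)^', P h.
Proof.
move=> r0 HP; apply: (@filterS _ (nbhs (0 : C)) _ (fun h : C => modulus (h - 0) < r)).
  by move=> h; rewrite subr0 => hr h0; exact: HP.
exact: near_modulus.
Qed.

Lemma modulus_gt0 z : z != 0 -> 0 < modulus z.
Proof.
move=> z0; rewrite lt_neqAle modulus_ge0 andbT eq_sym.
by apply: contra z0 => /eqP/modulus_eq0 ->.
Qed.

(** Increment form of the complex derivative. There is no quotient and [h = 0] is allowed, so it can
    be restricted to segments and circles and composed by hand; [cdiffP] links it to [is_derive]. *)
Definition cdiff (F : R[i] -> R[i]) z d :=
  forall e : R, 0 < e -> exists2 r : R, 0 < r &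
    forall h, modulus h < r -> modulus (F (z + h) - F z - d * h) <= e * modulus h.

Lemma cdiffP F z d : cdiff F z d <-> is_derive (z : C) (1 : C) (F : C -> C) (d : C).
Proof.
split.
- move=> H.
  have cv : (h^-1 *: (((F : C -> C) \o shift (z:C)) (h *: (1:C)) - F z)) @[h --> (0:C)^'] --> (d:C).
    apply/cvg_modulusP => e e0.
    have e2 : 0 < e / 2 by rewrite divr_gt0.
    have [r r0 Hr] := H _ e2.
    apply: (near_dnbhs_modulus r0) => h h0 hr.
    rewrite /= /GRing.scale/= mulr1.
    have -> : h^-1 * (F (h + z) - F z) - d = h^-1 * (F (z + h) - F z - d * h).
      by rewrite [h + z]addrC [in RHS]mulrBr [_ * (d * h)]mulrCA mulVf// mulr1.
    rewrite normcM normcV mulrC ltr_pdivrMr ?modulus_gt0//.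
    apply: le_lt_trans (Hr _ hr) _.
    by rewrite ltr_pM2r ?modulus_gt0// ltr_pdivrMr// ltr_pMr// ltr1n.
  apply: DeriveDef; first by apply/cvg_ex; exists d.
  exact: (cvg_lim _ cv).
- move=> [] /cvg_ex [l Hl] dl e e0.
  have ld : l = d.
    by rewrite -dl /derive; apply/esym; apply: (cvg_lim _ Hl).
  subst l.
  move/cvg_modulusP/(_ _ e0): Hl; rewrite near_withinE /= => /nbhs_normP[r /= r0 Hr].
  exists (Re r); first by move: r0; rewrite ltcE => /andP[].
  move=> h hr.
  have [->|h0] := eqVneq h 0.
    by rewrite addr0 subrr mulr0 subr0 modulus0 mulr0.
  have /Hr/(_ h0) : ball_ (fun x => `|x|) (0:C) r h.
    rewrite /ball_/= sub0r normrN normcE_modulus ltcE /= hr.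
    by move: r0; rewrite ltcE => /andP[/eqP ->]; rewrite eqxx.
  rewrite /= /GRing.scale/= mulr1 [h + z]addrC.
  have -> : h^-1 * (F (z + h) - F z) - d = h^-1 * (F (z + h) - F z - d * h).
    by rewrite [in RHS]mulrBr [_ * (d * h)]mulrCA mulVf// mulr1.
  by rewrite normcM normcV mulrC ltr_pdivrMr ?modulus_gt0// => /ltW.
Qed.

Lemma cdiff_continuous F z d : cdiff F z d -> {for z, continuous (F : C -> C)}.
Proof.
move=> /cdiffP[Hd _].
by apply: differentiable_continuous; exact/derivable1_diffP.
Qed.

End complex_plane.
#[global] Hint Extern 0 (is_true (@Order.le _ _ _ (normc _))) => solve [apply: modulus_ge0] : core.

(** * Integrals of continuous functions over segments *)

Section integral_continuous.
Context {R : realType}.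
Implicit Types (f g : R -> R) (a b k m : R).
Local Notation mu := (@lebesgue_measure R).

Definition itg a b f : R := \int[mu]_(t in `[a, b]) f t.

(** Two-sided continuity, at the end points too, so that the pointwise limit rules apply without a
    subspace topology. *)
Definition cont_on a b f := forall x, a <= x <= b -> {for x, continuous f}.

Lemma continuous_cont_on a b f : continuous f -> cont_on a b f.
Proof. by move=> cf x _; exact: cf. Qed.

Lemma cont_on_within a b f : cont_on a b f -> {within `[a, b], continuous f}.
Proof.
move=> cf; apply: continuous_in_subspaceT => x.
by rewrite inE/= in_itv/= => /cf.
Qed.

Lemma cont_on_integrable a b f : cont_on a b f -> mu.-integrable `[a, b] (EFin \o f).
Proof.
move=> cf; apply: continuous_compact_integrable; first exact: segment_compact.
exact: cont_on_within.
Qed.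
Hint Resolve cont_on_integrable : core.

Lemma cont_onB a b f g : cont_on a b f -> cont_on a b g -> cont_on a b (fun t => f t - g t).
Proof. by move=> cf cg x xab; apply: cvgB; [exact: cf|exact: cg]. Qed.

Lemma cont_onM a b f g : cont_on a b f -> cont_on a b g -> cont_on a b (fun t => f t * g t).
Proof. by move=> cf cg x xab; apply: cvgM; [exact: cf|exact: cg]. Qed.

Lemma cont_on_cst a b k : cont_on a b (fun=> k).
Proof. by move=> x _; exact: cst_continuous. Qed.

Lemma cont_on_norm a b f : cont_on a b f -> cont_on a b (fun t => `|f t|).
Proof. by move=> cf x xab; apply: cvg_norm; exact: cf. Qed.

Lemma eq_itg a b f g : (forall x, a <= x <= b -> f x = g x) -> itg a b f = itg a b g.
Proof. by move=> fg; apply: eq_Rintegral => x; rewrite inE/= in_itv/= => /fg. Qed.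

Lemma itgD a b f g : cont_on a b f -> cont_on a b g ->
  itg a b (fun t => f t + g t) = itg a b f + itg a b g.
Proof. by move=> cf cg; rewrite /itg RintegralD; auto. Qed.

Lemma itgB a b f g : cont_on a b f -> cont_on a b g ->
  itg a b (fun t => f t - g t) = itg a b f - itg a b g.
Proof. by move=> cf cg; rewrite /itg RintegralB; auto. Qed.

Lemma itgZ a b k f : cont_on a b f -> itg a b (fun t => k * f t) = k * itg a b f.
Proof. by move=> cf; rewrite /itg RintegralZl; auto. Qed.

Lemma itg_cst a b k : a <= b -> itg a b (fun=> k) = k * (b - a).
Proof.
move=> ab; rewrite /itg Rintegral_cst//= lebesgue_measure_itv/= lte_fin.
by case: ltgtP ab => // -> _; rewrite subrr.
Qed.

Lemma le_itg a b f g : cont_on a b f -> cont_on a b g ->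
  (forall x, a <= x <= b -> f x <= g x) -> itg a b f <= itg a b g.
Proof.
by move=> cf cg fg; apply: le_Rintegral; auto.
Qed.

Lemma itg_bound a b f k m : a <= b -> cont_on a b f ->
  (forall x, a <= x <= b -> `|f x - k| <= m) ->
  `|itg a b f - k * (b - a)| <= m * (b - a).
Proof.
move=> ab cf fk; rewrite -itg_cst// -itgB//; last exact: cont_on_cst.
rewrite /itg; apply: le_trans (le_normr_Rintegral _ _) _ => //.
  by apply: cont_on_integrable; apply: cont_onB => //; exact: cont_on_cst.
rewrite -(itg_cst m ab); apply: le_itg.
- by apply: cont_on_norm; apply: cont_onB => //; exact: cont_on_cst.
- exact: cont_on_cst.
- exact: fk.
Qed.

Lemma itg_split a c b f : a <= c -> c <= b -> cont_on a b f ->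
  itg a b f = itg a c f + itg c b f.
Proof.
move=> ac cb cf.
have /= := @Rintegral_itvB _ _ (BLeft a) (BRight b) c (cont_on_integrable cf).
rewrite !bnd_simp Rintegral_itv_obnd_cbnd; last first.
  apply: integrableS (cont_on_integrable cf) => //.
  by apply: subset_itv => //; rewrite bnd_simp.
by rewrite /itg => <-//; rewrite addrC subrK.
Qed.

Lemma itg_FTC a b (f F : R -> R) : a <= b -> (forall x : R, is_derive x (1 : R) F (f x)) -> continuous f ->
  itg a b f = F b - F a.
Proof.
rewrite le_eqVlt => /predU1P[-> HF cf|ab HF cf].
  by rewrite /itg set_itv1 Rintegral_set1 subrr.
have cF : continuous F.
  by move=> x; apply: differentiable_continuous; apply/derivable1_diffP; case: (HF x).
rewrite /itg /Rintegral (@continuous_FTC2 _ f F a b)//.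
- by apply: cont_on_within; exact: continuous_cont_on.
- split; first by move=> x _; case: (HF x).
  + by apply: cvg_at_right_filter; exact: cF.
  + by apply: cvg_at_left_filter; exact: cF.
- by move=> x _; rewrite derive1E; case: (HF x).
Qed.

Lemma itg_ge0 a b f : (forall x, a <= x <= b -> 0 <= f x) -> 0 <= itg a b f.
Proof. by move=> f0; apply: Rintegral_ge0 => x /=; rewrite in_itv; exact: f0. Qed.

End integral_continuous.
#[global] Hint Resolve cont_on_integrable : core.

(** * Mean values of holomorphic functions *)

Section bisection.
Context {R : realType}.

Lemma exists_half_lt (x d : R) : 0 < d -> exists n, x / 2 ^+ n < d.
Proof.
move=> d0; exists (Num.bound (`|x| / d)).
have := archi_boundP (divr_ge0 (normr_ge0 x) (ltW d0)).
set n := Num.bound _ => xn; rewrite ltr_pdivrMr ?exprn_gt0//.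
apply: le_lt_trans (ler_norm x) _; rewrite mulrC -ltr_pdivrMr//.
by apply: lt_le_trans xn _; rewrite -natrX ler_nat ltnW// ltn_expl.
Qed.

(** The common point is the supremum of the left end points; by [all], every right end point bounds
    them from above. *)
Lemma nested_intervals (W : R) (x : nat -> R) : 0 <= W ->
  (forall n, x n <= x n.+1 /\ x n.+1 <= x n + W / 2 ^+ n.+1) ->
  exists r, forall n, x n <= r /\ r <= x n + W / 2 ^+ n.
Proof.
move=> W0 xS.
have pos n : 0 <= W / 2 ^+ n by rewrite divr_ge0// exprn_ge0.
have step n : W / 2 ^+ n = W / 2 ^+ n.+1 + W / 2 ^+ n.+1.
  by rewrite exprS; field; rewrite expf_neq0// pnatr_eq0.
have mono n k : x n <= x (n + k)%N.
  by elim: k => [|k IH]; rewrite ?addn0// addnS (le_trans IH)//; case: (xS (n + k)%N).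
have ub n k : x (n + k)%N + W / 2 ^+ (n + k) <= x n + W / 2 ^+ n.
  elim: k => [|k IH]; first by rewrite addn0.
  apply: le_trans IH; rewrite addnS; have [_ H] := xS (n + k)%N.
  by rewrite [X in _ <= _ + X]step addrA lerD2r.
have all m n : x m <= x n + W / 2 ^+ n.
  have [mn|nm] := leqP m n.
    rewrite -(subnKC mn); apply: le_trans (mono m (n - m)%N) _.
    by rewrite lerDl.
  rewrite -(subnKC (ltnW nm)); apply: le_trans (ub n (m - n)%N).
  by rewrite lerDl.
exists (sup (range x)) => n; split.
- apply: ub_le_sup; last by exists n.
  by exists (x 0%N + W / 2 ^+ 0) => _ [k _ <-].
- by apply: ge_sup; [exists (x 0%N), 0%N | move=> _ [k _ <-]].
Qed.

(* Goursat's bisection, for an abstract additive function of rectangles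
   that is infinitesimally small compared with the squared size *)
Lemma bisection_eq0 (J : R -> R -> R -> R -> R) (S1 S2 A B : R) :
  S1 <= S2 -> A <= B ->
  (forall s1 m s2 a b, S1 <= s1 -> s1 <= m -> m <= s2 -> s2 <= S2 ->
     A <= a -> a <= b -> b <= B -> J s1 s2 a b = J s1 m a b + J m s2 a b) ->
  (forall s1 s2 a m b, S1 <= s1 -> s1 <= s2 -> s2 <= S2 ->
     A <= a -> a <= m -> m <= b -> b <= B -> J s1 s2 a b = J s1 s2 a m + J s1 s2 m b) ->
  (forall r t e, S1 <= r <= S2 -> A <= t <= B -> 0 < e -> exists2 d, 0 < d &
    forall s1 s2 a b, S1 <= s1 -> s1 <= r -> r <= s2 -> s2 <= S2 ->
      A <= a -> a <= t -> t <= b -> b <= B -> s2 - s1 < d -> b - a < d ->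
      `|J s1 s2 a b| <= e * ((s2 - s1) + (b - a)) ^+ 2) ->
  J S1 S2 A B = 0.
Proof.
move=> S12 AB addJ1 addJ2 locJ.
pose W := S2 - S1; pose H := B - A; pose m := `|J S1 S2 A B|.
have W0 : 0 <= W by rewrite subr_ge0.
have H0 : 0 <= H by rewrite subr_ge0.
apply: contrapT => /eqP J0; have m0 : 0 < m by rewrite normr_gt0.
pose w n := W / 2 ^+ n; pose h n := H / 2 ^+ n.
have w0 n : 0 <= w n by rewrite divr_ge0// exprn_ge0.
have h0 n : 0 <= h n by rewrite divr_ge0// exprn_ge0.
have wS n : w n = w n.+1 + w n.+1.
  by rewrite /w exprS; field; rewrite expf_neq0// pnatr_eq0.
have hS n : h n = h n.+1 + h n.+1.
  by rewrite /h exprS; field; rewrite expf_neq0// pnatr_eq0.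
(* Of the four quarters of a rectangle, one carries at least a quarter of [J]; [m / 4 ^+ n] is what
   survives after [n] subdivisions. *)
pose bad n (p : R * R) := [/\ S1 <= p.1, p.1 + w n <= S2, A <= p.2, p.2 + h n <= B &
  m / 4 ^+ n <= `|J p.1 (p.1 + w n) p.2 (p.2 + h n)|].
have step (np : nat * (R * R)) : exists q : R * R, bad np.1 np.2 -> [/\ bad np.1.+1 q,
   np.2.1 <= q.1 /\ q.1 <= np.2.1 + w np.1.+1 & np.2.2 <= q.2 /\ q.2 <= np.2.2 + h np.1.+1].
  case: np => n [x y] /=.
  have [[/= x1 x2 y1 y2 bd]|nb] := pselect (bad n (x, y)); last by exists 0.
  have := w0 n.+1; have := h0 n.+1; move: x2 y2 bd; rewrite wS hS.
  set w' := w n.+1; set h' := h n.+1 => x2 y2 + h'0 w'0.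
  rewrite (addJ1 _ (x + w'))//; [|lra..].
  rewrite (addJ2 _ _ _ (y + h'))//; [|lra..].
  rewrite (addJ2 (x + w') _ _ (y + h'))//; [|lra..].
  have -> : m / 4 ^+ n = (m / 4 ^+ n.+1) *+ 4.
    by rewrite exprS -mulr_natr; field; rewrite expf_neq0// pnatr_eq0.
  set mm := m / 4 ^+ n.+1.
  rewrite !addrA => bd.
  have [b1|b1] := leP mm `|J x (x + w') y (y + h')|.
    by exists (x, y) => _; split => /=; [split => //=; rewrite -/w' -/h'; lra|split; lra|split; lra].
  have [b2|b2] := leP mm `|J x (x + w') (y + h') (y + h' + h')|.
    by exists (x, y + h') => _; split => /=; [split => //=; rewrite -/w' -/h'; lra|split; lra|split; lra].
  have [b3|b3] := leP mm `|J (x + w') (x + w' + w') y (y + h')|.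
    by exists (x + w', y) => _; split => /=; [split => //=; rewrite -/w' -/h'; lra|split; lra|split; lra].
  have [b4|b4] := leP mm `|J (x + w') (x + w' + w') (y + h') (y + h' + h')|.
    by exists (x + w', y + h') => _; split => /=; [split => //=; rewrite -/w' -/h'; lra|split; lra|split; lra].
  exfalso; move: bd; rewrite leNgt => /negP; apply.
  rewrite -!addrA in b1 b2 b3 b4 *.
  apply: le_lt_trans (ler_normD _ _) _; apply: le_lt_trans (lerD (lexx _) (ler_normD _ _)) _.
  apply: le_lt_trans (lerD (lexx _) (lerD (lexx _) (ler_normD _ _))) _.
  by rewrite -mulr_natr; lra.
have [st Hst] := choice step.
pose q := fix q n := if n is n'.+1 then st (n', q n') else (S1, A).
have badq n : bad n (q n).
  elim: n => [|n IH]; last by have [] := Hst (n, q n) IH.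
  by split => //=; rewrite /w /h expr0 ?divr1 /W /H ?(addrC _ (_ - _)) ?subrK.
have qS n := Hst (n, q n) (badq n).
have [r Hr] : exists r, forall n, (q n).1 <= r /\ r <= (q n).1 + w n.
  by apply: nested_intervals => // n; have [] := qS n.
have [t Ht] : exists r, forall n, (q n).2 <= r /\ r <= (q n).2 + h n.
  by apply: nested_intervals => // n; have [] := qS n.
(* At level [n] both the lower bound for [J] and the squared size carry the factor [4 ^- n]. This
   [e] makes [e * (W + H) ^+ 2 < m], the contradiction; the [+ 1] covers the degenerate
   rectangle. *)
pose e := m / ((W + H) ^+ 2 + 1).
have D0 : 0 < (W + H) ^+ 2 + 1 by rewrite ltr_wpDl// sqr_ge0.
have e0 : 0 < e by rewrite divr_gt0.
have rS : S1 <= r <= S2.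
  have [x1 x2 _ _ _] := badq 0%N; have [] := Hr 0%N => ? ?; apply/andP; split; lra.
have tS : A <= t <= B.
  have [_ _ x1 x2 _] := badq 0%N; have [] := Ht 0%N => ? ?; apply/andP; split; lra.
have [d d0 Hd] := locJ r t e rS tS e0.
have [n Hn] := exists_half_lt (W + H) d0.
have wn : w n + h n < d by rewrite /w /h -mulrDl.
have [x1 x2 y1 y2 bd] := badq n.
have [r1 r2] := Hr n; have [t1 t2] := Ht n.
have := w0 n; have := h0 n => hn wn0.
have : `|J (q n).1 ((q n).1 + w n) (q n).2 ((q n).2 + h n)| <= e * (w n + h n) ^+ 2.
  have := Hd _ _ _ _ x1 r1 r2 x2 y1 t1 t2 y2.
  rewrite [_ + w n - _]addrAC subrr add0r [_ + h n - _]addrAC subrr add0r.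
  by apply; lra.
move/(le_trans bd); apply/negP; rewrite -ltNge.
rewrite /w /h -mulrDl expr_div_n -exprM mulnC exprM (_ : 2 ^+ 2 = 4)//; last by rewrite -natrX.
rewrite mulrA ltr_pM2r ?invr_gt0 ?exprn_gt0// /e mulrAC ltr_pdivrMr//.
by rewrite ltr_pM2l// ltrDl.
Qed.

End bisection.

Section circles.
Context {R : realType}.
Local Notation C := (R[i]^o).
Implicit Types (z w c : R[i]) (F : R[i] -> R[i]).

Definition cis (t : R) : R[i] := cos t +i* sin t.

Lemma modulus_cis t : modulus (cis t) = 1.
Proof. by rewrite /= cos2Dsin2 sqrtr1. Qed.

Lemma cisD a b : cis (a + b) = cis a * cis b.
Proof. by apply: complex_ext; rewrite !complexE2 /= ?cosD ?sinD; ring. Qed.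

Lemma cis_conj t : conjc (cis t) * cis t = 1.
Proof. by rewrite mul_conj modulus_cis expr1n. Qed.

Lemma cis0 : cis 0 = 1. Proof. by rewrite /cis cos0 sin0. Qed.

Lemma cis2pi : cis (2 * pi) = 1.
Proof. by rewrite /cis mulr_natl cos2pi sin2pi. Qed.

Lemma continuous_cis : continuous (cis : R -> C).
Proof. by move=> t; apply: continuous_complex; [exact: continuous_cos|exact: continuous_sin]. Qed.

Lemma lipschitz_of_derive (f df : R -> R) a b k : (forall x : R, is_derive x (1:R) f (df x)) ->
  (forall x, `|df x| <= k) -> `|f b - f a| <= k * `|b - a|.
Proof.
move=> fd dfk.
wlog ab : a b / a <= b => [H|].
  have [/H//|/ltW/H] := leP a b; by rewrite distrC [`|a - b|]distrC.
have cf : {within `[a, b], continuous f}.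
  apply: continuous_in_subspaceT => x _; apply: differentiable_continuous.
  by apply/derivable1_diffP; case: (fd x).
have [x _ ->] := MVT_segment ab (fun x _ => fd x) cf.
by rewrite normrM ler_wpM2r.
Qed.

Lemma cis_lipschitz a b : modulus (cis b - cis a) <= 2 * `|b - a|.
Proof.
apply: le_trans (modulus_le _) _; rewrite ReB ImB /= mulr_natl mulr2n lerD//.
- rewrite -[leRHS]mul1r; apply: (@lipschitz_of_derive _ (fun x => - sin x)).
  by move=> x; rewrite normrN sin_max.
- rewrite -[leRHS]mul1r; apply: (@lipschitz_of_derive _ cos).
  by move=> x; rewrite cos_max.
Qed.

Definition polar c (r t : R) : R[i] := c + r%:C * cis t.

Lemma modulus_polar c r t : modulus (polar c r t - c) = `|r|.
Proof. by rewrite /polar addrAC subrr add0r normcM modulus_real modulus_cis mulr1. Qed.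

Lemma polar_dist c r t r' t' :
  modulus (polar c r t - polar c r' t') <= `|r - r'| + 2 * `|r'| * `|t - t'|.
Proof.
rewrite /polar opprD addrACA subrr add0r.
have -> : r%:C * cis t - r'%:C * cis t' = (r - r')%:C * cis t + r'%:C * (cis t - cis t').
  by rewrite rmorphB mulrBr mulrBl addrA subrK.
apply: le_trans (le_normcD _ _) _; rewrite !normcM !modulus_real modulus_cis mulr1 lerD//.
by rewrite -mulrA mulrCA ler_wpM2l// cis_lipschitz.
Qed.

Lemma continuous_polar_t c r : continuous (polar c r : R -> C).
Proof.
move=> t; apply: cvgD; first exact: cvg_cst.
by apply: cvgM; [exact: cvg_cst|exact: continuous_cis].
Qed.

Lemma continuous_RtoC : continuous (fun x : R => x%:C : C).
Proof. by move=> x; apply: continuous_complex => //; exact: cst_continuous. Qed.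

Lemma continuous_polar_r c t : continuous (fun r => polar c r t : C).
Proof.
move=> r; apply: cvgD; first exact: cvg_cst.
by apply: cvgM; [exact: continuous_RtoC|exact: cvg_cst].
Qed.

Lemma continuousC_comp (T : topologicalType) (g : T -> C) F x : {for x, continuous g} ->
  {for g x, continuous (F : C -> C)} -> {for x, continuous (fun y => F (g y) : C)}.
Proof. by move=> cg cF; exact: (@continuous_comp T C C g F x cg cF). Qed.

Lemma continuousCZ (T : topologicalType) (k : R[i]) (g : T -> C) x : {for x, continuous g} ->
  {for x, continuous (fun y => (k * g y : R[i]) : C)}.
Proof. by move=> cg; apply: cvgM; [exact: cvg_cst|exact: cg]. Qed.

Lemma continuous_Re_comp (T : topologicalType) (g : T -> C) F x : {for x, continuous g} ->
  {for g x, continuous (F : C -> C)} -> {for x, continuous (fun y => Re (F (g y)))}.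
Proof.
move=> cg cF; apply: (@continuous_comp _ _ _ (fun y => F (g y) : C) (Re : C -> R)).
  exact: (@continuous_comp T C C g F x cg cF).
exact: continuous_Re.
Qed.

Lemma continuous_Im_comp (T : topologicalType) (g : T -> C) F x : {for x, continuous g} ->
  {for g x, continuous (F : C -> C)} -> {for x, continuous (fun y => Im (F (g y)))}.
Proof.
move=> cg cF; apply: (@continuous_comp _ _ _ (fun y => F (g y) : C) (Im : C -> R)).
  exact: (@continuous_comp T C C g F x cg cF).
exact: continuous_Im.
Qed.

Lemma continuous_mulC (d : R[i]) : continuous (fun z : C => (d * z : R[i]) : C).
Proof. exact: mulrl_continuous. Qed.

(** The integral of [d * cis t] is [d * (cis b - cis a)] divided by i, and dividing by i turns the
    imaginary part into the real part. *)
Lemma itg_Re_cis (d : R[i]) a b : a <= b ->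
  itg a b (fun t => Re (d * cis t)) = Im (d * (cis b - cis a)).
Proof.
move=> ab.
have dG (x : R) : is_derive x (1 : R) (Re d *: (sin : R -> R) + Im d *: (cos : R -> R)) (Re (d * cis x)).
  have -> : Re (d * cis x) = Re d *: cos x + Im d *: - sin x.
    by rewrite !complexE2 /GRing.scale /=; ring.
  by apply: is_deriveD; apply: is_deriveZ.
rewrite (itg_FTC ab dG).
  rewrite !complexE2 /= !fctE /GRing.scale /=; ring.
move=> x; apply: (@continuous_Re_comp _ cis (fun z => d * z)); first exact: continuous_cis.
exact: continuous_mulC.
Qed.

(** * Goursat's theorem on polar rectangles *)

Section goursat.
Variables (F : R[i] -> R[i]) (c : R[i]) (S1 S2 : R).
Hypotheses (S1_gt0 : 0 < S1)
  (dF : forall z, S1 <= modulus (z - c) <= S2 -> exists d, cdiff F z d).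
Let U r t := Re (F (polar c r t)).
Let V r t := Im (F (polar c r t)).
(* imaginary part of the integral of F(z) dz / (z - c) along the boundary of a polar rectangle *)
Let J s1 s2 a b := itg a b (fun t => U s2 t - U s1 t) -
  itg s1 s2 (fun r => (V r b - V r a) / r).

Let cF r t : S1 <= r <= S2 -> {for polar c r t, continuous (F : C -> C)}.
Proof.
move=> rS; have r0 : 0 <= r by case/andP: rS => + _; apply: le_trans (ltW S1_gt0).
have [|d] := @dF (polar c r t); first by rewrite modulus_polar ger0_norm.
exact: cdiff_continuous.
Qed.

Let cU r a b : S1 <= r <= S2 -> cont_on a b (U r).
Proof.
by move=> rS t _; apply: continuous_Re_comp; [exact: continuous_polar_t|exact: cF].
Qed.

Let cVr t s1 s2 : S1 <= s1 -> s2 <= S2 -> cont_on s1 s2 (V^~ t).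
Proof.
move=> s1S s2S r /andP[rs1 rs2]; apply: continuous_Im_comp; first exact: continuous_polar_r.
by apply: cF; rewrite (le_trans s1S rs1) (le_trans rs2 s2S).
Qed.

Let cV a b s1 s2 : S1 <= s1 -> s2 <= S2 -> cont_on s1 s2 (fun r => (V r b - V r a) / r).
Proof.
move=> s1S s2S; apply: cont_onM.
  by apply: cont_onB; exact: cVr.
move=> r /andP[rs1 rs2]; apply: continuousV.
  by rewrite gt_eqF// (lt_le_trans S1_gt0)// (le_trans s1S).
exact: cvg_id.
Qed.

Let addJ1 s1 m s2 a b : S1 <= s1 -> s1 <= m -> m <= s2 -> s2 <= S2 ->
  J s1 s2 a b = J s1 m a b + J m s2 a b.
Proof.
move=> h1 h2 h3 h4.
have hm : S1 <= m <= S2 by apply/andP; split; lra.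
have hs1 : S1 <= s1 <= S2 by apply/andP; split; lra.
have hs2 : S1 <= s2 <= S2 by apply/andP; split; lra.
rewrite /J !itgB; auto.
rewrite (@itg_split _ s1 m s2)//; last exact: cV.
lra.
Qed.

Let addJ2 s1 s2 a m b : S1 <= s1 -> s1 <= s2 -> s2 <= S2 ->
  a <= m -> m <= b -> J s1 s2 a b = J s1 s2 a m + J s1 s2 m b.
Proof.
move=> h1 h2 h3 h4 h5.
have hs1 : S1 <= s1 <= S2 by apply/andP; split; lra.
have hs2 : S1 <= s2 <= S2 by apply/andP; split; lra.
rewrite /J (@itg_split _ a m b)//; last by apply: cont_onB; exact: cU.
rewrite (@eq_itg _ s1 s2 (fun r => (V r b - V r a) / r)
   (fun r => (V r m - V r a) / r + (V r b - V r m) / r)); last first.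
  by move=> r _; ring.
rewrite [itg s1 s2 (fun r => _ + _)]itgD; try exact: cV.
by ring.
Qed.

Let D1 := 1 + 2 * S2.
Let D2 := 1 + S1^-1.

(** Near [z0], [F] is affine up to an error [E] that is small against the size of the rectangle. The
    affine part contributes the same amount to the arcs and to the radial sides, hence nothing to
    [J]. [D1] converts side lengths into distances to [z0]; [D2] collects the factor 1 of the arcs
    and the factor 1/S1 coming from the division by the radius. *)
Let locJ r0 t0 e : S1 <= r0 <= S2 -> 0 < e -> exists2 d, 0 < d &
  forall s1 s2 a b, S1 <= s1 -> s1 <= r0 -> r0 <= s2 -> s2 <= S2 ->
    a <= t0 -> t0 <= b -> s2 - s1 < d -> b - a < d ->
    `|J s1 s2 a b| <= e * ((s2 - s1) + (b - a)) ^+ 2.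
Proof.
move=> /andP[r0S1 r0S2] e0; pose z0 := polar c r0 t0.
have r0_gt0 : 0 < r0 by exact: lt_le_trans r0S1.
have S2_gt0 : 0 < S2 by exact: lt_le_trans r0S2.
have [|l Hl] := @dF z0; first by rewrite modulus_polar gtr0_norm// r0S1.
have D1_gt0 : 0 < D1 by rewrite /D1 ltr_wpDr// mulr_ge0// ltW.
have D2_gt0 : 0 < D2 by rewrite /D2 ltr_wpDr// invr_ge0 ltW.
(* Chosen so that the final bound [2 * M * (D2 * sz)] is exactly [e * sz ^+ 2]. *)
pose k := 2 * D1 * D2.
have k0 : 0 < k by rewrite !mulr_gt0.
have ek0 : 0 < e / k by rewrite divr_gt0.
have [d d0 Hd] := Hl _ ek0.
exists (d / (2 * D1)); first by rewrite divr_gt0// mulr_gt0.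
move=> s1 s2 a b s1S s1r rs2 s2S at0 t0b ds db.
set sz := (s2 - s1) + (b - a).
have sz0 : 0 <= sz by rewrite /sz; lra.
have szd : D1 * sz < d.
  have -> : d = D1 * (d / (2 * D1) + d / (2 * D1)) by field; rewrite gt_eqF.
  by rewrite ltr_pM2l// ltrD.
pose E z := F z - F z0 - l * (z - z0).
have EH r t : s1 <= r -> r <= s2 -> a <= t -> t <= b ->
    modulus (E (polar c r t)) <= e / k * (D1 * sz).
  move=> h1 h2 h3 h4.
  have dist : modulus (polar c r t - z0) <= D1 * sz.
    apply: le_trans (polar_dist _ _ _ _ _) _.
    have -> : D1 * sz = sz + 2 * S2 * sz by rewrite /D1; ring.
    apply: lerD.
      by rewrite ler_norml /sz; apply/andP; split; lra.
    apply: ler_pM; rewrite ?mulr_ge0//; first by rewrite ler_pM2l// gtr0_norm.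
    by rewrite ler_norml /sz; apply/andP; split; lra.
  have := Hd (polar c r t - z0) (le_lt_trans dist szd).
  rewrite [z0 + _]addrC subrK => /le_trans; apply.
  by rewrite ler_wpM2l// ltW.
set M := e / k * (D1 * sz) in EH.
have M0 : 0 <= M by apply: mulr_ge0; [exact: ltW|apply: mulr_ge0 => //; exact: ltW].
have FE z : F z = F z0 + l * (z - z0) + E z by rewrite /E; ring.
have hs1 : S1 <= s1 <= S2 by apply/andP; split; lra.
have hs2 : S1 <= s2 <= S2 by apply/andP; split; lra.
have ab : a <= b by exact: le_trans t0b.
have s12 : s1 <= s2 by exact: le_trans rs2.
(* The share of the linear part [l * (z - z0)] in each of the two integrals; constants cancel in the
   differences of [U] and of [V]. *)
pose Q := Im (l * (cis b - cis a)) * (s2 - s1).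
have cl : cont_on a b (fun t => (s2 - s1) * Re (l * cis t)).
  apply: cont_onM; first exact: cont_on_cst.
  move=> t _; apply: (@continuous_Re_comp _ cis (fun z => l * z)).
    exact: continuous_cis.
  exact: continuous_mulC.
have I1 : `|itg a b (fun t => U s2 t - U s1 t) - Q| <= 2 * M * (b - a).
  have -> : Q = itg a b (fun t => (s2 - s1) * Re (l * cis t)).
    rewrite itgZ.
      by rewrite itg_Re_cis// /Q mulrC.
    move=> t _; apply: (@continuous_Re_comp _ cis (fun z => l * z)).
      exact: continuous_cis.
    exact: continuous_mulC.
  rewrite -itgB//; last by apply: cont_onB; exact: cU.
  rewrite -[X in `|X|]subr0 -[X in _ - X](mul0r (b - a)).
  apply: itg_bound => //.
    by apply: cont_onB => //; apply: cont_onB; exact: cU.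
  move=> t /andP[ta tb]; rewrite subr0.
  have -> : U s2 t - U s1 t - (s2 - s1) * Re (l * cis t) =
     Re (E (polar c s2 t)) - Re (E (polar c s1 t)).
    by rewrite /U (FE (polar c s2 t)) (FE (polar c s1 t)) /polar !complexE2 /=; ring.
  apply: le_trans (ler_normB _ _) _.
  rewrite mulr_natl mulr2n lerD// (le_trans (Re_le_modulus _))// EH//.
have I2 : `|itg s1 s2 (fun r => (V r b - V r a) / r) - Q| <= 2 * M / S1 * (s2 - s1).
  apply: itg_bound => //; first exact: cV.
  move=> r /andP[rs1 rs2'].
  have r_gt0 : 0 < r by apply: lt_le_trans S1_gt0 _; lra.
  have -> : (V r b - V r a) / r - Im (l * (cis b - cis a)) =
      (Im (E (polar c r b)) - Im (E (polar c r a))) / r.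
    rewrite /V (FE (polar c r b)) (FE (polar c r a)) /polar !complexE2 /=.
    by field; rewrite gt_eqF.
  rewrite normrM ler_pM//.
    apply: le_trans (ler_normB _ _) _.
    by rewrite mulr_natl mulr2n lerD// (le_trans (Im_le_modulus _))// EH.
  rewrite normfV gtr0_norm// lef_pV2//; lra.
have -> : J s1 s2 a b = (itg a b (fun t => U s2 t - U s1 t) - Q) -
   (itg s1 s2 (fun r => (V r b - V r a) / r) - Q) by rewrite /J; ring.
apply: le_trans (ler_normB _ _) _; apply: le_trans (lerD I1 I2) _.
have -> : e * sz ^+ 2 = 2 * M * (D2 * sz).
  by rewrite /M /k; field; rewrite !gt_eqF.
have -> : 2 * M * (b - a) + 2 * M / S1 * (s2 - s1) = 2 * M * ((b - a) + S1^-1 * (s2 - s1)) by ring.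
apply: ler_wpM2l; first by rewrite mulr_ge0.
have -> : D2 * sz = sz + S1^-1 * sz by rewrite /D2; ring.
apply: lerD; first by rewrite /sz; lra.
by apply: ler_wpM2l; rewrite ?invr_ge0 ?(ltW S1_gt0)// /sz; lra.
Qed.

(** Over a full turn the two radial sides coincide, because [cis (2 * pi) = cis 0], and only the two
    circles remain in [J]. The hypothesis concerns the closed annulus alone, so the centre may be a
    singular point. *)
Lemma circle_int_Re_eq : S1 <= S2 ->
  itg 0 (2 * pi) (fun t => Re (F (polar c S2 t))) = itg 0 (2 * pi) (fun t => Re (F (polar c S1 t))).
Proof.
move=> S12.
have pi0 : 0 <= 2 * pi :> R by rewrite mulr_ge0// pi_ge0.
have : J S1 S2 0 (2 * pi) = 0.
  apply: bisection_eq0 => //.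
  - by move=> s1 m s2 a b h1 h2 h3 h4 _ _ _; exact: addJ1.
  - by move=> s1 s2 a m b h1 h2 h3 _ h4 h5 _; exact: addJ2.
  - move=> r t e hr _ e0; have [d d0 Hd] := locJ t hr e0; exists d => //.
    by move=> s1 s2 a b h1 h2 h3 h4 _ h5 h6 _; exact: Hd.
have hs1 : S1 <= S1 <= S2 by rewrite lexx.
have hs2 : S1 <= S2 <= S2 by rewrite lexx andbT.
rewrite /J itgB; auto.
rewrite (@eq_itg _ S1 S2 _ (fun=> 0)); last first.
  by move=> r _; rewrite /V /polar cis2pi cis0 subrr mul0r.
rewrite itg_cst// mul0r subr0 => /eqP; rewrite subr_eq0 => /eqP; exact.
Qed.

End goursat.
End circles.

(** * Averages over circles, mean value property, Cauchy's formula for the derivative *)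

Section averages.
Context {R : realType}.
Local Notation C := (R[i]^o).
Implicit Types (f g : R -> R) (h : R -> R[i]).

Lemma twopi_gt0 : 0 < 2 * pi :> R.
Proof. by rewrite mulr_gt0// pi_gt0. Qed.

Definition avg f : R := (2 * pi)^-1 * itg 0 (2 * pi) f.

Let c0 f : continuous f -> cont_on 0 (2 * pi) f.
Proof. exact: continuous_cont_on. Qed.

Lemma eq_avg f g : f =1 g -> avg f = avg g.
Proof. by move=> fg; congr (_ * _); apply: eq_itg => x _. Qed.

Lemma avgD f g : continuous f -> continuous g -> avg (fun t => f t + g t) = avg f + avg g.
Proof. by move=> cf cg; rewrite /avg (itgD (c0 cf) (c0 cg)) mulrDr. Qed.

Lemma avgB f g : continuous f -> continuous g -> avg (fun t => f t - g t) = avg f - avg g.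
Proof. by move=> cf cg; rewrite /avg (itgB (c0 cf) (c0 cg)) mulrBr. Qed.

Lemma avgZ k f : continuous f -> avg (fun t => k * f t) = k * avg f.
Proof. by move=> cf; rewrite /avg (itgZ _ (c0 cf)) mulrCA. Qed.

Lemma avg_cst k : avg (fun=> k) = k.
Proof.
rewrite /avg itg_cst ?ltW ?twopi_gt0// subr0 mulrCA mulVf ?mulr1//.
by rewrite gt_eqF ?twopi_gt0.
Qed.

Lemma le_avg f g : continuous f -> continuous g -> (forall t, f t <= g t) -> avg f <= avg g.
Proof.
move=> cf cg fg; rewrite /avg ler_pM2l ?invr_gt0 ?twopi_gt0//.
by apply: le_itg => //; exact: c0.
Qed.

Lemma avg_ge0 f : (forall t, 0 <= f t) -> 0 <= avg f.
Proof.
move=> f0; rewrite /avg mulr_ge0 ?invr_ge0 ?(ltW twopi_gt0)//.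
by apply: itg_ge0.
Qed.

Lemma avg_bound f k m : continuous f -> (forall t, `|f t - k| <= m) -> `|avg f - k| <= m.
Proof.
move=> cf fk.
have fk' t : k - m <= f t /\ f t <= k + m.
  by have := fk t; rewrite ler_norml => /andP[]; lra.
rewrite ler_norml; apply/andP; split.
  rewrite -lerBlDr opprK addrC -(avg_cst (k - m)); apply: le_avg => //.
    exact: cst_continuous.
  by move=> t; have [] := fk' t.
rewrite lerBlDl -(avg_cst (k + m)); apply: le_avg => //.
  exact: cst_continuous.
by move=> t; have [] := fk' t.
Qed.

Lemma avg_FTC f (G : R -> R) : (forall x : R, is_derive x (1 : R) G (f x)) -> continuous f ->
  G (2 * pi) = G 0 -> avg f = 0.
Proof.
move=> dG cf G0; rewrite /avg (itg_FTC (ltW twopi_gt0) dG cf) G0.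
by rewrite subrr mulr0.
Qed.

Lemma avg_cos : avg cos = 0.
Proof.
apply: (@avg_FTC _ sin); first exact: continuous_cos.
by rewrite mulr_natl sin2pi sin0.
Qed.

Lemma avg_sin : avg sin = 0.
Proof.
apply: (@avg_FTC _ (- (cos : R -> R))).
- move=> x; have -> : sin x = - - sin x by rewrite opprK.
  by apply: is_deriveN.
- exact: continuous_sin.
- by rewrite !fctE mulr_natl cos2pi cos0.
Qed.

Definition cavg h : R[i] := avg (fun t => Re (h t)) +i* avg (fun t => Im (h t)).

Lemma eq_cavg h1 h2 : h1 =1 h2 -> cavg h1 = cavg h2.
Proof. by move=> e; congr (_ +i* _); apply: eq_avg => t; rewrite e. Qed.

Lemma cRe h : continuous (h : R -> C) -> continuous (fun t => Re (h t)).
Proof.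
by move=> ch t; apply: (@continuous_comp _ _ _ (h : R -> C) (Re : C -> R) t (ch t)); exact: continuous_Re.
Qed.

Lemma cIm h : continuous (h : R -> C) -> continuous (fun t => Im (h t)).
Proof.
by move=> ch t; apply: (@continuous_comp _ _ _ (h : R -> C) (Im : C -> R) t (ch t)); exact: continuous_Im.
Qed.

Lemma cmodulus h : continuous (h : R -> C) -> continuous (fun t => modulus (h t)).
Proof.
by move=> ch t; apply: (@continuous_comp _ _ _ (h : R -> C) (modulus : C -> R) t (ch t)); exact: continuous_modulus.
Qed.

Lemma continuous_cstC d : continuous ((fun=> d) : R -> C).
Proof. by move=> t; exact: cvg_cst. Qed.

Lemma continuousCB (h1 h2 : R -> R[i]) : continuous (h1 : R -> C) -> continuous (h2 : R -> C) ->
  continuous (fun t => (h1 t - h2 t : R[i]) : C).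
Proof. by move=> c1 c2 t; exact: (cvgB (c1 t) (c2 t)). Qed.

Lemma continuousCD (h1 h2 : R -> R[i]) : continuous (h1 : R -> C) -> continuous (h2 : R -> C) ->
  continuous (fun t => (h1 t + h2 t : R[i]) : C).
Proof. by move=> c1 c2 t; exact: (cvgD (c1 t) (c2 t)). Qed.

Lemma continuousCM (h1 h2 : R -> R[i]) : continuous (h1 : R -> C) -> continuous (h2 : R -> C) ->
  continuous (fun t => (h1 t * h2 t : R[i]) : C).
Proof. by move=> c1 c2 t; exact: (cvgM (c1 t) (c2 t)). Qed.

Lemma cavgB h1 h2 : continuous (h1 : R -> C) -> continuous (h2 : R -> C) ->
  cavg (fun t => h1 t - h2 t) = cavg h1 - cavg h2.
Proof.
move=> c1 c2; apply: complex_ext; rewrite ?ReB ?ImB /= -avgB; try exact: cRe; try exact: cIm.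
  by apply: eq_avg => t; rewrite ReB.
by apply: eq_avg => t; rewrite ImB.
Qed.

Lemma cavgZ d h : continuous (h : R -> C) -> cavg (fun t => d * h t) = d * cavg h.
Proof.
move=> ch; have cR := cRe ch; have cI := cIm ch.
apply: complex_ext; rewrite !complexE2 /=.
  rewrite -!avgZ// -avgB; last 2 first.
  - by move=> t; apply: cvgM; [exact: cvg_cst|exact: cR].
  - by move=> t; apply: cvgM; [exact: cvg_cst|exact: cI].
  by apply: eq_avg => t; rewrite !complexE2.
rewrite -!avgZ// -avgD; last 2 first.
- by move=> t; apply: cvgM; [exact: cvg_cst|exact: cI].
- by move=> t; apply: cvgM; [exact: cvg_cst|exact: cR].
by apply: eq_avg => t; rewrite !complexE2.
Qed.

Lemma cavg_cst d : cavg (fun=> d) = d.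
Proof. by rewrite /cavg !avg_cst; case: d. Qed.

(** For [m = cavg h], the real part of [conjc m * cavg h] is the square of the modulus of [m]. It is
    also the average of a real function bounded by [modulus m * modulus (h t)], and one factor
    [modulus m] cancels. *)
Lemma modulus_cavg h : continuous (h : R -> C) -> modulus (cavg h) <= avg (fun t => modulus (h t)).
Proof.
move=> ch.
have key m : Re (conjc m * cavg h) <= modulus m * avg (fun t => modulus (h t)).
  rewrite -cavgZ// -avgZ; last exact: cmodulus.
  apply: le_avg.
  - exact: (@cRe (fun t => conjc m * h t) (@continuousCM (fun=> conjc m) h (@continuous_cstC _) ch)).
  - by move=> t; apply: cvgM; [exact: cvg_cst|exact: cmodulus].
  - move=> t; apply: le_trans (ler_norm _) _; apply: le_trans (Re_le_modulus _) _.
    by rewrite normcM modulus_conj.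
have [m0|m0] := eqVneq (cavg h) 0.
  by rewrite m0 modulus0; apply: avg_ge0 => t; exact: modulus_ge0.
rewrite -(ler_pM2l (modulus_gt0 m0)) -expr2; apply: le_trans (key _).
by rewrite mul_conj.
Qed.

Lemma continuous_conj_cis : continuous (fun t => conjc (cis t) : C).
Proof.
move=> t; apply: (@continuous_complex R R (cos : R -> R) (fun t => - sin t)); first exact: continuous_cos.
by apply: cvgN; exact: continuous_sin.
Qed.

Lemma cavg_conj_cis : cavg (fun t => conjc (cis t)) = 0.
Proof.
apply: complex_ext => /=; first exact: avg_cos.
rewrite (eq_avg (g := fun t => -1 * sin t)); last by move=> t; rewrite mulN1r.
by rewrite avgZ ?avg_sin ?mulr0//; exact: continuous_sin.
Qed.

Implicit Types (F G : R[i] -> R[i]) (z c d e k : R[i]) (r : R).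

Lemma cdiffB F G z d e : cdiff F z d -> cdiff G z e -> cdiff (fun w => F w - G w) z (d - e).
Proof. by move=> /cdiffP dF /cdiffP dG; apply/cdiffP; exact: is_deriveB. Qed.

Lemma cdiffD F G z d e : cdiff F z d -> cdiff G z e -> cdiff (fun w => F w + G w) z (d + e).
Proof. by move=> /cdiffP dF /cdiffP dG; apply/cdiffP; exact: is_deriveD. Qed.

Lemma cdiffZ F z d k : cdiff F z d -> cdiff (fun w => k * F w) z (k * d).
Proof. by move=> /cdiffP dF; apply/cdiffP; exact: (@is_deriveZ _ _ _ (F : C -> C) k). Qed.

Lemma cdiff_cst k z : cdiff (fun=> k) z 0.
Proof.
by move=> e e0; exists 1 => // h _; rewrite subrr mul0r subr0 modulus0 mulr_ge0// ltW.
Qed.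

Lemma cdiff_id z : cdiff id z 1.
Proof.
move=> e e0; exists 1 => // h _.
by rewrite /= mul1r [z + h]addrC addrK subrr modulus0 mulr_ge0// ltW.
Qed.

Lemma cdiff_eq F G z d : (exists2 r, 0 < r & forall w, modulus (w - z) < r -> F w = G w) ->
  cdiff F z d -> cdiff G z d.
Proof.
move=> [r r0 FG] dF e /dF[s s0 H]; exists (Num.min r s); first by rewrite lt_min r0.
move=> h; rewrite lt_min => /andP[hr hs]; rewrite -!FG ?subrr ?modulus0//; first exact: H.
by rewrite addrAC subrr add0r.
Qed.

Lemma cdiff_divX F c z d : z != c -> cdiff F z d ->
  exists e, cdiff (fun w => F w / (w - c)) z e.
Proof.
move=> zc dF.
have /cdiffP di : cdiff (fun w => w - c) z (1 - 0) by apply: cdiffB; [exact: cdiff_id|exact: cdiff_cst].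
move/cdiffP: dF => dF.
have zc0 : z - c != 0 by rewrite subr_eq0.
have dV : derivable (fun w : C => (w - c)^-1 : C) (z : C) (1 : C).
  by apply: (@derivableV _ _ (fun w : C => (w - c : C))) => //; case: di.
have [dF1 _] := dF.
have dM := @derivableM _ _ (F : C -> C) (fun w : C => (w - c)^-1 : C) (z : C) (1 : C) dF1 dV.
by eexists; apply/cdiffP; exact: (derivableP dM).
Qed.

(** The circle is shrunk to a small one around [c], where continuity makes the average close to
    [F c]. Only continuity is asked at [c] itself, so that the lemma applies to difference quotients
    in [cauchy_deriv]. *)
Lemma mean_value F c r : 0 < r ->
  (forall z, 0 < modulus (z - c) <= r -> exists d, cdiff F z d) ->
  {for c, continuous (F : C -> C)} -> cavg (fun t => F (polar c r t)) = F c.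
Proof.
move=> r0 dF cF.
have key G : (forall z, 0 < modulus (z - c) <= r -> exists d, cdiff G z d) ->
    {for c, continuous (G : C -> C)} -> avg (fun t => Re (G (polar c r t))) = Re (G c).
  move=> dG cG; apply/eqP; rewrite -subr_eq0 -normr_le0; apply/ler_addgt0Pl => e e0.
  rewrite addr0.
  have : \forall z \near (c : C), modulus (G z - G c) < e.
    exact: (iffLR (@cvg_modulusP _ _ (nbhs (c:C)) _ (G : C -> C) (G c)) cG).
  move=> /nbhs_normP[d0 /= d00 Hd].
  pose d := Re d0.
  have d_gt0 : 0 < d by move: d00; rewrite ltcE => /andP[].
  pose s := Num.min (d / 2) r.
  have s0 : 0 < s by rewrite lt_min r0 divr_gt0.
  have sr : s <= r by rewrite ge_min lexx orbT.
  have dGs z : s <= modulus (z - c) <= r -> exists d, cdiff G z d.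
    by move=> /andP[a b]; apply: dG; rewrite b (lt_le_trans s0).
  have -> : avg (fun t => Re (G (polar c r t))) = avg (fun t => Re (G (polar c s t))).
    by rewrite /avg (circle_int_Re_eq s0 dGs sr).
  apply: avg_bound.
    move=> t; apply: continuous_Re_comp; first exact: continuous_polar_t.
    have [|e' ] := dG (polar c s t); first by rewrite modulus_polar gtr0_norm// s0.
    exact: cdiff_continuous.
  move=> t; rewrite -ReB; apply: le_trans (Re_le_modulus _) _; apply: ltW.
  apply: Hd; rewrite /ball_/= normcE_modulus modulusB modulus_polar gtr0_norm//.
  move: d00; rewrite !ltcE /= => /andP[-> _] /=.
  by rewrite /s gt_min ltr_pdivrMr// ltr_pMr// ltr1n.
apply: complex_ext => /=; first exact: key.
rewrite -[RHS]opprK -ReiNIm.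
(* Multiplication by -i turns imaginary parts into real parts, so [key] serves for both
   components. *)
have H := key (fun z => - 'i%C * F z).
have E z : Re (- 'i%C * z) = Im z by rewrite !complexE2 /=; ring.
rewrite ReiNIm opprK -E -H.
- by apply: eq_avg => t; rewrite E.
- by move=> z /dF[d /(@cdiffZ _ _ _ (- 'i%C)) ?]; exists (- 'i%C * d).
- exact: continuousCZ.
Qed.

(** The mean value property for the difference quotient [G], completed by [d] at [c]. On the circle
    the denominator is [r%:C * cis t], whose inverse brings in [conjc (cis t)]; the term with [F c]
    averages to 0. *)
Lemma cauchy_deriv F c r d : 0 < r ->
  (forall z, modulus (z - c) <= r -> exists d, cdiff F z d) -> cdiff F c d ->
  cavg (fun t => F (polar c r t) * conjc (cis t)) = r%:C * d.
Proof.
move=> r0 dF dc.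
pose G z := if z == c then d else (F z - F c) / (z - c).
have GE z : z != c -> G z = (F z - F c) / (z - c) by rewrite /G => /negbTE ->.
have mG : cavg (fun t => G (polar c r t)) = G c.
  apply: mean_value => //.
  - move=> z /andP[zc zr].
    have zc' : z != c by apply: contraL zc => /eqP ->; rewrite subrr modulus0 ltxx.
    have [e de] := dF _ zr.
    have /(cdiff_divX zc')[e' de'] := cdiffB de (cdiff_cst (F c) z).
    exists e'; apply: cdiff_eq de'; exists (modulus (z - c)) => //.
    move=> w wz; rewrite GE//; apply: contraTneq wz => ->.
    by rewrite modulusB ltxx.
  - apply/(@cvg_modulusP _ _ (nbhs (c : C)) _ (G : C -> C)) => e e0.
    have e2 : 0 < e / 2 by rewrite divr_gt0.
    have [s s0 Hs] := dc _ e2.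
    apply: (@filterS C (nbhs (c : C)) _ _ _ _ (near_modulus c s0)) => w wc.
    have [->|wc0] := eqVneq w c; first by rewrite subrr modulus0.
    rewrite GE// /G eqxx.
    have wc1 : w - c != 0 by rewrite subr_eq0.
    have := Hs _ wc; rewrite [c + _]addrC subrK => H.
    have -> : (F w - F c) / (w - c) - d = (F w - F c - d * (w - c)) / (w - c).
      by rewrite [RHS]mulrBl mulfK.
    rewrite normcM normcV ltr_pdivrMr ?modulus_gt0//.
    by apply: le_lt_trans H _; rewrite ltr_pM2r ?modulus_gt0// ltr_pdivrMr// ltr_pMr// ltr1n.
have rC : r%:C != 0 by rewrite gt_eqF ?ltcR.
have cFp : continuous (fun t => F (polar c r t) : C).
  move=> t; apply: (@continuousC_comp _ _ (polar c r)); first exact: continuous_polar_t.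
  by have [|e] := dF (polar c r t); [rewrite modulus_polar gtr0_norm|exact: cdiff_continuous].
have pc t : polar c r t - c = r%:C * cis t by rewrite /polar addrAC subrr add0r.
have -> : d = cavg (fun t => G (polar c r t)) by rewrite mG /G eqxx.
rewrite (@eq_cavg (fun t => G (polar c r t))
  (fun t => r%:C^-1 * ((F (polar c r t) - F c) * conjc (cis t)))); last first.
  move=> t; rewrite GE; last first.
    by rewrite -subr_eq0 pc mulf_neq0//; apply/eqP => /(congr1 modulus);
      rewrite modulus_cis modulus0; apply/eqP; rewrite oner_eq0.
  rewrite pc invfM mulrCA; congr (_ * _); congr (_ * _).
  by apply: (@mulIf _ (cis t)); rewrite ?cis_conj ?mulVf//;
   apply/eqP => /(congr1 modulus); rewrite modulus_cis modulus0; apply/eqP; rewrite oner_eq0.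
rewrite cavgZ; last first.
  exact: (@continuousCM (fun t => F (polar c r t) - F c) _
    (@continuousCB _ (fun=> F c) cFp (@continuous_cstC _)) continuous_conj_cis).
rewrite mulrA divff// mul1r.
rewrite [in RHS](@eq_cavg _ (fun t => F (polar c r t) * conjc (cis t) - F c * conjc (cis t))); last first.
  by move=> t; rewrite mulrBl.
have cM1 : continuous (fun t => (F (polar c r t) * conjc (cis t) : R[i]) : C).
  exact: (continuousCM cFp continuous_conj_cis).
have cM2 : continuous (fun t => (F c * conjc (cis t) : R[i]) : C).
  exact: (@continuousCM (fun=> F c) _ (@continuous_cstC _) continuous_conj_cis).
by rewrite (cavgB cM1 cM2) (cavgZ _ continuous_conj_cis) cavg_conj_cis mulr0 subr0.
Qed.

End averages.

(** * Derivatives of holomorphic functions are holomorphic *)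

Section holomorphic.
Context {R : realType}.
Local Notation C := (R[i]^o).
Implicit Types (F G dF : R[i] -> R[i]) (z w c d h k u : R[i]) (r s t m : R).

Lemma is_derive_line F z h u t d : cdiff F (z + t%:C * h) d ->
  is_derive t (1 : R) (fun s => Re (u * F (z + s%:C * h))) (Re (u * d * h)).
Proof.
move=> dF; set g := fun s => _.
have cv : (q^-1 *: ((g \o shift t) (q *: (1 : R)) - g t)) @[q --> (0 : R)^'] --> (Re (u * d * h)).
  apply/cvgrPdist_le => e e0.
  pose K := modulus u * modulus h + 1.
  have K0 : 0 < K by rewrite ltr_wpDl// mulr_ge0.
  have [r r0 Hr] := dF _ (divr_gt0 e0 K0).
  have h1 : 0 < modulus h + 1 by rewrite ltr_wpDl.
  near=> q.
  have q0 : q != 0 by near: q; exact: nbhs_dnbhs_neq.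
  have qr : `|q| < r / (modulus h + 1).
    near: q; apply: dnbhs0_lt; exact: divr_gt0.
  have qh : modulus (q%:C * h) < r.
    rewrite normcM modulus_real; apply: (@le_lt_trans _ _ (`|q| * (modulus h + 1))).
      by rewrite ler_wpM2l// lerDl.
    by rewrite -ltr_pdivlMr.
  have {}Hr := Hr _ qh.
  have E1 : (q%:C)^-1 * q%:C = 1 by rewrite mulVf//; apply: contra q0 => /eqP[->].
  have -> : Re (u * d * h) - q^-1 *: ((g \o shift t) (q *: (1 : R)) - g t) =
     q^-1 * Re (u * - (F (z + t%:C * h + q%:C * h) - F (z + t%:C * h) - d * (q%:C * h))).
    rewrite /g /= /GRing.scale /= mulr1 rmorphD /= mulrDl.
    rewrite [q%:C * h + _]addrC addrA !complexE2 /=; field.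
    by rewrite q0.
  rewrite normrM normfV; rewrite ler_pdivrMl ?normr_gt0//.
  apply: le_trans (Re_le_modulus _) _; rewrite normcM normcN.
  apply: le_trans (ler_wpM2l (modulus_ge0 _) Hr) _.
  rewrite normcM modulus_real.
  have -> : modulus u * (e / K * (`|q| * modulus h)) = `|q| * (e * ((modulus u * modulus h) / K)).
    by field; rewrite gt_eqF.
  rewrite ler_wpM2l// -[leRHS]mulr1 ler_wpM2l ?(ltW e0)// ler_pdivrMr// mul1r.
  by rewrite lerDl.
apply: DeriveDef; first by apply/cvg_ex; exists (Re (u * d * h)).
exact: (cvg_lim _ cv).
Unshelve. all: by end_near. Qed.

(** With [w] the vector to be bounded, the real mean value theorem applies to the real part of
    [conjc w] times [F v - k * v] along the segment. Its total increment is the square of the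
    modulus of [w]. *)
Lemma complex_mvt F dF z h k m :
  (forall t, 0 <= t <= 1 -> cdiff F (z + t%:C * h) (dF (z + t%:C * h))) ->
  (forall t, 0 <= t <= 1 -> modulus (dF (z + t%:C * h) - k) <= m) ->
  modulus (F (z + h) - F z - k * h) <= m * modulus h.
Proof.
move=> HF Hm; set w := F (z + h) - F z - k * h.
have m0 : 0 <= m.
  by apply: le_trans (Hm 0 _); rewrite ?modulus_ge0// lexx ler01.
have [w0|w0] := eqVneq w 0; first by rewrite w0 modulus0 mulr_ge0.
pose G v := F v - k * v.
have dG t : 0 <= t <= 1 -> cdiff G (z + t%:C * h) (dF (z + t%:C * h) - k * 1).
  move=> t01; apply: cdiffB; first exact: HF.
  by apply: cdiffZ; exact: cdiff_id.
pose g t := Re (conjc w * G (z + t%:C * h)).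
pose dg t := Re (conjc w * (dF (z + t%:C * h) - k * 1) * h).
have gd t : t \in `[0, 1] -> is_derive t (1 : R) g (dg t).
  by rewrite in_itv => t01; apply: is_derive_line; exact: dG.
have cg : {within `[0, 1], continuous g}.
  apply: continuous_in_subspaceT => x; rewrite inE => xI.
  apply: differentiable_continuous; apply/derivable1_diffP.
  by case: (gd x xI).
have [t tI] := @MVT_segment _ g dg 0 1 ler01 (fun x xI => gd x (subset_itv_oo_cc xI)) cg.
rewrite subr0 mulr1.
have -> : g 1 - g 0 = modulus w ^+ 2.
  have -> : modulus w ^+ 2 = Re (conjc w * w) by rewrite mul_conj.
  rewrite -ReB -mulrBr /G rmorph1 rmorph0 mul1r mul0r addr0.
  by congr (Re (_ * _)); rewrite /w; ring.
move=> E.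
rewrite -(ler_pM2l (modulus_gt0 w0)) -expr2 E /dg.
apply: le_trans (ler_norm _) _; apply: le_trans (Re_le_modulus _) _.
rewrite !normcM modulus_conj -!mulrA mulr1.
apply: (ler_wpM2l (modulus_ge0 _)); apply: (ler_wpM2r (modulus_ge0 _)).
by apply: Hm; move: tI; rewrite in_itv.
Qed.

Lemma ball_segment c r z h t : modulus (z - c) < r -> modulus (z + h - c) < r ->
  0 <= t <= 1 -> modulus (z + t%:C * h - c) < r.
Proof.
move=> zc zhc /andP[t0 t1].
have -> : z + t%:C * h - c = (1 - t)%:C * (z - c) + t%:C * (z + h - c).
  by rewrite rmorphB rmorph1; ring.
apply: le_lt_trans (le_normcD _ _) _; rewrite !normcM !modulus_real.
rewrite !ger0_norm ?subr_ge0//.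
have [->|tn0] := eqVneq t 0; first by rewrite mul0r addr0 subr0 mul1r.
have tp : 0 < t by rewrite lt_neqAle eq_sym tn0.
have -> : r = (1 - t) * r + t * r by ring.
by rewrite ler_ltD// ?ltr_pM2l// ler_wpM2l ?subr_ge0// ltW.
Qed.

(* Cauchy's estimates on circles of a fixed radius make [F], then [dF], Lipschitz near [c];
   hence the difference quotients of [F] converge uniformly on a circle around [c]. *)
Lemma cdiff_derivative F dF c s : 0 < s ->
  (forall z, modulus (z - c) < s -> cdiff F z (dF z)) -> exists d, cdiff dF c d.
Proof.
move=> s0 HF.
have cFc : {for c, continuous (F : C -> C)}.
  by apply: cdiff_continuous; apply: HF; rewrite subrr modulus0.
have [q q0 Hq] : exists2 q : R, 0 < q & forall z, modulus (z - c) < q -> modulus (F z - F c) < 1.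
  have : \forall z \near (c : C), modulus (F z - F c) < 1.
    exact: (iffLR (@cvg_modulusP _ _ (nbhs (c:C)) _ (F : C -> C) (F c)) cFc).
  move=> /nbhs_normP[d0 /= d00 Hd]; move: d00; rewrite ltcE /= => /andP[/eqP d1 d2].
  exists (Re d0) => // z zc; apply: Hd.
  by rewrite /ball_/= normcE_modulus modulusB ltcE /= d1 eqxx.
(* Every use of a circle of radius [r] costs one [r]: [F] is bounded within [4 * r] of [c], so [dF]
   is bounded within [3 * r] and Lipschitz within [2 * r], which leaves the circle of radius [r]
   around [c] and its small translates. *)
pose r : R := Num.min s q / 4.
have r0 : 0 < r by rewrite divr_gt0// lt_min s0.
have r4 z : modulus (z - c) < 4 * r -> modulus (z - c) < s /\ modulus (z - c) < q.
  by rewrite /r mulrCA divff ?mulr1 ?pnatr_eq0// lt_min => /andP[].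
pose B : R := modulus (F c) + 1.
have B0 : 0 < B by rewrite ltr_wpDl.
have FB z : modulus (z - c) < 4 * r -> modulus (F z) <= B.
  move=> /r4[_ /Hq H]; rewrite -[X in modulus X](subrK (F c)).
  by apply: le_trans (le_normcD _ _) _; rewrite /B addrC lerD2l ltW.
have inb z t (k : R) : modulus (z - c) < k * r -> modulus (polar z r t - c) < (k + 1) * r.
  move=> zc; have -> : polar z r t - c = (polar z r t - z) + (z - c) by ring.
  apply: le_lt_trans (le_normcD _ _) _; rewrite modulus_polar gtr0_norm// mulrDl mul1r.
  by rewrite addrC ltrD2r.
have inb' z z' (k : R) : modulus (z - c) < k * r -> modulus (z' - z) <= r ->
    modulus (z' - c) < (k + 1) * r.
  move=> zc zz; have -> : z' - c = (z' - z) + (z - c) by ring.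
  by apply: le_lt_trans (le_normcD _ _) _; rewrite mulrDl mul1r addrC ltr_leD.
have n23 : 2 + 1 = 3 :> R by ring.
have n34 : 3 + 1 = 4 :> R by ring.
have n12 : 1 + 1 = 2 :> R by ring.
have dF3 z : modulus (z - c) < 4 * r -> cdiff F z (dF z) by move=> /r4[/HF].
have cFp z : modulus (z - c) < 3 * r -> continuous (fun t => F (polar z r t) : C).
  move=> zc t; apply: (@continuousC_comp _ _ (polar z r)); first exact: continuous_polar_t.
  by apply: cdiff_continuous; apply: dF3; rewrite -n34; exact: inb.
have cauchy z : modulus (z - c) < 3 * r ->
    cavg (fun t => F (polar z r t) * conjc (cis t)) = r%:C * dF z.
  move=> zc; apply: cauchy_deriv => //.
    move=> z' z'z; exists (dF z'); apply: dF3; rewrite -n34; exact: inb' z'z.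
  by apply: dF3; apply: lt_trans zc _; rewrite ltr_pM2r// ltr_nat.
have modconj (a : R[i]) t : modulus (a * conjc (cis t)) = modulus a.
  by rewrite normcM modulus_conj modulus_cis mulr1.
have dFB z : modulus (z - c) < 3 * r -> modulus (dF z) <= B / r.
  move=> zc; rewrite ler_pdivlMr// mulrC -(gtr0_norm r0) -modulus_real -normcM -cauchy//.
  apply: le_trans (modulus_cavg _) _.
    by apply: (continuousCM _ continuous_conj_cis); exact: cFp.
  rewrite -(avg_cst B); apply: le_avg; [|exact: cst_continuous|].
    by apply: cmodulus; apply: (continuousCM _ continuous_conj_cis); exact: cFp.
  by move=> t; rewrite modconj; apply: FB; rewrite -n34; exact: inb.
have FL z h : modulus (z - c) < 3 * r -> modulus (z + h - c) < 3 * r ->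
    modulus (F (z + h) - F z) <= B / r * modulus h.
  move=> z1 z2; have -> : F (z + h) - F z = F (z + h) - F z - 0 * h by rewrite mul0r subr0.
  apply: (@complex_mvt _ dF) => t t01.
    apply: dF3; apply: (@lt_trans _ _ (3 * r)); first exact: ball_segment.
    by rewrite ltr_pM2r// ltr_nat.
  by rewrite subr0; apply: dFB; exact: ball_segment.
pose L : R := B / r / r.
have L0 : 0 < L by do 2 (apply: divr_gt0 => //).
have dFL z h : modulus (z - c) < 2 * r -> modulus (z + h - c) < 2 * r ->
    modulus (dF (z + h) - dF z) <= L * modulus h.
  move=> z1 z2.
  have lt23 : 2 * r < 3 * r by rewrite ltr_pM2r// ltr_nat.
  have z13 := lt_trans z1 lt23; have z23 := lt_trans z2 lt23.
  have -> : L * modulus h = B / r * modulus h / r by rewrite /L; ring.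
  rewrite ler_pdivlMr// mulrC -{1}(gtr0_norm r0) -modulus_real -normcM mulrBr -!cauchy//.
  have c1 : continuous (fun t => (F (polar (z + h) r t) * conjc (cis t) : R[i]) : C).
    by apply: (continuousCM _ continuous_conj_cis); exact: cFp.
  have c2 : continuous (fun t => (F (polar z r t) * conjc (cis t) : R[i]) : C).
    by apply: (continuousCM _ continuous_conj_cis); exact: cFp.
  rewrite -cavgB//; apply: le_trans (modulus_cavg (continuousCB c1 c2)) _.
  rewrite -(avg_cst (B / r * modulus h)); apply: le_avg; [|exact: cst_continuous|].
    exact: (cmodulus (continuousCB c1 c2)).
  move=> t; rewrite -mulrBl modconj.
  have -> : polar (z + h) r t = polar z r t + h by rewrite /polar; ring.
  apply: FL; first by rewrite -n23; exact: inb.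
  have -> : polar z r t + h - c = polar (z + h) r t - c by rewrite /polar; ring.
  by rewrite -n23; exact: inb.
have cdF z : modulus (z - c) < 2 * r -> {for z, continuous (dF : C -> C)}.
  move=> zc; apply/(@cvg_modulusP _ _ (nbhs (z : C)) _ (dF : C -> C)) => e e0.
  pose m := Num.min (e / L) (2 * r - modulus (z - c)).
  have m0 : 0 < m by rewrite lt_min divr_gt0//= subr_gt0.
  apply: (@filterS C (nbhs (z : C)) _ _ _ _ (near_modulus z m0)) => w.
  rewrite lt_min => /andP[we wr].
  have -> : w = z + (w - z) by ring.
  apply: le_lt_trans (dFL _ _ _ _) _ => //.
    have -> : z + (w - z) - c = (w - z) + (z - c) by ring.
    by apply: le_lt_trans (le_normcD _ _) _; rewrite -ltrBrDr.
  by rewrite mulrC -ltr_pdivlMr.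
have lt13 : 1 * r < 3 * r by rewrite ltr_pM2r// ltr1n.
(* The value that [cauchy_deriv] would give for the derivative of [dF]; the average exists because
   [dF] is already known to be continuous. *)
pose d := (r%:C)^-1 * cavg (fun t => dF (polar c r t) * conjc (cis t)).
exists d => e e0.
exists (Num.min (r / 2) (e * r / L)); first by rewrite lt_min; apply/andP; split; apply: divr_gt0 => //; exact: mulr_gt0.
move=> h; rewrite lt_min => /andP[hr he].
have rC : r%:C != 0 by rewrite gt_eqF ?ltcR.
have cc : modulus (c - c) < 1 * r by rewrite subrr modulus0 mul1r.
have hc : modulus (c + h - c) < 1 * r.
  by rewrite addrAC subrr add0r mul1r (lt_trans hr)// ltr_pdivrMr// ltr_pMr// ltr1n.
have c1 : continuous (fun t => (F (polar (c + h) r t) * conjc (cis t) : R[i]) : C).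
  by apply: (continuousCM _ continuous_conj_cis); apply: cFp; exact: lt_trans lt13.
have c2 : continuous (fun t => (F (polar c r t) * conjc (cis t) : R[i]) : C).
  by apply: (continuousCM _ continuous_conj_cis); apply: cFp; exact: lt_trans lt13.
have c3 : continuous (fun t => (dF (polar c r t) * conjc (cis t) : R[i]) : C).
  apply: (continuousCM _ continuous_conj_cis).
  move=> t; apply: (@continuousC_comp _ _ (polar c r)); first exact: continuous_polar_t.
  by apply: cdF; rewrite -n12; exact: inb.
have c4 : continuous (fun t => (h * (dF (polar c r t) * conjc (cis t)) : R[i]) : C).
  exact: (@continuousCM _ (fun=> h) _ (@continuous_cstC _ h) c3).
have c12 := continuousCB c1 c2.
have cH := continuousCB c12 c4.
have E : r%:C * (dF (c + h) - dF c - d * h) =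
   cavg (fun t => (F (polar (c + h) r t) * conjc (cis t) - F (polar c r t) * conjc (cis t))
      - h * (dF (polar c r t) * conjc (cis t))).
  rewrite (cavgB c12 c4) (cavgB c1 c2) (cavgZ _ c3) !cauchy; last 2 first.
  - exact: lt_trans lt13.
  - exact: lt_trans lt13.
  by rewrite /d 2!mulrBr; congr (_ - _); field.
have mr w : modulus (r%:C * w) = r * modulus w by rewrite normcM modulus_real gtr0_norm.
rewrite -(ler_pM2l r0) -mr E.
have bound t : modulus (F (polar (c + h) r t) * conjc (cis t) - F (polar c r t) * conjc (cis t)
      - h * (dF (polar c r t) * conjc (cis t))) <= L * modulus h * modulus h.
  have -> : F (polar (c + h) r t) * conjc (cis t) - F (polar c r t) * conjc (cis t)
      - h * (dF (polar c r t) * conjc (cis t)) =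
      (F (polar c r t + h) - F (polar c r t) - dF (polar c r t) * h) * conjc (cis t).
    by rewrite (_ : polar (c + h) r t = polar c r t + h); rewrite /polar; ring.
  rewrite modconj.
  have p1 : modulus (polar c r t - c) < 2 * r by rewrite -n12; exact: inb.
  have p2 : modulus (polar c r t + h - c) < 2 * r.
    rewrite (_ : polar c r t + h = polar (c + h) r t); last by rewrite /polar; ring.
    by rewrite -n12; exact: inb.
  apply: (@complex_mvt _ dF) => u u01.
    apply: dF3; apply: (@lt_trans _ _ (2 * r)); first exact: ball_segment.
    by rewrite ltr_pM2r// ltr_nat.
  apply: le_trans (dFL _ _ _ _) _ => //; first exact: ball_segment.
  case/andP: u01 => u0 u1.
  by rewrite normcM modulus_real ger0_norm// ler_pM2l// ler_piMl.
apply: (@le_trans _ _ (L * modulus h * modulus h)); last first.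
  rewrite mulrA; apply: (ler_wpM2r (modulus_ge0 _)).
  by rewrite mulrC -ler_pdivlMr// [r * e]mulrC; exact: ltW.
have ch : continuous (fun t => (F (polar (c + h) r t) * conjc (cis t) - F (polar c r t) * conjc (cis t)
      - h * (dF (polar c r t) * conjc (cis t)) : R[i]) : C) by exact: cH.
apply: le_trans (modulus_cavg ch) _.
rewrite -(avg_cst (L * modulus h * modulus h)); apply: le_avg => //; last exact: cst_continuous.
exact: cmodulus.
Qed.

End holomorphic.

(** * Power means *)

Section powers.
Context {R : realType}.
Local Notation C := (R[i]^o).
Implicit Types (p q : R) (z w : R[i]).

(** Young's inequality for [x] and y^(q-1) with the conjugate exponents q and q/(q-1). This single
    form of convexity yields the midpoint inequality, Jensen's inequality and the closedness of the
    level sets. *)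
Lemma powR_tangent q (x y : R) : 1 <= q -> 0 <= x -> 0 <= y ->
  y `^ q + q * y `^ (q - 1) * (x - y) <= x `^ q.
Proof.
rewrite le_eqVlt => /predU1P[<- x0 y0|q1 x0 y0].
  by rewrite subrr powRr0 !powRr1// !mul1r addrC subrK.
have q0 : 0 < q by exact: lt_trans q1.
have q10 : 0 < q - 1 by rewrite subr_gt0.
pose q' := q / (q - 1).
have q'0 : 0 < q' by rewrite divr_gt0.
have conj : q^-1 + q'^-1 = 1 by rewrite /q'; field; rewrite !gt_eqF.
have := @conjugate_powR _ x (y `^ (q - 1)) q q' x0 (powR_ge0 _ _) q0 q'0 conj.
rewrite -powRrM (_ : (q - 1) * q' = q); last by rewrite /q'; field; rewrite gt_eqF.
move=> H; have yq := mulr_powRB1 y0 q0.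
have {}H : q * x * y `^ (q - 1) <= x `^ q + (q - 1) * y `^ q.
  rewrite -mulrA; apply: le_trans (ler_wpM2l (ltW q0) H) _.
  by rewrite le_eqVlt; apply/orP; left; apply/eqP; rewrite /q'; field; rewrite !gt_eqF.
have -> : y `^ q + q * y `^ (q - 1) * (x - y) = q * x * y `^ (q - 1) - (q * (y * y `^ (q - 1)) - y `^ q).
  by ring.
by rewrite yq; lra.
Qed.

(** Split (x+y)^q into x (x+y)^(q-1) and y (x+y)^(q-1), and use that the power q-1 is monotone. *)
Lemma powR_superadd q (x y : R) : 1 <= q -> 0 <= x -> 0 <= y ->
  x `^ q + y `^ q <= (x + y) `^ q.
Proof.
move=> q1 x0 y0; have q0 : 0 < q by exact: lt_le_trans q1.
have xy0 : 0 <= x + y by rewrite addr_ge0.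
rewrite -(mulr_powRB1 x0 q0) -(mulr_powRB1 y0 q0) -(mulr_powRB1 xy0 q0) mulrDl.
by apply: lerD; apply: ler_wpM2l => //; apply: ge0_ler_powR;
  rewrite ?nnegrE ?subr_ge0// ?lerDl ?lerDr.
Qed.

(** Sum of the tangent inequalities at the midpoint, whose linear terms are opposite. *)
Lemma powR_midpoint q (x y : R) : 1 <= q -> 0 <= x -> 0 <= y ->
  2 * ((x + y) / 2) `^ q <= x `^ q + y `^ q.
Proof.
move=> q1 x0 y0; set m := (x + y) / 2.
have m0 : 0 <= m by rewrite divr_ge0// addr_ge0.
have := powR_tangent q1 x0 m0; have := powR_tangent q1 y0 m0.
have -> : y - m = - (x - m) by rewrite /m; field.
rewrite mulrN; set u := _ * (x - m); lra.
Qed.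

Lemma modulus_powR z p : modulus z `^ p = (modulus z ^+ 2) `^ (p / 2).
Proof. by rewrite -powR_mulrn// -powRrM; congr (_ `^ _); field. Qed.

(** All moduli are written as powers p/2 of their squares, with p/2 >= 1. Superadditivity joins the
    two terms on the left, the parallelogram law evaluates the sum of squares as the mean of the
    squared moduli of [z] and [w], and convexity separates these again. *)
Lemma clarkson p z w : 2 <= p ->
  2 * modulus ((z + w) / 2) `^ p + 2 * modulus ((z - w) / 2) `^ p <=
  modulus z `^ p + modulus w `^ p.
Proof.
move=> p2; have q1 : 1 <= p / 2 by rewrite ler_pdivlMr// mul1r.
rewrite !modulus_powR -mulrDr.
apply: le_trans (powR_midpoint q1 (sqr_ge0 _) (sqr_ge0 _)).
rewrite ler_pM2l//; apply: le_trans (powR_superadd q1 (sqr_ge0 _) (sqr_ge0 _)) _.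
suff -> : modulus ((z + w) / 2) ^+ 2 + modulus ((z - w) / 2) ^+ 2 = (modulus z ^+ 2 + modulus w ^+ 2) / 2 by [].
have m2 : modulus (2 : R[i])^-1 = 2^-1.
  by rewrite normcV (_ : 2 = 2%:C) ?modulus_real ?ger0_norm// rmorphD rmorph1.
rewrite !normcM m2 !exprMn !sqr_modulus ReB ImB ReD ImD; by field.
Qed.

(** The power of a negative base is a default value; the absolute value makes the function
    continuous across 0. *)
Lemma continuous_norm_powR p : 0 < p -> continuous (fun x : R => `|x| `^ p).
Proof.
move=> p0 x; have [->|x0] := eqVneq x 0.
  rewrite /continuous_at normr0 powR0 ?gt_eqF//.
  apply/(@cvgrPdist_lt R R R (nbhs (0 : R)) _ (fun x : R => `|x| `^ p)) => e e0.
  have d0 : 0 < e `^ p^-1 by exact: powR_gt0.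
  apply: (@filterS _ (nbhs (0 : R)) _ _ _ _ (@nbhs0_lt R R _ d0)) => y yd.
  rewrite sub0r normrN ger0_norm ?powR_ge0//.
  have -> : e = (e `^ p^-1) `^ p by rewrite -powRrM mulVf ?gt_eqF// powRr1// ltW.
  by apply: (gt0_ltr_powR p0); rewrite ?nnegrE ?powR_ge0.
apply: (@continuous_comp _ _ _ (fun x : R => `|x|) (fun y => y `^ p)).
  exact: norm_continuous.
apply: differentiable_continuous; apply/derivable1_diffP.
by apply: derivable_powR; rewrite in_itv /= andbT normr_gt0.
Qed.

Lemma continuous_modulus_powR (T : topologicalType) (h : T -> R[i]) p (x : T) : 0 < p ->
  {for x, continuous (h : T -> C)} -> {for x, continuous (fun y => modulus (h y) `^ p)}.
Proof.
move=> p0 ch.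
have -> : (fun y => modulus (h y) `^ p) = (fun y => `|modulus (h y)| `^ p).
  by apply/funext => y; rewrite ger0_norm.
apply: (@continuous_comp _ _ _ (fun y => modulus (h y)) (fun a : R => `|a| `^ p)).
  apply: (@continuous_comp _ _ _ (h : T -> C) (modulus : C -> R)) => //.
  exact: continuous_modulus.
exact: continuous_norm_powR.
Qed.

(** Jensen's inequality: average the tangent inequality at [m = avg g]; its linear term has average
    0. *)
Lemma avg_powR (g : R -> R) q : 1 <= q -> continuous g -> (forall t, 0 <= g t) ->
  avg g `^ q <= avg (fun t => g t `^ q).
Proof.
move=> q1 cg g0; set m := avg g.
have q0 : 0 < q by exact: lt_le_trans q1.
have m0 : 0 <= m by exact: avg_ge0.
have cc k : continuous ((fun=> k) : R -> R) by exact: cst_continuous.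
have cB : continuous (fun t => g t - m) by move=> t; exact: (cvgB (cg t) (cc m t)).
have cM k : continuous (fun t => k * (g t - m)) by move=> t; exact: (cvgM (cc k t) (cB t)).
have -> : m `^ q = avg (fun t => m `^ q + q * m `^ (q - 1) * (g t - m)).
  rewrite (@avgD _ (fun=> _))// avgZ// avgB//.
  by rewrite !avg_cst subrr mulr0 addr0.
apply: le_avg.
- by move=> t; exact: (cvgD (cc _ t) (cM _ t)).
- have -> : (fun t => g t `^ q) = (fun y => `|g y| `^ q).
    by apply/funext => y; rewrite ger0_norm.
  move=> t; apply: (@continuous_comp _ _ _ g (fun a : R => `|a| `^ q)); first exact: cg.
  exact: continuous_norm_powR.
- by move=> t; exact: powR_tangent.
Qed.

Lemma jensen_cavg (h : R -> R[i]) p : 2 <= p -> continuous (h : R -> C) ->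
  modulus (cavg h) `^ p <= avg (fun t => modulus (h t) `^ p).
Proof.
move=> p2 ch; have q1 : 1 <= p / 2 by rewrite ler_pdivlMr// mul1r.
have p1 : 1 <= p by lra.
have p0 : 0 <= p by lra.
apply: le_trans (avg_powR p1 (cmodulus ch) _); last by move=> t; exact: modulus_ge0.
apply: ge0_ler_powR; rewrite ?nnegrE ?modulus_ge0//; last exact: modulus_cavg.
by apply: avg_ge0 => t; exact: modulus_ge0.
Qed.

End powers.

Section local_estimate.
Context {R : realType}.
Local Notation C := (R[i]^o).

(** Clarkson's inequality for [F (polar c r t)] and [F c]. The half sum averages to [F c]. The half
    difference, turned by [conjc (cis t)] without changing its modulus, averages to r F'(c) / 2.
    Jensen's inequality bounds both terms from below, and one copy of the p-th power of |F(c)|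
    cancels. *)
Lemma circle_mean_lower_bound (F dF : R[i] -> R[i]) c (r p : R) : 2 <= p -> 0 < r ->
  (forall z, modulus (z - c) <= r -> cdiff F z (dF z)) ->
  modulus (F c) `^ p + 2 * (r * modulus (dF c) / 2) `^ p <=
  avg (fun t => modulus (F (polar c r t)) `^ p).
Proof.
move=> p2 r0 HF; have p0 : 0 < p by lra.
have dc : cdiff F c (dF c) by apply: HF; rewrite subrr modulus0 ltW.
have ex z : modulus (z - c) <= r -> exists d, cdiff F z d by move=> /HF; exists (dF z).
have mF : cavg (fun t => F (polar c r t)) = F c.
  by apply: mean_value => //; [move=> z /andP[_ /ex]|exact: cdiff_continuous dc].
have mdF := cauchy_deriv r0 ex dc.
have cF : continuous (fun t => F (polar c r t) : C).
  move=> t; apply: (@continuousC_comp _ _ (polar c r)); first exact: continuous_polar_t.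
  by apply: cdiff_continuous; apply: HF; rewrite modulus_polar gtr0_norm.
have cF1 : continuous (fun t => (F (polar c r t) * conjc (cis t) : R[i]) : C).
  exact: (continuousCM cF continuous_conj_cis).
have cst1 : continuous (fun t => (F c * conjc (cis t) : R[i]) : C).
  exact: (@continuousCM _ (fun=> F c) _ (@continuous_cstC _ _) continuous_conj_cis).
pose A t := F (polar c r t) + F c.
pose B t := F (polar c r t) * conjc (cis t) - F c * conjc (cis t).
have cA : continuous (A : R -> C) by exact: (@continuousCD _ _ (fun=> F c) cF (@continuous_cstC _ _)).
have cB : continuous (B : R -> C) by exact: (continuousCB cF1 cst1).
have cA2 : continuous ((fun t => 2^-1 * A t) : R -> C).
  by move=> t; exact: continuousCZ (cA t).
have cB2 : continuous ((fun t => 2^-1 * B t) : R -> C).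
  by move=> t; exact: continuousCZ (cB t).
have mA : cavg (fun t => 2^-1 * A t) = F c.
  have -> : cavg (fun t => 2^-1 * A t) = 2^-1 * cavg (fun t => F (polar c r t) - (- F c)).
    by rewrite (cavgZ _ cA); congr (_ * _); apply: eq_cavg => t; rewrite opprK.
  rewrite (@cavgB _ _ (fun=> - F c) cF (@continuous_cstC _ _)) mF cavg_cst opprK.
  by field.
have mB : cavg (fun t => 2^-1 * B t) = 2^-1 * (r%:C * dF c).
  rewrite (cavgZ _ cB) /B (cavgB cF1 cst1) (cavgZ _ continuous_conj_cis) cavg_conj_cis.
  by rewrite mulr0 subr0 mdF.
have m2 : modulus (2 : R[i])^-1 = 2^-1.
  by rewrite normcV (_ : 2 = 2%:C) ?modulus_real ?ger0_norm// rmorphD rmorph1.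
have JA := jensen_cavg p2 cA2; have JB := jensen_cavg p2 cB2.
rewrite mA in JA; rewrite mB in JB.
have mm : modulus (2^-1 * (r%:C * dF c)) = 2^-1 * (r * modulus (dF c)).
  by rewrite normcM m2 normcM modulus_real gtr0_norm.
rewrite mm in JB.
have cpA : continuous (fun t => 2 * modulus (2^-1 * A t) `^ p).
  by move=> t; apply: cvgM; [exact: cvg_cst|exact: continuous_modulus_powR (cA2 t)].
have cpB : continuous (fun t => 2 * modulus (2^-1 * B t) `^ p).
  by move=> t; apply: cvgM; [exact: cvg_cst|exact: continuous_modulus_powR (cB2 t)].
have cpF : continuous (fun t => modulus (F (polar c r t)) `^ p).
  by move=> t; exact: continuous_modulus_powR (cF t).
have cpA' : continuous (fun t => modulus (2^-1 * A t) `^ p).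
  by move=> t; exact: continuous_modulus_powR (cA2 t).
have cpB' : continuous (fun t => modulus (2^-1 * B t) `^ p).
  by move=> t; exact: continuous_modulus_powR (cB2 t).
have : avg (fun t => 2 * modulus (2^-1 * A t) `^ p + 2 * modulus (2^-1 * B t) `^ p) <=
       avg (fun t => modulus (F (polar c r t)) `^ p + modulus (F c) `^ p).
  apply: le_avg.
  - by move=> t; exact: (cvgD (cpA t) (cpB t)).
  - by move=> t; apply: cvgD; [exact: cpF|exact: cvg_cst].
  - move=> t; apply: le_trans (clarkson _ _ p2).
    have -> : modulus (2^-1 * B t) = modulus ((F (polar c r t) - F c) / 2).
      rewrite /B -mulrBl mulrA normcM modulus_conj modulus_cis mulr1.
      by rewrite [2^-1 * _]mulrC.
    by rewrite /A [2^-1 * _]mulrC.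
have ccst : continuous ((fun=> modulus (F c) `^ p) : R -> R) by exact: cst_continuous.
rewrite (avgD cpA cpB) (avgZ 2 cpA') (avgZ 2 cpB') (avgD cpF ccst).
have -> : avg (fun=> modulus (F c) `^ p) = modulus (F c) `^ p by exact: avg_cst.
have -> : r * modulus (dF c) / 2 = 2^-1 * (r * modulus (dF c)) by rewrite mulrC.
move: JA JB; move: (modulus (F c) `^ p) (avg _) (avg _) (avg _) (_ `^ p); clear; move=> x1 x2 x3 x4 x5; lra.
Qed.

End local_estimate.

(** * Area measure in the plane *)

Section lebesgue_affine.
Context {R : realType}.
Local Notation mu := (@lebesgue_measure R).
Local Open Scope ereal_scope.

Lemma measurable_affine (k a : R) : measurable_fun [set: R] (fun x => k * x + a)%R.
Proof. by apply: measurable_funD => //; apply: measurable_funM. Qed.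

(** The image of Lebesgue measure under [phi], scaled by [k], gives half-open intervals their
    length, hence is Lebesgue measure by uniqueness. *)
Lemma ge0_integral_affine (k a : R) (f : R -> \bar R) : (0 < k)%R ->
  measurable_fun setT f -> (forall x, 0 <= f x) ->
  \int[mu]_x f (k * x + a)%R = (k^-1)%:E * \int[mu]_x f x.
Proof.
move=> k0 mf f0; pose phi (x : measurableTypeR R) : measurableTypeR R := (k * x + a)%R.
have mphi : measurable_fun setT phi by exact: measurable_affine.
pose kn : {nonneg R} := NngNum (ltW k0).
pose nu_ : {measure set (measurableTypeR R) -> \bar R} := mscale kn (pushforward mu phi).
pose nu := nu_ mphi.
have E A : measurable A -> mu A = nu A.
  apply: lebesgue_measure_unique => X /ocitvP[->|[[x y] /= xy ->]].
    by rewrite !measure0.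
  rewrite lebesgue_measure_itv/= lte_fin xy /nu /nu_ /mscale /= /pushforward /=.
  have -> : phi @^-1` `]x, y]%classic = `]((x - a) / k)%R, ((y - a) / k)%R]%classic.
    apply/seteqP; split => z /=; rewrite !in_itv /= /phi ltr_pdivrMr// ler_pdivlMr//;
     by rewrite ltrBlDr lerBrDr mulrC.
  rewrite lebesgue_measure_itv/= lte_fin ltr_pM2r ?invr_gt0// ltrD2r xy.
  rewrite -!EFinB -EFinM; congr (_%:E); field.
  by rewrite gt_eqF.
have -> : \int[mu]_x f x = \int[nu]_x f x.
  by apply: eq_measure_integral => A mA _; exact: E.
rewrite /nu /nu_ ge0_integral_mscale//= ge0_integral_pushforward//=.
by rewrite preimage_setT muleA -EFinM mulVf ?gt_eqF// mul1e.
Qed.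

Local Notation mu2 := (mu \x mu).
Implicit Types f : R * R -> \bar R.

Lemma measurable_fun_comp_pair f (g h : R * R -> R) : measurable_fun setT f ->
  measurable_fun setT g -> measurable_fun setT h ->
  measurable_fun setT (fun z => f (g z, h z)).
Proof.
move=> mf mg mh; apply: (measurableT_comp mf).
exact: measurable_fun_pair.
Qed.

(** Measurability of the composite is bundled with the equality of integrals, so that
    transformations can be chained. *)
Definition preserves_area (T : R * R -> R * R) := forall f,
  measurable_fun setT f -> (forall z, 0 <= f z) ->
  measurable_fun setT (f \o T) /\ \int[mu2]_z f (T z) = \int[mu2]_z f z.

Lemma preserves_area_comp T1 T2 : preserves_area T1 -> preserves_area T2 ->
  preserves_area (T1 \o T2).
Proof.
move=> H1 H2 f mf f0.
have [m1 e1] := H1 f mf f0.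
by have [m2 e2] := H2 (f \o T1) m1 (fun z => f0 (T1 z)); split; rewrite // e2.
Qed.

Lemma measurable_slice1 f x : measurable_fun setT f -> measurable_fun setT (fun y => f (x, y)).
Proof. by move=> mf; apply: (measurableT_comp mf); exact: pair1_measurable. Qed.

Lemma measurable_slice2 f y : measurable_fun setT f -> measurable_fun setT (fun x => f (x, y)).
Proof. by move=> mf; apply: (measurableT_comp mf); exact: pair2_measurable. Qed.

Lemma integral_xy f : measurable_fun setT f -> (forall z, 0 <= f z) ->
  \int[mu2]_z f z = \int[mu]_x \int[mu]_y f (x, y).
Proof. by move=> mf f0; have H := fubini_tonelli1 (m1 := mu) (m2 := mu) f mf f0; rewrite H. Qed.

Lemma integral_yx f : measurable_fun setT f -> (forall z, 0 <= f z) ->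
  \int[mu2]_z f z = \int[mu]_y \int[mu]_x f (x, y).
Proof. by move=> mf f0; have H := fubini_tonelli2 (m1 := mu) (m2 := mu) f mf f0; rewrite H. Qed.

Lemma measurable_integral_y f : measurable_fun setT f -> (forall z, 0 <= f z) ->
  measurable_fun setT (fun x => \int[mu]_y f (x, y)).
Proof. by move=> mf f0; have := measurable_fun_fubini_tonelli_F (m2 := mu) f mf f0. Qed.

Lemma measurable_integral_x f : measurable_fun setT f -> (forall z, 0 <= f z) ->
  measurable_fun setT (fun y => \int[mu]_x f (x, y)).
Proof. by move=> mf f0; have := measurable_fun_fubini_tonelli_G (m1 := mu) f mf f0. Qed.

(** By Tonelli: for fixed second coordinate, the shear is a translation of the line. *)
Lemma shear1_preserves_area t : preserves_area (fun z => (z.1 + t * z.2, z.2)%R).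
Proof.
move=> f mf f0.
have mfT : measurable_fun setT (fun z : R * R => f (z.1 + t * z.2, z.2)%R).
  apply: (measurable_fun_comp_pair mf) => //.
  by apply: measurable_funD => //; apply: measurable_funM.
split => //.
rewrite (integral_yx mfT (fun z => f0 _)) (integral_yx mf f0) /=.
apply: eq_integral => y _.
under eq_integral do rewrite -[X in f (X + _, _)%R]mul1r.
rewrite (@ge0_integral_affine 1 (t * y) (fun x => f (x, y)))//; first by rewrite invr1 mul1e.
exact: measurable_slice2.
Qed.

Lemma shear2_preserves_area t : preserves_area (fun z => (z.1, z.2 + t * z.1)%R).
Proof.
move=> f mf f0.
have mfT : measurable_fun setT (fun z : R * R => f (z.1, z.2 + t * z.1)%R).
  apply: (measurable_fun_comp_pair mf) => //.
  by apply: measurable_funD => //; apply: measurable_funM.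
split => //.
rewrite (integral_xy mfT (fun z => f0 _)) (integral_xy mf f0) /=.
apply: eq_integral => x _.
under eq_integral do rewrite -[X in f (_, X + _)%R]mul1r.
rewrite (@ge0_integral_affine 1 (t * x) (fun y => f (x, y)))//; first by rewrite invr1 mul1e.
exact: measurable_slice1.
Qed.

Lemma translation_preserves_area a b : preserves_area (fun z => (z.1 + a, z.2 + b)%R).
Proof.
move=> f mf f0.
have mfT : measurable_fun setT (fun z : R * R => f (z.1 + a, z.2 + b)%R).
  by apply: (measurable_fun_comp_pair mf) => //; exact: measurable_funD.
have mf1 : measurable_fun setT (fun z : R * R => f (z.1 + a, z.2)%R).
  by apply: (measurable_fun_comp_pair mf) => //; exact: measurable_funD.
split => //.
transitivity (\int[mu2]_z f (z.1 + a, z.2)%R).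
  rewrite (integral_xy mfT (fun z => f0 _)) (integral_xy mf1 (fun z => f0 _)) /=.
  apply: eq_integral => x _.
  under eq_integral do rewrite -[X in f (_, X + _)%R]mul1r.
  rewrite (@ge0_integral_affine 1 b (fun y => f (x + a, y)%R))//; first by rewrite invr1 mul1e.
  exact: measurable_slice1.
rewrite (integral_yx mf1 (fun z => f0 _)) (integral_yx mf f0) /=.
apply: eq_integral => y _.
under eq_integral do rewrite -[X in f (X + _, _)%R]mul1r.
rewrite (@ge0_integral_affine 1 a (fun x => f (x, y)))//; first by rewrite invr1 mul1e.
exact: measurable_slice2.
Qed.

Lemma integral_dilation k f : (0 < k)%R ->
  measurable_fun setT f -> (forall z, 0 <= f z) ->
  \int[mu2]_z f (k * z.1, k * z.2)%R = (k ^- 2)%:E * \int[mu2]_z f z.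
Proof.
move=> k0 mf f0.
have mfT : measurable_fun setT (fun z : R * R => f (k * z.1, k * z.2)%R).
  by apply: (measurable_fun_comp_pair mf) => //; exact: measurable_funM.
have mf1 : measurable_fun setT (fun z : R * R => f (k * z.1, z.2)%R).
  by apply: (measurable_fun_comp_pair mf) => //; exact: measurable_funM.
have step : \int[mu2]_z f (k * z.1, k * z.2)%R = (k^-1)%:E * \int[mu2]_z f (k * z.1, z.2)%R.
  rewrite (integral_xy mfT (fun z => f0 _)) (integral_xy mf1 (fun z => f0 _)) /=.
  rewrite -ge0_integralZl//; last 3 first.
  - exact: (measurable_integral_y mf1).
  - by move=> x _; exact: integral_ge0.
  - by rewrite lee_fin invr_ge0 ltW.
  apply: eq_integral => x _.
  under eq_integral do rewrite -[X in f (_, X)%R]addr0.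
  rewrite (@ge0_integral_affine k 0 (fun y => f (k * x, y)%R))//.
  exact: measurable_slice1.
rewrite step (integral_yx mf1 (fun z => f0 _)) (integral_yx mf f0) /=.
rewrite expr2 invfM EFinM -muleA; congr (_ * _).
rewrite -ge0_integralZl//; last 3 first.
- exact: (measurable_integral_x mf).
- by move=> x _; exact: integral_ge0.
- by rewrite lee_fin invr_ge0 ltW.
apply: eq_integral => y _.
under eq_integral do rewrite -[X in f (X, _)%R]addr0.
rewrite (@ge0_integral_affine k 0 (fun x => f (x, y)))//.
exact: measurable_slice2.
Qed.

Lemma preserves_area_ext T1 T2 : T1 =1 T2 -> preserves_area T1 -> preserves_area T2.
Proof. by move=> /funext ->. Qed.

(* a rotation other than the half turn is a product of three shears *)
Lemma rotation_preserves_area (c s : R) : (c ^+ 2 + s ^+ 2 = 1)%R ->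
  preserves_area (fun z => (c * z.1 - s * z.2, s * z.1 + c * z.2)%R).
Proof.
have main (c' s' : R) : (c' ^+ 2 + s' ^+ 2 = 1)%R -> (c' != - 1)%R ->
    preserves_area (fun z => (c' * z.1 - s' * z.2, s' * z.1 + c' * z.2)%R).
  move=> cs c1; have c10 : (1 + c' != 0)%R by rewrite addrC addr_eq0.
  (* For the rotation by an angle a this is -tan(a/2), the slope of the two outer shears; the middle
     one has slope sin a. *)
  pose t := (- (s' / (1 + c')))%R.
  apply: preserves_area_ext (preserves_area_comp (shear1_preserves_area t)
    (preserves_area_comp (shear2_preserves_area s') (shear1_preserves_area t))).
  move=> [x y] /=; rewrite /t.
  have E : (s' ^+ 2 = (1 + c') * (1 - c'))%R.
    have -> : (s' ^+ 2 = 1 - c' ^+ 2)%R by rewrite -cs [(c' ^+ 2 + _)%R]addrC addrK.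
    by ring.
  have E2 : (s' * s' / (1 + c') = 1 - c')%R by rewrite -expr2 E mulrAC mulfV// mul1r.
  have E3 : (s' * (s' / (1 + c')) = 1 - c')%R by rewrite mulrA.
  congr (_, _).
    have -> : (x + - (s' / (1 + c')) * y + - (s' / (1 + c')) * (y + s' * (x + - (s' / (1 + c')) * y)) =
      (1 - s' * (s' / (1 + c'))) * x - (s' / (1 + c')) * (2 - s' * (s' / (1 + c'))) * y)%R by ring.
    rewrite E3 (_ : 2 - (1 - c') = 1 + c')%R; last by ring.
    by rewrite divfK//; ring.
  have -> : (y + s' * (x + - (s' / (1 + c')) * y) = s' * x + (1 - s' * (s' / (1 + c'))) * y)%R by ring.
  by rewrite E3; ring.
move=> cs; have [c1|c1] := eqVneq c (- 1)%R; last exact: main.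
have s0 : s = 0%R.
  by move: cs; rewrite c1 sqrrN expr1n => /eqP; rewrite -subr_eq0 addrC addKr sqrf_eq0 => /eqP.
(* The excluded half turn is the quarter turn applied twice. *)
have q : preserves_area (fun z => (0 * z.1 - 1 * z.2, 1 * z.1 + 0 * z.2)%R).
  by apply: main; rewrite ?expr0n ?expr1n ?add0r// eq_sym oppr_eq0 oner_eq0.
apply: preserves_area_ext (preserves_area_comp q q).
by move=> [x y] /=; rewrite c1 s0; congr (_, _); ring.
Qed.

End lebesgue_affine.

(** * Measurability of continuous functions on open subsets of the plane *)

Section plane_measurability.
Context {R : realType}.
Implicit Types (D U : set (R * R)) (f : R * R -> R).

(** The sigma-algebra is the product one, so [U] is written as a countable union of boxes with
    rational corners: all codes of boxes are enumerated, and a box not contained in [U] is replaced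
    by the empty set. *)
Lemma open_measurable_plane U : open U -> measurable U.
Proof.
move=> oU.
pose box (q : rat * rat * (rat * rat)) : set (R * R) :=
  `]ratr q.1.1, ratr q.1.2[%classic `*` `]ratr q.2.1, ratr q.2.2[%classic.
pose F (n : nat) : set (R * R) := if unpickle n is Some q then
  if `[< box q `<=` U >] then box q else set0 else set0.
have -> : U = \bigcup_n F n.
  apply/seteqP; split; last first.
    move=> z [n _]; rewrite /F; case: unpickle => // q.
    by case: asboolP => // qU; exact: qU.
  move=> [x y] Uxy.
  have : nbhs (x, y) U by exact: open_nbhs_nbhs.
  move=> [[/= P Q] [/nbhs_ballP[e /= e0 eP] /nbhs_ballP[d /= d0 dQ]] PQU].
  have xe : x - e < x by lra.
  have xe' : x < x + e by lra.
  have yd : y - d < y by lra.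
  have yd' : y < y + d by lra.
  have [q1] := rat_in_itvoo xe; rewrite in_itv/= => /andP[q1a q1b].
  have [q2] := rat_in_itvoo xe'; rewrite in_itv/= => /andP[q2a q2b].
  have [q3] := rat_in_itvoo yd; rewrite in_itv/= => /andP[q3a q3b].
  have [q4] := rat_in_itvoo yd'; rewrite in_itv/= => /andP[q4a q4b].
  have [n Hn] : exists n, unpickle n = Some ((q1, q2), (q3, q4)).
    by exists (pickle ((q1, q2), (q3, q4))); exact: pickleK.
  exists n; first exact: I.
  rewrite /F Hn.
  case: asboolP => [_|]; first by split; rewrite /= in_itv/=; apply/andP.
  case=> -[a b] [/=]; rewrite !in_itv/= => /andP[a1 a2] /andP[b1 b2]; apply: PQU; split => /=.
    by apply: eP; rewrite /ball/= ltr_norml; apply/andP; split; lra.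
  by apply: dQ; rewrite /ball/= ltr_norml; apply/andP; split; lra.
apply: bigcup_measurable => n _; rewrite /F; case: unpickle => // q.
by case: asboolP => // _; apply: measurableX; exact: measurable_itv.
Qed.

Lemma open_continuous_measurable_plane D f : open D ->
  (forall z, D z -> {for z, continuous f}) -> measurable_fun D f.
Proof.
move=> oD cf; apply: (measurability _ (RGenOInfty.measurableE R)).
move=> /= _ [_ [a ->]] <-; apply: open_measurable_plane.
rewrite openE => z [Dz fz]; apply: filterI; first exact: open_nbhs_nbhs.
by apply: (cf z Dz); apply: open_nbhs_nbhs; split => //; exact: interval_open.
Qed.

End plane_measurability.

(** * Continuity and exchange of averages depending on a parameter *)

Section parameter_averages.
Context {R : realType}.
Local Notation mu := (@lebesgue_measure R).
Local Notation I := (`[(0 : R), 2 * pi]%classic).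

Lemma continuous_pair (T U V : topologicalType) (f : T -> U) (g : T -> V) (x : T) :
  {for x, continuous f} -> {for x, continuous g} -> {for x, continuous (fun y => (f y, g y))}.
Proof.
move=> cf cg.
exact: (@cvg_pair T U V (nbhs x) (nbhs (f x)) (nbhs (g x)) _ _ _ f g cf cg).
Qed.

Lemma continuous_fst (T U : topologicalType) : continuous (@fst T U).
Proof. by move=> z; exact: (@cvg_fst T U (nbhs z.1) (nbhs z.2)). Qed.

Lemma continuous_snd (T U : topologicalType) : continuous (@snd T U).
Proof. by move=> z; exact: (@cvg_snd T U (nbhs z.1) (nbhs z.2)). Qed.

Lemma continuous_slice1 (T : topologicalType) (H : R * R -> T) x t :
  {for (x, t), continuous H} -> {for t, continuous (fun t => H (x, t))}.
Proof.
move=> cH; apply: (@continuous_comp _ _ _ (fun t => (x, t)) H) => //.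
exact: (@continuous_pair _ _ _ (fun=> x) id t (@cvg_cst _ _ _ _ _) (@cvg_id _ _)).
Qed.

Lemma continuous_slice2 (T : topologicalType) (H : R * R -> T) x t :
  {for (x, t), continuous H} -> {for x, continuous (fun x => H (x, t))}.
Proof.
move=> cH; apply: (@continuous_comp _ _ _ (fun x => (x, t)) H) => //.
exact: (@continuous_pair _ _ _ id (fun=> t) x (@cvg_id _ _) (@cvg_cst _ _ _ _ _)).
Qed.

Lemma avg_integral (g : R -> R) : continuous g ->
  ((avg g)%:E = ((2 * pi)^-1)%:E * \int[mu]_(t in I) (g t)%:E)%E.
Proof.
move=> cg; rewrite /avg EFinM /itg /Rintegral fineK//.
apply: integrable_fin_num => //.
by apply: cont_on_integrable; exact: continuous_cont_on.
Qed.

Lemma rectangle_bounded (H : R * R -> R) (a b c d : R) : a <= b -> c <= d ->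
  (forall x t, a <= x <= b -> c <= t <= d -> {for (x, t), continuous H}) ->
  exists B, forall x t, a <= x <= b -> c <= t <= d -> `|H (x, t)| <= B.
Proof.
move=> ab cd cH; pose K := `[a, b]%classic `*` `[c, d]%classic.
have K0 : K !=set0 by exists (a, c); split; rewrite /= in_itv/= lexx.
have cK : compact K by apply: compact_setX; exact: segment_compact.
have [|z _ Hz] := compact_EVT_max (f := fun z => `|H z|) K0 cK.
  apply: continuous_in_subspaceT => -[x t]; rewrite inE => -[/=].
  rewrite !in_itv/= => xab tcd; apply: (@continuous_comp _ _ _ H (fun y => `|y|)).
    exact: cH.
  exact: norm_continuous.
exists `|H z| => x t xab tcd; apply: (Hz (x, t)).
by rewrite inE; split; rewrite /= in_itv/=.
Qed.

Lemma continuous_avg_param (H : R * R -> R) (a b x : R) :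
  (forall y t, a < y < b -> {for (y, t), continuous H}) -> a < x < b ->
  {for x, continuous (fun y => avg (fun t => H (y, t)))}.
Proof.
move=> cH /andP[ax xb].
(* [H] may be unbounded up to [a] and [b]. On the compact interval from [u] to [v] it has a bound
   [B], and this constant is the dominating function. *)
pose u := (a + x) / 2; pose v := (x + b) / 2.
have au : a < u by rewrite /u; lra.
have ux : u < x by rewrite /u; lra.
have xv : x < v by rewrite /v; lra.
have vb : v < b by rewrite /v; lra.
have inab y : u <= y <= v -> a < y < b by move=> /andP[? ?]; apply/andP; split; lra.
have [B HB] : exists B, forall y t, u <= y <= v -> 0 <= t <= 2 * pi -> `|H (y, t)| <= B.
  apply: rectangle_bounded; [by lra|exact/ltW/twopi_gt0|].
  by move=> y t /inab yab _; exact: cH.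
have cslice y : a < y < b -> continuous (fun t => H (y, t)).
  by move=> yab t; apply: continuous_slice1; exact: cH.
apply: (@continuous_comp _ _ _ (fun y => itg 0 (2 * pi) (fun t => H (y, t)))
   (fun z => (2 * pi)^-1 * z)); last exact: mulrl_continuous.
have bnd y : `]u, v[%classic y -> u <= y <= v.
  by rewrite /= in_itv/= => /andP[/ltW -> /ltW ->].
apply: (@continuity_under_integral R _ _ mu (fun y t => H (y, t)) I _ u v _ _ (fun=> B)).
- exact: measurable_itv.
- move=> y /bnd/inab yab; apply: cont_on_integrable.
  by apply: continuous_cont_on; exact: cslice.
- apply: aeW => t _ y; rewrite inE => /bnd/inab yab.
  by apply: continuous_slice2; exact: cH.
- by apply: cont_on_integrable; exact: cont_on_cst.
- move=> y /bnd yuv; apply: aeW => t; rewrite /= in_itv/= => tI; exact: HB.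
- by rewrite inE /= in_itv/= ux xv.
Qed.

Lemma continuous_avg_paramT (H : R * R -> R) : continuous H ->
  continuous (fun y => avg (fun t => H (y, t))).
Proof.
move=> cH x; apply: (@continuous_avg_param H (x - 1) (x + 1)).
  by move=> y t _; exact: cH.
by apply/andP; split; lra.
Qed.

Lemma avg_swap (H : R * R -> R) : continuous H -> (forall z, 0 <= H z) ->
  avg (fun s => avg (fun t => H (s, t))) = avg (fun t => avg (fun s => H (s, t))).
Proof.
move=> cH H0.
pose H' (z : R * R) := H (z.2, z.1).
have cH' : continuous H'.
  move=> z; apply: (@continuous_comp _ _ _ (fun z : R * R => (z.2, z.1)) H); last exact: cH.
  exact: (@continuous_pair _ _ _ snd fst z (@continuous_snd _ _ _) (@continuous_fst _ _ _)).
have mI : measurable I by exact: measurable_itv.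
pose h (z : R * R) : \bar R := (\1_I z.1 * (\1_I z.2 * H z))%:E.
have mH : measurable_fun setT H.
  by apply: open_continuous_measurable_plane => [|z _]; [exact: openT|exact: cH].
have mh : measurable_fun setT h.
  apply/measurable_EFinP; apply: measurable_funM.
    exact: (measurableT_comp (measurable_indic mI) measurable_fst).
  apply: measurable_funM => //.
  exact: (measurableT_comp (measurable_indic mI) measurable_snd).
have h0 z : (0 <= h z)%E by rewrite lee_fin !mulr_ge0 ?indic_ge0.
have cs1 s : continuous (fun t => H (s, t)) by move=> t; apply: continuous_slice1; exact: cH.
have cs2 t : continuous (fun s => H (s, t)) by move=> s; apply: continuous_slice2; exact: cH.
pose k : R := (2 * pi)^-1.
have k0 : 0 <= k by rewrite invr_ge0 ltW// twopi_gt0.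
have E1 : (\int[mu]_(s in I) (k%:E * \int[mu]_(t in I) (H (s, t))%:E) =
           \int[mu]_s (k%:E * \int[mu]_t h (s, t)))%E.
  rewrite integral_mkcond; apply: eq_integral => s _; rewrite patchE /h /=.
  case: ifPn => sI; last first.
    under eq_integral do rewrite indicE (negbTE sI) mul0r.
    by rewrite integral0 mule0.
  congr (_ * _)%E; rewrite integral_mkcond; apply: eq_integral => t _.
  rewrite patchE !indicE sI mul1r.
  by case: ifPn => _; rewrite ?mul1r ?mul0r.
have E2 : (\int[mu]_(t in I) (k%:E * \int[mu]_(s in I) (H (s, t))%:E) =
           \int[mu]_t (k%:E * \int[mu]_s h (s, t)))%E.
  rewrite integral_mkcond; apply: eq_integral => t _; rewrite patchE /h /=.
  case: ifPn => tI; last first.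
    under eq_integral do rewrite [\1_I t]indicE (negbTE tI) mul0r mulr0.
    by rewrite integral0 mule0.
  congr (_ * _)%E; rewrite integral_mkcond; apply: eq_integral => s _.
  rewrite patchE !indicE tI mul1r.
  by case: ifPn => _; rewrite ?mul1r ?mul0r.
apply: EFin_inj.
rewrite (avg_integral (continuous_avg_paramT cH)) (avg_integral (continuous_avg_paramT cH')).
congr (_ * _)%E.
under eq_integral do rewrite (avg_integral (cs1 _)).
under [RHS]eq_integral do rewrite (avg_integral (cs2 _)).
have F1 := @ge0_integralZl _ _ R mu setT measurableT (fun s => \int[mu]_t h (s, t))%E
  (measurable_integral_y mh h0) k%:E.
have F2 := @ge0_integralZl _ _ R mu setT measurableT (fun t => \int[mu]_s h (s, t))%E
  (measurable_integral_x mh h0) k%:E.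
rewrite E1 E2 F1 ?F2; first last; try by move=> x _; apply: integral_ge0.
- by rewrite lee_fin.
- by rewrite lee_fin.
by rewrite -(integral_xy mh h0) (integral_yx mh h0).
Qed.

End parameter_averages.

(** * Monotonicity of circular means *)

Section arguments.
Context {R : realType}.
Local Notation mu := (@lebesgue_measure R).
Local Notation C := (R[i]^o).

Lemma itg_shift (g : R -> R) a b (d : R) : continuous g -> (forall x, 0 <= g x) ->
  itg a b (fun t => g (t + d)) = itg (a + d) (b + d) g.
Proof.
move=> cg g0; rewrite /itg /Rintegral; congr fine.
pose f (x : R) : \bar R := (\1_(`[(a + d), (b + d)]%classic) x * g x)%:E.
have mg : measurable_fun setT g by exact: continuous_measurable_fun.
have mf : measurable_fun setT f.
  by apply/measurable_EFinP; apply: measurable_funM => //; exact: measurable_indic.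
have f0 x : (0 <= f x)%E by rewrite lee_fin mulr_ge0 ?indic_ge0.
have -> : (\int[mu]_(x in `[(a + d)%R, (b + d)%R]) (g x)%:E = \int[mu]_x f x)%E.
  rewrite integral_mkcond; apply: eq_integral => x _; rewrite patchE /f indicE.
  by case: ifPn => _; rewrite ?mul1r ?mul0r.
have -> : (\int[mu]_x f x = \int[mu]_x f (1 * x + d)%R)%E.
  by rewrite (ge0_integral_affine d ltr01 mf f0) invr1 mul1e.
rewrite integral_mkcond; apply: eq_integral => x _; rewrite patchE /f indicE mul1r.
have -> : (x + d \in `[(a + d)%R, (b + d)%R]%classic) = (x \in `[a, b]%classic).
  by apply/idP/idP; rewrite !inE/= !in_itv/= !lerD2r.
by case: ifPn => _; rewrite ?mul1r ?mul0r.
Qed.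

Lemma avg_shift (g : R -> R) d : continuous g -> (forall x, 0 <= g x) ->
  (forall t, g (t + 2 * pi) = g t) -> 0 <= d <= 2 * pi ->
  avg (fun t => g (t + d)) = avg g.
Proof.
move=> cg g0 pg /andP[d0 d1]; congr (_ * _).
have c a b : cont_on a b g by exact: continuous_cont_on.
rewrite itg_shift// add0r (@itg_split _ d (2 * pi)) ?lerDl//.
rewrite (@itg_split _ 0 d (2 * pi))// addrC; congr (_ + _).
have -> : itg (2 * pi) (2 * pi + d) g = itg (0 + 2 * pi) (d + 2 * pi) g.
  by rewrite add0r [d + _]addrC.
rewrite -itg_shift//.
by apply: eq_itg => x _; rewrite pg.
Qed.

(** A positive value at 0 would persist on a short segment to its right. The end point is the place
    of interest: in [circ_mono] the angle 0 is where the circle touches the larger radius. *)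
Lemma itg_le0_at0 (g : R -> R) (b : R) : 0 < b -> continuous g -> (forall t, 0 <= g t) ->
  itg 0 b g <= 0 -> g 0 <= 0.
Proof.
move=> b0 cg g0 Ig; rewrite leNgt; apply/negP => gp.
have e0 : 0 < g 0 / 2 by rewrite divr_gt0.
have := cg 0 => /(@cvgrPdist_lt _ _ _ (nbhs (0 : R)) _ g)/(_ _ e0)/nbhs_normP[d /= dp Hd].
pose c := Num.min (d / 2) b.
have c0 : 0 < c by rewrite lt_min divr_gt0.
have cb : c <= b by rewrite ge_min lexx orbT.
have cd : c < d by rewrite /c gt_min ltr_pdivrMr// ltr_pMr// ltr1n.
have cgo u v : cont_on u v g by exact: continuous_cont_on.
have : 0 < itg 0 b g.
  rewrite (@itg_split _ 0 c b)// ?ltW//.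
  apply: (@lt_le_trans _ _ (itg 0 c (fun=> g 0 / 2))).
    by rewrite itg_cst ?ltW// subr0 mulr_gt0.
  rewrite -[leLHS]addr0; apply: lerD; last by apply: itg_ge0.
  apply: le_itg => //; first exact: cont_on_cst.
  move=> u /andP[u0 ud].
  have := Hd u; rewrite /ball_/= sub0r normrN ger0_norm// => /(_ (le_lt_trans ud cd)).
  by rewrite ltr_norml => /andP[_]; lra.
by rewrite ltNge Ig.
Qed.

Lemma exists_arg (z : R[i]) : exists2 d : R, 0 <= d <= 2 * pi & z = (modulus z)%:C * cis d.
Proof.
have pi0 : 0 <= pi :> R by exact: pi_ge0.
have [->|z0] := eqVneq z 0.
  exists 0; first by rewrite lexx mulr_ge0.
  by rewrite modulus0 mul0r.
have mz : modulus z != 0 by rewrite gt_eqF// modulus_gt0.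
pose x := Re z / modulus z; pose y := Im z / modulus z.
have xy : x ^+ 2 + y ^+ 2 = 1.
  by rewrite /x /y !expr_div_n -mulrDl -sqr_modulus divff// expf_neq0.
have x1 : -1 <= x <= 1.
  by rewrite -ler_norml -(@ler_pXn2r _ 2)// ?nnegrE// expr1n real_normK ?num_real// -xy lerDl sqr_ge0.
have sx : sin (acos x) = `|y|.
  by rewrite sin_acos// -sqrtr_sqr; congr Num.sqrt; rewrite -xy addrC addKr.
have cx : cos (acos x) = x by rewrite acosK// in_itv.
have zE d : cos d = x -> sin d = y -> z = (modulus z)%:C * cis d.
  move=> c s; apply: complex_ext; rewrite !complexE2 /= c s mul0r ?subr0 ?addr0 /x /y;
    by rewrite mulrC divfK.
have [y0|y0] := leP 0 y.
  exists (acos x); last by apply: zE; rewrite ?cx// sx ger0_norm.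
  by rewrite acos_ge0//= (le_trans (acos_lepi x1))// mulr_natl mulr2n lerDl.
exists (2 * pi - acos x).
  rewrite subr_ge0 (le_trans (acos_lepi x1)) ?lerBlDr ?lerDl ?acos_ge0//.
  by rewrite mulr_natl mulr2n lerDl.
have c2 : cos (2 * pi - acos x) = cos (acos x).
  by rewrite cosB mulr_natl cos2pi sin2pi mul1r mul0r addr0.
have s2 : sin (2 * pi - acos x) = - sin (acos x).
  by rewrite sinB mulr_natl cos2pi sin2pi mul1r mul0r sub0r.
by apply: zE; rewrite ?c2 ?cx// s2 sx ltr0_norm// opprK.
Qed.

End arguments.

Section circle_means.
Context {R : realType}.
Local Notation C := (R[i]^o).
Variables (F dF : R[i] -> R[i]) (p : R).
Hypotheses (p2 : 2 <= p) (HF : forall z, modulus z < 1 -> cdiff F z (dF z)).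

(** The rotation acts on the argument, so this is at once a function on the disc depending only on
    the modulus ([circ_modulus]) and an average over the rotated functions, to each of which
    pointwise estimates apply. *)
Definition circ (G : R[i] -> R[i]) (q : R) z := avg (fun t => modulus (G (cis t * z)) `^ q).

Let p0 : 0 < p. Proof. by apply: lt_le_trans p2. Qed.

Let modulus_cisM t (z : R[i]) : modulus (cis t * z) = modulus z.
Proof. by rewrite normcM modulus_cis mul1r. Qed.

Lemma continuous_powR_comp (T : topologicalType) (G : R[i] -> R[i]) (g : T -> R[i]) (x : T) :
  {for x, continuous (g : T -> C)} -> {for g x, continuous (G : C -> C)} ->
  {for x, continuous (fun y => modulus (G (g y)) `^ p)}.
Proof.
move=> cg cG.
exact: (@continuous_modulus_powR _ T (fun y => G (g y)) p x p0 (@continuousC_comp _ T g G x cg cG)).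
Qed.

Let cF z : modulus z < 1 -> {for z, continuous (F : C -> C)}.
Proof. by move=> z1; exact: cdiff_continuous (HF z1). Qed.

Lemma continuous_cisM (z : R[i]) : continuous (fun t => (cis t * z : R[i]) : C).
Proof. exact: (@continuousCM _ cis (fun=> z) continuous_cis (@continuous_cstC _ z)). Qed.

Section general.
Variable G : R[i] -> R[i].
Hypothesis cG : forall z, modulus z < 1 -> {for z, continuous (G : C -> C)}.

Lemma continuous_on_circle z : modulus z < 1 -> continuous (fun t => modulus (G (cis t * z)) `^ p).
Proof.
move=> z1 t; apply: (@continuous_powR_comp _ G (fun t => cis t * z)); first exact: continuous_cisM.
by apply: cG; rewrite modulus_cisM.
Qed.

Lemma circ_modulus z : modulus z < 1 -> circ G p z = circ G p (modulus z)%:C.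
Proof.
move=> z1; have [d dI zE] := exists_arg z.
have m1 : modulus (modulus z)%:C < 1 by rewrite modulus_real ger0_norm.
pose g t := modulus (G (cis t * (modulus z)%:C)) `^ p.
have cg : continuous g by exact: (continuous_on_circle m1).
have g0 t : 0 <= g t by exact: powR_ge0.
have pg t : g (t + 2 * pi) = g t by rewrite /g cisD cis2pi mulr1.
have <- : avg (fun t => g (t + d)) = circ G p (modulus z)%:C by exact: avg_shift.
by apply: eq_avg => t; rewrite /g {1}zE cisD -mulrA [cis d * _]mulrC.
Qed.

Lemma circ_continuous (x : R) : -1 < x < 1 -> {for x, continuous (fun r : R => circ G p r%:C)}.
Proof.
move=> x1; apply: (@continuous_avg_param _ (fun y : R * R => modulus (G (cis y.2 * y.1%:C)) `^ p) (-1) 1) => // y t y1.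
apply: (@continuous_powR_comp _ G (fun y : R * R => cis y.2 * y.1%:C)); last first.
  by apply: cG; rewrite modulus_cisM modulus_real ltr_norml.
have c1 : {for (y, t), continuous (fun y : R * R => cis y.2 : C)}.
  apply: (@continuous_comp _ _ _ snd (cis : R -> C)); first exact: continuous_snd.
  exact: continuous_cis.
have c2 : {for (y, t), continuous (fun y : R * R => y.1%:C : C)}.
  apply: (@continuous_comp _ _ _ fst (fun x : R => x%:C : C)); first exact: continuous_fst.
  exact: continuous_RtoC.
exact: (cvgM c1 c2).
Qed.

Lemma circ_ge0 z : 0 <= circ G p z.
Proof. by apply: avg_ge0 => t; exact: powR_ge0. Qed.

End general.

Lemma continuous_derivative z : modulus z < 1 -> {for z, continuous (dF : C -> C)}.
Proof.
move=> z1; have s0 : 0 < 1 - modulus z by rewrite subr_gt0.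
have [|d Hd] := @cdiff_derivative _ F dF z (1 - modulus z) s0; last exact: cdiff_continuous Hd.
move=> w wz; apply: HF; rewrite -[w](subrK z) (le_lt_trans (le_normcD _ _))//.
by rewrite -ltrBrDr.
Qed.

Let inside z (r : R) t : 0 < r -> modulus z + r < 1 -> modulus (polar z r t) < 1.
Proof.
move=> r0 zr; apply: le_lt_trans (le_normcD _ _) _.
by rewrite normcM modulus_real modulus_cis mulr1 gtr0_norm.
Qed.

(** [circle_mean_lower_bound] for each rotated function [F (cis t * w)], whose derivative has the
    modulus of [dF (cis t * w)], is averaged over [t]; [avg_swap] exchanges the two averages. *)
Lemma circ_lower_bound z (r : R) : 0 < r -> modulus z + r < 1 ->
  circ F p z + 2 * (r / 2) `^ p * circ dF p z <= avg (fun s => circ F p (polar z r s)).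
Proof.
move=> r0 zr; have z1 : modulus z < 1 by apply: lt_trans zr; rewrite ltrDl.
pose H (y : R * R) := modulus (F (cis y.1 * polar z r y.2)) `^ p.
have cH : continuous H.
  move=> y; apply: (@continuous_powR_comp _ F (fun y : R * R => cis y.1 * polar z r y.2)); last first.
    by apply: cF; rewrite modulus_cisM inside.
  have c1 : {for y, continuous (fun y : R * R => cis y.1 : C)}.
    apply: (@continuous_comp _ _ _ fst (cis : R -> C)); first exact: continuous_fst.
    exact: continuous_cis.
  have c2 : {for y, continuous (fun y : R * R => polar z r y.2 : C)}.
    apply: (@continuous_comp _ _ _ snd (polar z r : R -> C)); first exact: continuous_snd.
    exact: continuous_polar_t.
  exact: (cvgM c1 c2).
have -> : avg (fun s => circ F p (polar z r s)) = avg (fun t => avg (fun s => H (t, s))).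
  by symmetry; exact: (avg_swap cH (fun y => powR_ge0 _ _)).
have c1 := continuous_on_circle cF z1.
have c2 := continuous_on_circle continuous_derivative z1.
have c3 : continuous (fun t => 2 * (r / 2) `^ p * modulus (dF (cis t * z)) `^ p).
  by move=> t; apply: cvgM; [exact: cvg_cst|exact: c2].
rewrite /circ -(avgZ _ c2) -(avgD c1 c3); apply: le_avg.
- by move=> t; exact: (cvgD (c1 t) (c3 t)).
- exact: continuous_avg_paramT.
- move=> t.
  have := @circle_mean_lower_bound _ (fun w => F (cis t * w)) (fun w => cis t * dF (cis t * w)) z r p p2 r0.
  rewrite modulus_cisM (_ : r * _ / 2 = (r / 2) * modulus (dF (cis t * z))); last by ring.
  rewrite powRM//; last by rewrite divr_ge0// ltW.
  rewrite mulrA; apply => w wz e e0.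
  have w1 : modulus (cis t * w) < 1.
    rewrite modulus_cisM -[w](subrK z) (le_lt_trans (le_normcD _ _))//.
    by rewrite addrC (le_lt_trans _ zr)// lerD2l.
  have [d d0 Hd] := HF w1 e0; exists d => // h hd.
  have := Hd (cis t * h); rewrite modulus_cisM mulrDr => /(_ hd).
  by rewrite mulrA [dF _ * cis t]mulrC.
Qed.

(** Maximum principle: without its nonnegative derivative term, [circ_lower_bound] is a sub-mean
    value property of the radial function [circ F p]. *)
Lemma circ_mono (r s : R) : 0 <= r -> r <= s -> s < 1 -> circ F p r%:C <= circ F p s%:C.
Proof.
move=> r0 rs s1; have s0 : 0 <= s by exact: le_trans rs.
pose M (x : R) := circ F p x%:C.
have cM : {within `[0, s], continuous M}.
  apply: continuous_in_subspaceT => x; rewrite inE /= in_itv/= => /andP[x0 xs].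
  by apply: circ_continuous => //; apply/andP; split; lra.
have [x] := EVT_max s0 cM; rewrite in_itv/= => /andP[x0 xs] maxM.
have maxM' y : 0 <= y -> y <= s -> M y <= M x by move=> y0 ys; apply: maxM; rewrite in_itv/= y0.
have [xs'|sx] := ltP x s; last first.
  have xE : x = s by apply/eqP; rewrite eq_le xs sx.
  by rewrite -[leRHS]/(M s) -xE; exact: maxM'.
(* at a maximum point [x < s] the mean over the circle of radius [s - x] around [x]
   forces the value [M x] to be attained everywhere on it, in particular at [s] *)
have d0 : 0 < s - x by rewrite subr_gt0.
have xd : modulus x%:C + (s - x) < 1 by rewrite modulus_real ger0_norm// addrC subrK.
have pin t : modulus (polar x%:C (s - x) t) <= s.
  apply: le_trans (le_normcD _ _) _.
  by rewrite normcM !modulus_real modulus_cis mulr1 ger0_norm// gtr0_norm// addrC subrK.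
have pin1 t : modulus (polar x%:C (s - x) t) < 1 by exact: le_lt_trans s1.
pose g t := M x - circ F p (polar x%:C (s - x) t).
have g0 t : 0 <= g t.
  by rewrite /g (circ_modulus cF (pin1 t)) subr_ge0; exact: (maxM' _ (modulus_ge0 _) (pin t)).
have cc : continuous (fun t => circ F p (polar x%:C (s - x) t)).
  move=> t; have -> : (fun t => circ F p (polar x%:C (s - x) t)) =
    (fun t => M (modulus (polar x%:C (s - x) t))).
    by apply/funext => u; rewrite circ_modulus.
  apply: (@continuous_comp _ _ _ (fun t => modulus (polar x%:C (s - x) t)) M).
    by apply: cmodulus; exact: continuous_polar_t.
  by apply: circ_continuous => //; rewrite pin1 (lt_le_trans _ (modulus_ge0 _)).
have cg : continuous g by move=> t; apply: cvgB; [exact: cvg_cst|exact: cc].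
have ag : avg g <= 0.
  have ccM : continuous ((fun=> M x) : R -> R) by exact: cst_continuous.
  have -> : avg g = M x - avg (fun t => circ F p (polar x%:C (s - x) t)).
    have -> : avg g = avg (fun=> M x) - avg (fun t => circ F p (polar x%:C (s - x) t)).
      exact: (avgB ccM cc).
    by congr (_ - _); exact: avg_cst.
  have H := circ_lower_bound d0 xd.
  have H2 : 0 <= 2 * ((s - x) / 2) `^ p * circ dF p x%:C.
    by apply: mulr_ge0; [apply: mulr_ge0 => //; exact: powR_ge0|exact: circ_ge0].
  rewrite subr_le0; apply: le_trans H.
  by rewrite -[leLHS]addr0 lerD2l.
have gs0 : g 0 = M x - M s.
  have pE : polar x%:C (s - x) 0 = s%:C.
    by rewrite /polar cis0 mulr1 -rmorphD [x + _]addrC subrK.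
  by rewrite /g pE.
have : g 0 <= 0.
  apply: (itg_le0_at0 twopi_gt0 cg g0).
  have ip : 0 < (2 * pi)^-1 :> R by rewrite invr_gt0; exact: twopi_gt0.
  by move: ag; rewrite /avg (pmulr_rle0 _ ip).
by rewrite gs0 subr_le0; apply: le_trans; exact: maxM'.
Qed.

(** The circle of radius [s - r] around [r] stays in the closed disc of radius [s], where
    [circ_mono] bounds the mean by its value at [s]. *)
Lemma circ_telescope (r s : R) : 0 <= r -> r < s -> s < 1 ->
  2 * ((s - r) / 2) `^ p * circ dF p r%:C <= circ F p s%:C - circ F p r%:C.
Proof.
move=> r0 rs s1; have d0 : 0 < s - r by rewrite subr_gt0.
have zr : modulus r%:C + (s - r) < 1 by rewrite modulus_real ger0_norm// addrC subrK.
rewrite lerBrDl; apply: le_trans (circ_lower_bound d0 zr) _.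
have pin t : modulus (polar r%:C (s - r) t) <= s.
  apply: le_trans (le_normcD _ _) _.
  by rewrite normcM !modulus_real modulus_cis mulr1 ger0_norm// gtr0_norm// addrC subrK.
have pin1 t : modulus (polar r%:C (s - r) t) < 1 by exact: le_lt_trans s1.
rewrite -(avg_cst (circ F p s%:C)); apply: le_avg; [|exact: cst_continuous|].
  move=> t; have -> : (fun t => circ F p (polar r%:C (s - r) t)) =
    (fun t => circ F p (modulus (polar r%:C (s - r) t))%:C).
    by apply/funext => u; rewrite circ_modulus.
  apply: (@continuous_comp _ _ _ (fun t => modulus (polar r%:C (s - r) t)) (fun x : R => circ F p x%:C)).
    by apply: cmodulus; exact: continuous_polar_t.
  by apply: circ_continuous => //; rewrite pin1 (lt_le_trans _ (modulus_ge0 _)).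
by move=> t; rewrite (circ_modulus cF (pin1 t)); exact: (circ_mono (modulus_ge0 _) (pin t) s1).
Qed.

End circle_means.

(** * Integrals over discs *)

Section circular_integrals.
Context {R : realType}.
Local Notation mu := (@lebesgue_measure R).
Local Notation mu2 := ((mu \x mu)%E).
Local Notation I := (`[(0 : R), 2 * pi]%classic).
Local Notation C := (R[i]^o).

Lemma plane_sigma_finite : sigma_finite setT (mu \x mu)%E.
Proof.
exists (fun n => `[(- n%:R : R), n%:R]%classic `*` `[(- n%:R : R), n%:R]%classic).
  apply/seteqP; split => // -[x y] _.
  pose b := maxn (Num.bound `|x|) (Num.bound `|y|).
  have hx : `|x| <= b%:R.
    by apply: le_trans (ltW (archi_boundP (normr_ge0 x))) _; rewrite ler_nat leq_maxl.
  have hy : `|y| <= b%:R.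
    by apply: le_trans (ltW (archi_boundP (normr_ge0 y))) _; rewrite ler_nat leq_maxr.
  by exists b => //; split; rewrite /= in_itv/= -ler_norml.
move=> n; split; first by apply: measurableX; exact: measurable_itv.
rewrite product_measure1E//; try exact: measurable_itv.
have H : (mu `[(- n%:R : R)%R, n%:R%R]%classic < +oo)%E.
  by rewrite lebesgue_measure_itv/=; case: ifPn => _; rewrite ?ltry// -EFinB ltry.
by rewrite lte_mul_pinfty// ge0_fin_numE.
Qed.

(** The area measure packed with its sigma-finiteness, as Tonelli's theorem requires for the product
    of an angle with the plane. *)
Definition plane_measure : {sigma_finite_measure set (measurableTypeR R * measurableTypeR R)%type -> \bar R} :=
 HB.pack (mu \x mu)%E (Measure_isSigmaFinite.Build _ _ _ (mu \x mu)%E plane_sigma_finite).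

Definition toC (z : R * R) : R[i] := z.1 +i* z.2.

Definition rotation t (z : R * R) : R * R :=
  (cos t * z.1 - sin t * z.2, sin t * z.1 + cos t * z.2).

Lemma toC_rotation t z : toC (rotation t z) = cis t * toC z.
Proof. by case: z => x y; apply: complex_ext; rewrite !complexE2 /=; ring. Qed.

(** This replaces integration in polar coordinates. Each rotation preserves the area and [A], so the
    left side equals its own average over [t], and Tonelli's theorem moves this average inside.
    Indicators turn all integrals into integrals over whole spaces. *)
Lemma integral_circular (A : set (R * R)) (g : R[i] -> R) : measurable A ->
  (forall t z, A (rotation t z) <-> A z) -> measurable_fun A (g \o toC) ->
  (forall z, A z -> continuous (fun t => g (cis t * toC z))) -> (forall z, 0 <= g z) ->
  (\int[mu2]_(z in A) (g (toC z))%:E = \int[mu2]_(z in A) (avg (fun t => g (cis t * toC z)))%:E)%E.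
Proof.
move=> mA rA mg cg g0.
pose h (z : R * R) : \bar R := (((g \o toC) \_ A) z)%:E.
have mh : measurable_fun setT h.
  by apply/measurable_EFinP; exact/(measurable_restrictT _ mA).
have h0 z : (0 <= h z)%E.
  by rewrite lee_fin patchE; case: ifPn => // _; exact: g0.
have mI : measurable I by exact: measurable_itv.
pose c : R := 2 * pi.
have c0 : 0 < c by exact: twopi_gt0.
have ci0 : 0 <= c^-1 by rewrite invr_ge0 ltW.
pose k (y : R * (R * R)) : \bar R := (c^-1%:E * ((\1_I y.1)%:E * h (rotation y.1 y.2)))%E.
have mrot : measurable_fun setT (fun y : R * (R * R) => rotation y.1 y.2).
  have m1 : measurable_fun setT (fun y : R * (R * R) => cos y.1).
    by apply: (measurableT_comp _ measurable_fst); apply: continuous_measurable_fun; exact: continuous_cos.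
  have m2 : measurable_fun setT (fun y : R * (R * R) => sin y.1).
    by apply: (measurableT_comp _ measurable_fst); apply: continuous_measurable_fun; exact: continuous_sin.
  have m3 : measurable_fun setT (fun y : R * (R * R) => y.2.1).
    exact: (measurableT_comp measurable_fst measurable_snd).
  have m4 : measurable_fun setT (fun y : R * (R * R) => y.2.2).
    exact: (measurableT_comp measurable_snd measurable_snd).
  apply: measurable_fun_pair.
    by apply: measurable_funB; exact: measurable_funM.
  by apply: measurable_funD; exact: measurable_funM.
have mk1 : measurable_fun setT (fun y : R * (R * R) => (\1_I y.1)%:E * h (rotation y.1 y.2))%E.
  apply: emeasurable_funM.
    by apply/measurable_EFinP; exact: (measurableT_comp (measurable_indic mI) measurable_fst).
  exact: (measurableT_comp mh mrot).
have mk : measurable_fun setT k by apply: emeasurable_funM => //; exact: measurable_cst.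
have k10 y : (0 <= (\1_I y.1)%:E * h (rotation y.1 y.2))%E by rewrite mule_ge0// lee_fin indic_ge0.
have k0 y : (0 <= k y)%E by rewrite mule_ge0.
have swap : (\int[mu]_t \int[mu2]_z k (t, z) = \int[mu2]_z \int[mu]_t k (t, z))%E.
  have H := fubini_tonelli (m1 := mu) (m2 := plane_measure) k mk k0.
  exact: H.
have rotI t : (\int[mu2]_z h (rotation t z) = \int[mu2]_z h z)%E.
  have := @rotation_preserves_area R (cos t) (sin t) (cos2Dsin2 t) h mh h0.
  by case.
have mrott t : measurable_fun setT (fun z => h (rotation t z)).
  have := @rotation_preserves_area R (cos t) (sin t) (cos2Dsin2 t) h mh h0.
  by case.
have muI : (mu I = c%:E)%E by rewrite lebesgue_measure_itv/= lte_fin c0 sube0.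
have L : (\int[mu]_t \int[mu2]_z k (t, z) = \int[mu2]_z h z)%E.
  transitivity (\int[mu]_(t in I) (c^-1%:E * \int[mu2]_z h z))%E.
    rewrite [RHS]integral_mkcond; apply: eq_integral => t _; rewrite patchE /k /= indicE.
    case: ifPn => _; last by under eq_integral do rewrite mul0e mule0; rewrite integral0.
    under eq_integral do rewrite mul1e.
    rewrite -(rotI t).
    have H := @ge0_integralZl _ _ R mu2 setT measurableT (fun z => h (rotation t z)) (mrott t) (c^-1%:E).
    by apply: H => // z _; exact: h0.
  have H := @integral_cst _ _ R mu I mI (c^-1%:E * \int[mu2]_z h z)%E.
  apply: (etrans H); transitivity (c^-1%:E * (\int[mu2]_z h z) * c%:E)%E.
    by congr (_ * _)%E; exact: muI.
  by rewrite muleAC -EFinM mulVf ?mul1e// gt_eqF.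
have Rt : (\int[mu2]_z \int[mu]_t k (t, z) =
   \int[mu2]_(z in A) (avg (fun t => g (cis t * toC z)))%:E)%E.
  rewrite [RHS]integral_mkcond; apply: eq_integral => z _; rewrite patchE.
  have mkz : measurable_fun setT (fun t => (\1_I t)%:E * h (rotation t z))%E.
    exact: (measurableT_comp mk1 (pair2_measurable z)).
  rewrite /k /= ge0_integralZl//; last by move=> t _; exact: (k10 (t, z)).
  case: ifPn => zA.
    rewrite (avg_integral (cg z (set_mem zA))); congr (_ * _)%E.
    rewrite [RHS]integral_mkcond; apply: eq_integral => t _; rewrite patchE indicE.
    case: ifPn => _; last by rewrite mul0e.
    rewrite mul1e /h patchE ifT; last by apply/mem_set/rA/set_mem.
    by rewrite /= toC_rotation.
  rewrite (_ : (\int[mu]_t _) = 0)%E ?mule0//.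
  under eq_integral => t _.
    rewrite /h patchE ifF; last by apply/negbTE; apply: contra zA => /set_mem/rA/mem_set.
    rewrite mule0.
    over.
  by rewrite integral0.
by rewrite -Rt -swap L [LHS]integral_mkcond; apply: eq_integral => z _; rewrite /h !patchE; case: ifP.
Qed.

End circular_integrals.

(** * Area of discs and annuli *)

Section disk_area.
Context {R : realType}.
Local Notation mu := (@lebesgue_measure R).
Local Notation mu2 := ((mu \x mu)%E).
Local Notation C := (R[i]^o).

Definition disk (r : R) : set (R * R) := [set z | modulus (toC z) < r].

Lemma continuous_toC : continuous (toC : R * R -> C).
Proof.
move=> z; exact: (@continuous_complex _ _ fst snd z (@continuous_fst _ _ z) (@continuous_snd _ _ z)).
Qed.

Lemma continuous_modulus_toC : continuous (fun z : R * R => modulus (toC z)).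
Proof.
move=> z; apply: (@continuous_comp _ _ _ (toC : _ -> C) (modulus : C -> R)).
  exact: continuous_toC.
exact: continuous_modulus.
Qed.

Lemma open_disk r : open (disk r).
Proof.
apply: (@open_comp _ _ (fun z : R * R => modulus (toC z)) [set x | x < r]); last exact: open_lt.
by move=> z _; exact: continuous_modulus_toC.
Qed.

Lemma measurable_disk r : measurable (disk r).
Proof. by apply: open_measurable_plane; exact: open_disk. Qed.

Lemma disk_rotation r t z : disk r (rotation t z) <-> disk r z.
Proof. by rewrite /disk !mksetE toC_rotation normcM modulus_cis mul1r. Qed.

Lemma mu2_rectangle (a b c d : R) : a <= b -> c <= d ->
  mu2 (`[a, b]%classic `*` `[c, d]%classic) = ((b - a) * (d - c))%:E.
Proof.
move=> ab cd; rewrite product_measure1E//; try exact: measurable_itv.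
have L (x y : R) : x <= y -> (mu `[x, y]%classic = (y - x)%:E)%E.
  rewrite lebesgue_measure_itv/= lte_fin le_eqVlt => /predU1P[->|->]; last by rewrite EFinB.
  by rewrite ltxx subrr.
by rewrite EFinM; congr (_ * _)%E; exact: L.
Qed.

Lemma disk1_lty : (mu2 (disk 1) < +oo)%E.
Proof.
apply: (@le_lt_trans _ _ (mu2 (`[(-1 : R), 1]%classic `*` `[(-1 : R), 1]%classic))).
  apply: le_measure; rewrite ?inE.
  - exact: measurable_disk.
  - by apply: measurableX; exact: measurable_itv.
  move=> z z1; split; rewrite /= in_itv/= -ler_norml.
    by apply: le_trans (ltW z1); exact: Re_le_modulus (toC z).
  by apply: le_trans (ltW z1); exact: Im_le_modulus (toC z).
by rewrite mu2_rectangle ?ltry//; lra.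
Qed.

Lemma disk1_gt0 : (0 < mu2 (disk 1))%E.
Proof.
apply: (@lt_le_trans _ _ (mu2 (`[(0 : R), 2^-1]%classic `*` `[(0 : R), 2^-1]%classic))).
  by rewrite mu2_rectangle ?subr0 ?lte_fin ?mulr_gt0 ?invr_gt0 ?invr_ge0//.
apply: le_measure; rewrite ?inE.
- by apply: measurableX; exact: measurable_itv.
- exact: measurable_disk.
move=> [x y] [/=]; rewrite !in_itv/= => /andP[x0 x1] /andP[y0 y1].
rewrite /disk mksetE modulusE -[ltRHS]sqrtr1 ltr_sqrt// /toC /=.
by nra.
Qed.

(** An abstract positive constant: the estimates hold up to constant factors, and all other areas
    reduce to this one by dilation. *)
Definition unit_area : R := fine (mu2 (disk 1)).

Lemma unit_area_gt0 : 0 < unit_area.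
Proof. by rewrite fine_gt0// disk1_gt0 disk1_lty. Qed.

Lemma mu2_disk r : 0 <= r -> mu2 (disk r) = (r ^+ 2 * unit_area)%:E.
Proof.
rewrite le_eqVlt => /predU1P[<-|r0].
  rewrite expr0n/= mul0r (_ : disk 0 = set0) ?measure0//.
  by apply/seteqP; split => // z; rewrite /disk mksetE ltNge modulus_ge0.
rewrite EFinM fineK ?ge0_fin_numE ?disk1_lty//.
have ri0 : 0 < r^-1 by rewrite invr_gt0.
have m1 : measurable_fun setT (fun z => (\1_(disk 1) z)%:E : \bar R).
  by apply/measurable_EFinP; exact: (measurable_indic (measurable_disk 1)).
have I0 z : (0 <= (\1_(disk 1) z)%:E :> \bar R)%E by rewrite lee_fin indicE ler0n.
have := @integral_dilation R _ _ ri0 m1 I0.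
rewrite exprVn invrK => H.
transitivity (\int[mu2]_z (\1_(disk r) z)%:E)%E.
  by rewrite (integral_indic mu2 measurableT (measurable_disk r)) setIT.
transitivity (\int[mu2]_z (\1_(disk 1) (r^-1 * z.1, r^-1 * z.2))%:E)%E.
  apply: eq_integral => z _; rewrite !indicE.
  have E : toC (r^-1 * z.1, r^-1 * z.2) = r^-1%:C * toC z.
    by apply: complex_ext; rewrite !complexE2 /=; ring.
  have D : disk 1 (r^-1 * z.1, r^-1 * z.2) <-> disk r z.
    by rewrite /disk !mksetE E normcM modulus_real ger0_norm ?ltW// mulrC ltr_pdivrMr// mul1r.
  have -> // : (z \in disk r) = ((r^-1 * z.1, r^-1 * z.2) \in disk 1).
  by apply/idP/idP; rewrite !in_setE => /D.
rewrite H; congr (_ * _)%E.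
by rewrite (integral_indic mu2 measurableT (measurable_disk 1)) setIT.
Qed.

Lemma mu2_annulus r s : 0 <= r -> r <= s ->
  mu2 (disk s `\` disk r) = ((s ^+ 2 - r ^+ 2) * unit_area)%:E.
Proof.
move=> r0 rs; have s0 : 0 <= s by exact: le_trans rs.
have sfin : (mu2 (disk s) < +oo)%E by rewrite mu2_disk// ltry.
have H := @measureD _ _ R mu2 _ _ (measurable_disk s) (measurable_disk r) sfin.
apply: (etrans H); transitivity (mu2 (disk s) - mu2 (disk r))%E.
  congr (_ - mu2 _)%E; apply: setIidr => z zr; exact: lt_le_trans rs.
by rewrite !mu2_disk// -EFinB mulrBl.
Qed.

End disk_area.

(** * The Littlewood-Paley inequality *)

Section littlewood_paley.
Context {R : realType}.
Local Notation mu := (@lebesgue_measure R).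
Local Notation mu2 := ((mu \x mu)%E).
Local Notation C := (R[i]^o).
Variable p : R.
Hypothesis p2 : 2 <= p.

(** The exponent is a parameter because the lacunary polynomials are estimated through exponent 2 as
    well as [p]. *)
Definition bergman_density (q : R) (G : R[i] -> R[i]) (z : R[i]) : R :=
  (1 - modulus z ^+ 2) `^ (q - 1) * modulus (G z) `^ q.

Lemma bergman_density_ge0 q G z : 0 <= bergman_density q G z.
Proof. by rewrite mulr_ge0// powR_ge0. Qed.

Let p0 : 0 < p. Proof. by apply: lt_le_trans p2. Qed.

Lemma bergman_density_cis q G t z :
  bergman_density q G (cis t * z) = (1 - modulus z ^+ 2) `^ (q - 1) * modulus (G (cis t * z)) `^ q.
Proof. by rewrite /bergman_density normcM modulus_cis mul1r. Qed.

(** Here [x] is a radius in the annulus of parameter [h], [c] the mean of the derivative at [x], and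
    [a], [b], [d] are the values of M at 1 - h/4, [x] and 1 - h. The weight is at most (2h)^(p-1)
    and the gap to 1 - h/4 is at least h/4; the constant is the quotient of (2h)^(p-1) by 2
    (h/8)^p. *)
Lemma density_arith (h x c a b d : R) : 0 < h -> h <= 1 -> 1 - h <= x -> x < 1 - h / 2 ->
  0 <= c -> 2 * ((1 - h / 4 - x) / 2) `^ p * c <= a - b -> d <= b ->
  (1 - x ^+ 2) `^ (p - 1) * c <= 16 `^ p / (4 * h) * (a - d).
Proof.
move=> h0 h1 hx xh c0 T db; have x0 : 0 <= x by lra.
have T1 : 2 * (h / 8) `^ p * c <= a - d.
  apply: (@le_trans _ _ (2 * ((1 - h / 4 - x) / 2) `^ p * c)); last by lra.
  rewrite ler_wpM2r// ler_wpM2l// ge0_ler_powR ?nnegrE ?(ltW p0)//; lra.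
have W1 : (1 - x ^+ 2) `^ (p - 1) <= (2 * h) `^ (p - 1).
  by rewrite ge0_ler_powR ?nnegrE//; move: p2; nra.
have E : 16 `^ p / (4 * h) * (2 * (h / 8) `^ p) = (2 * h) `^ (p - 1).
  have -> : (2 * h) `^ (p - 1) = (2 * h) `^ p / (2 * h).
    rewrite powRB ?powRr1//; lra.
  have -> : (2 * h) `^ p = 16 `^ p * (h / 8) `^ p.
    rewrite -powRM//; last by lra.
    by congr (_ `^ _); field.
  field; lra.
apply: (@le_trans _ _ (16 `^ p / (4 * h) * (2 * (h / 8) `^ p * c))).
  by rewrite mulrA E ler_wpM2r.
by rewrite ler_wpM2l// divr_ge0 ?powR_ge0//; lra.
Qed.

Section continuous_case.
Variable G : R[i] -> R[i].
Hypothesis cG : forall z, modulus z < 1 -> {for z, continuous (G : C -> C)}.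

Lemma measurable_density_weight :
  measurable_fun (disk 1) (fun z => (1 - modulus (toC z) ^+ 2) `^ (p - 1)).
Proof.
have mm : measurable_fun setT (fun z : R * R => modulus (toC z)).
  apply: open_continuous_measurable_plane; first exact: openT.
  by move=> z _; exact: continuous_modulus_toC.
apply: (@measurable_funS _ _ _ _ setT) => //.
apply: (measurableT_comp (f := fun x : R => x `^ (p - 1))); first exact: measurable_powR.
by apply: measurable_funB => //; apply: measurable_funX; exact: mm.
Qed.

Lemma measurable_circ : measurable_fun (disk 1) (fun z => circ G p (modulus (toC z))%:C).
Proof.
apply: open_continuous_measurable_plane; first exact: open_disk.
move=> z z1.
apply: (@continuous_comp _ _ _ (fun z : R * R => modulus (toC z)) (fun r : R => circ G p r%:C)).
  exact: continuous_modulus_toC.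
apply: (circ_continuous p2 cG); apply/andP; split; last exact: z1.
by apply: lt_le_trans (modulus_ge0 _); rewrite ltrN10.
Qed.

Lemma measurable_circ_density : measurable_fun (disk 1)
  (fun z => (1 - modulus (toC z) ^+ 2) `^ (p - 1) * circ G p (modulus (toC z))%:C).
Proof.
by apply: measurable_funM; [exact: measurable_density_weight|exact: measurable_circ].
Qed.

Lemma measurable_modulus_powR : measurable_fun (disk 1) (fun z => modulus (G (toC z)) `^ p).
Proof.
apply: open_continuous_measurable_plane; first exact: open_disk.
move=> z z1; apply: (@continuous_powR_comp _ _ p2 _ G toC); first exact: continuous_toC.
exact: cG.
Qed.

Lemma measurable_bergman_density :
  measurable_fun (disk 1) (fun z => bergman_density p G (toC z)).
Proof.
by apply: measurable_funM; [exact: measurable_density_weight|exact: measurable_modulus_powR].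
Qed.

Lemma measurable_bergman_density_sub (A : set (R * R)) : measurable A -> A `<=` disk 1 ->
  measurable_fun A (fun z => bergman_density p G (toC z)).
Proof. by move=> mA AD; apply: (measurable_funS (measurable_disk 1) AD); exact: measurable_bergman_density. Qed.

Lemma integral_bergman_density_circular (A : set (R * R)) : measurable A -> A `<=` disk 1 ->
  (forall t z, A (rotation t z) <-> A z) ->
  (\int[mu2]_(z in A) (bergman_density p G (toC z))%:E =
   \int[mu2]_(z in A) ((1 - modulus (toC z) ^+ 2) `^ (p - 1) * circ G p (modulus (toC z))%:C)%:E)%E.
Proof.
move=> mA AD rA.
have cW z : A z -> continuous (fun t => modulus (G (cis t * toC z)) `^ p).
  by move=> /AD z1; exact: (continuous_on_circle p2 cG z1).
transitivity (\int[mu2]_(z in A) (avg (fun t => bergman_density p G (cis t * toC z)))%:E)%E.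
  apply: (@integral_circular _ A (bergman_density p G)) => //.
  - by apply: measurable_bergman_density_sub.
  - move=> z Az; under eq_fun do rewrite bergman_density_cis.
    by move=> t; apply: cvgM; [exact: cvg_cst|exact: cW].
  - by move=> z; exact: bergman_density_ge0.
apply: eq_integral => z; rewrite inE => Az; congr (_%:E).
have -> : (fun t => bergman_density p G (cis t * toC z)) =
  (fun t => (1 - modulus (toC z) ^+ 2) `^ (p - 1) * modulus (G (cis t * toC z)) `^ p).
  by apply/funext => t; exact: bergman_density_cis.
apply: (etrans (avgZ _ (cW z Az))); apply: congr1.
exact: (circ_modulus p2 cG (AD _ Az)).
Qed.

End continuous_case.

Variables (F dF : R[i] -> R[i]).
Hypothesis HF : forall z, modulus z < 1 -> cdiff F z (dF z).

Let M (x : R) := circ F p x%:C.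
Let M_ge0 x : 0 <= M x. Proof. exact: circ_ge0. Qed.

(** The comparison radius 1 - h/4 lies beyond the outer rim 1 - h/2, which keeps its distance to [x]
    comparable with [h] over the whole annulus. *)
Lemma density_circle_bound (h x : R) : 0 < h -> h <= 1 -> 1 - h <= x -> x < 1 - h / 2 ->
  (1 - x ^+ 2) `^ (p - 1) * circ dF p x%:C <=
  16 `^ p / (4 * h) * (M (1 - h / 4) - M (1 - h)).
Proof.
move=> h0 h1 hx xh; have x0 : 0 <= x by lra.
have c0 : 0 <= circ dF p x%:C by exact: circ_ge0.
have xs : x < 1 - h / 4 by lra.
have s1 : 1 - h / 4 < 1 by lra.
have hx0 : 0 <= 1 - h by lra.
have T : 2 * ((1 - h / 4 - x) / 2) `^ p * circ dF p x%:C <= M (1 - h / 4) - M x.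
  exact: (circ_telescope p2 HF x0 xs s1).
have m : M (1 - h) <= M x := circ_mono p2 HF hx0 hx (lt_trans xs s1).
exact: density_arith h0 h1 hx xh c0 T m.
Qed.

Let r (n : nat) : R := 1 - 2^-1 ^+ n.

(** The area of the annulus is [unit_area] times h (1 - 3h/4), which absorbs the factor 1/h of
    [density_circle_bound]. The radius 1 - h/4 is [r n.+2], whence the jump of two indices. *)
Lemma annulus_bound n :
  (\int[mu2]_(z in disk (r n.+1) `\` disk (r n)) (bergman_density p dF (toC z))%:E <=
   (unit_area * 16 `^ p / 4 * (M (r n.+2) - M (r n)))%:E)%E.
Proof.
pose h : R := 2^-1 ^+ n.
have h0 : 0 < h by rewrite exprn_gt0// invr_gt0.
have h1 : h <= 1 by rewrite exprn_ile1// ?invr_ge0// invf_le1//; lra.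
have r1 : r n.+1 = 1 - h / 2 by rewrite /r exprSr.
have r2 : r n.+2 = 1 - h / 4 by rewrite /r !exprSr -/h; field.
have r0 : r n = 1 - h by [].
rewrite r1 r2 r0.
have mA : measurable (disk (1 - h / 2) `\` disk (1 - h)).
  by apply: measurableD; exact: measurable_disk.
have AD : disk (1 - h / 2) `\` disk (1 - h) `<=` disk 1.
  by move=> z [zs _]; apply: lt_trans zs _; lra.
have cdF z (z1 : modulus z < 1) : {for z, continuous (dF : C -> C)} := continuous_derivative HF z1.
rewrite (integral_bergman_density_circular cdF mA AD); last first.
  by move=> t z; rewrite /setD /= /setD; rewrite !disk_rotation.
set B := M _ - M _.
pose c : R := 16 `^ p / (4 * h) * B.
have mc : measurable_fun (disk (1 - h / 2) `\` disk (1 - h))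
    (fun z => (1 - modulus (toC z) ^+ 2) `^ (p - 1) * circ dF p (modulus (toC z))%:C).
  by apply: (measurable_funS (measurable_disk 1) AD); exact: measurable_circ_density.
apply: (@le_trans _ _ (\int[mu2]_(z in disk (1 - h / 2) `\` disk (1 - h)) (cst c%:E) z)%E).
  apply: ge0_le_integral => //.
  - by move=> z _; rewrite lee_fin mulr_ge0 ?powR_ge0// circ_ge0.
  - by apply/measurable_EFinP; exact: mc.
  - move=> z [z1 /negP z2]; rewrite lee_fin; apply: density_circle_bound => //.
    by move: z2; rewrite -leNgt.
have H := @integral_cst _ _ R mu2 _ mA c%:E.
apply: (@le_trans _ _ (c%:E * mu2 (disk (1 - h / 2) `\` disk (1 - h)))%E).
  by rewrite -H.
rewrite mu2_annulus; [|lra|lra].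
rewrite -EFinM lee_fin /c.
have B0 : 0 <= B.
  have T : M (1 - h) <= M (1 - h / 4) by apply: (circ_mono p2 HF); lra.
  by rewrite subr_ge0.
have q0 : 0 <= 16 `^ p :> R by exact: powR_ge0.
have u0 := @unit_area_gt0 R.
have -> : 16 `^ p / (4 * h) * B * (((1 - h / 2) ^+ 2 - (1 - h) ^+ 2) * unit_area) =
  unit_area * 16 `^ p / 4 * B * (1 - 3 / 4 * h).
  by field; rewrite gt_eqF.
rewrite ler_piMr//; last by lra.
by rewrite !mulr_ge0// ?invr_ge0// ltW.
Qed.

Let r_lt1 n : r n < 1.
Proof. by rewrite /r ltrBlDr ltrDl exprn_gt0// invr_gt0. Qed.

Let r_ge0 n : 0 <= r n.
Proof. by rewrite /r subr_ge0 exprn_ile1 ?invr_ge0// invf_le1// ler1n. Qed.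

Let r_mono n m : (n <= m)%N -> r n <= r m.
Proof. by move=> nm; rewrite /r lerB// ler_wiXn2l ?invr_ge0// invf_le1// ler1n. Qed.

Let disk_sub n : disk (r n) `<=` disk 1.
Proof. by move=> z zr; apply: lt_trans zr (r_lt1 n). Qed.

Let cdF z (z1 : modulus z < 1) : {for z, continuous (dF : C -> C)} := continuous_derivative HF z1.

(** The increments [M (r n.+2) - M (r n)] telescope by two steps, so two consecutive values of [M]
    remain. *)
Lemma disk_integral_bound n :
  (\int[mu2]_(z in disk (r n)) (bergman_density p dF (toC z))%:E <=
   (unit_area * 16 `^ p / 4 * (M (r n.+1) + M (r n)))%:E)%E.
Proof.
have u0 := @unit_area_gt0 R.
have q0 : 0 <= 16 `^ p :> R by exact: powR_ge0.
elim: n => [|n IH].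
  have -> : disk (r 0) = set0.
    by apply/seteqP; split => // z; rewrite /disk mksetE ltNge /r expr0 subrr modulus_ge0.
  rewrite integral_set0 lee_fin; apply: mulr_ge0; last by apply: addr_ge0.
  by rewrite !mulr_ge0// ?invr_ge0// ltW.
have E : disk (r n.+1) = disk (r n) `|` (disk (r n.+1) `\` disk (r n)).
  by rewrite setDUK// => z zr; apply: lt_le_trans zr (r_mono (leqnSn n)).
rewrite {1}E.
have mD := measurable_disk (r n); have mD' := measurable_disk (r n.+1).
have H := @ge0_integral_setU _ _ R mu2 _ _ mD (measurableD mD' mD)
  (fun z => (bergman_density p dF (toC z))%:E).
apply: (@le_trans _ _ (_ + _)%E).
  rewrite H; first exact: le_refl.
  - rewrite -E; apply/measurable_EFinP.
    by apply: measurable_bergman_density_sub => //; exact: disk_sub.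
  - by move=> z _; rewrite lee_fin bergman_density_ge0.
  - by rewrite disj_set2E setDIK.
apply: (le_trans (leeD IH (annulus_bound n))).
rewrite -EFinD lee_fin -mulrDr le_eqVlt; apply/orP; left; apply/eqP.
by move: (M _) (M _) (M _) => x y z; ring.
Qed.

Lemma littlewood_paley (L : R) : (forall x, 0 <= x -> x < 1 -> circ F p x%:C <= L) ->
  (\int[mu2]_(z in disk 1) (bergman_density p dF (toC z))%:E <=
   (unit_area * 16 `^ p / 2 * L)%:E)%E.
Proof.
move=> HL.
have u0 := @unit_area_gt0 R.
have q0 : 0 <= 16 `^ p :> R by exact: powR_ge0.
have E : disk 1 = \bigcup_n disk (r n).
  apply/seteqP; split => [z z1|z [n _]]; last exact: disk_sub.
  have d0 : 0 < 1 - modulus (toC z) by rewrite subr_gt0.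
  have [n Hn] := @exists_half_lt R 1 _ d0; exists n => //.
  by move: Hn; rewrite /disk mksetE /r div1r -exprVn ltrBrDl addrC -ltrBrDl.
have H : ((\int[mu2]_(z in disk (r n)) (bergman_density p dF (toC z))%:E) @[n --> \oo] -->
    \int[mu2]_(z in \bigcup_n disk (r n)) (bergman_density p dF (toC z))%:E)%E.
  apply: ge0_nondecreasing_set_cvg_integral.
  - move=> n m nm; apply/subsetPset => z zr; exact: lt_le_trans zr (r_mono nm).
  - by move=> n; exact: measurable_disk.
  - move=> n; apply/measurable_EFinP.
    exact: (measurable_bergman_density_sub cdF (measurable_disk (r n)) (@disk_sub n)).
  - by move=> n z _; rewrite lee_fin bergman_density_ge0.
rewrite E -(cvg_lim (@ereal_hausdorff R) H); apply: lime_le; first exact: cvgP H.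
near=> n; apply: (le_trans (disk_integral_bound n)); rewrite lee_fin.
have -> : unit_area * 16 `^ p / 2 * L = unit_area * 16 `^ p / 4 * (L + L).
  by move: (16 `^ p) => x; field.
apply: ler_wpM2l; first by rewrite !mulr_ge0// ?invr_ge0// ltW.
by apply: lerD; apply: HL.
Unshelve. all: by end_near.
Qed.

End littlewood_paley.

(** * Hardy and Dirichlet spaces *)

Section disc_functions.
Context {R : realType}.
Local Notation mu := (@lebesgue_measure R).
Local Notation mu2 := ((mu \x mu)%E).
Local Notation C := (R[i]^o).
Implicit Types (f g h : disc R -> R[i]) (F dF : R[i] -> R[i]) (z : R[i]).

Lemma normc_lt1 z : (`|z| < 1) = (modulus z < 1).
Proof. by rewrite normcE_modulus ltcR. Qed.

Lemma disc_modulus (z : disc R) : modulus (val z) < 1.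
Proof. by rewrite -normc_lt1; case: z. Qed.

Lemma disc_exists z : modulus z < 1 -> exists w : disc R, val w = z.
Proof. by rewrite -normc_lt1 => z1; exists (exist _ z z1). Qed.

Lemma extend0_val f (z : disc R) : extend0 f (val z) = f z.
Proof. by rewrite /extend0 valK. Qed.

Lemma extend0B f g z : extend0 (f \- g) z = extend0 f z - extend0 g z.
Proof. by rewrite /extend0; case: insubP => /= [w _ _|_]; rewrite ?subr0. Qed.

Lemma cdiff_extend0 f z d : modulus z < 1 -> cdiff (extend0 f) z d -> extend0 (disc_derive f) z = d.
Proof.
move=> /disc_exists[w <-] /cdiffP H; rewrite extend0_val /disc_derive derive1E.
by case: H.
Qed.

Lemma analyticP f : analytic f <->
  forall z, modulus z < 1 -> cdiff (extend0 f) z (extend0 (disc_derive f) z).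
Proof.
split=> [af z /disc_exists[w <-]|af w].
  apply/cdiffP; rewrite extend0_val /disc_derive derive1E.
  exact: (@derivableP _ _ _ (extend0 f : C -> C) (val w : C) (1 : C) (af w)).
by have /cdiffP[] := af (val w) (disc_modulus w).
Qed.

Lemma analytic_disc_derive f : analytic f -> analytic (disc_derive f).
Proof.
move=> /analyticP af; apply/analyticP => z z1.
have s0 : 0 < 1 - modulus z by rewrite subr_gt0.
have [|d Hd] := @cdiff_derivative _ (extend0 f) (extend0 (disc_derive f)) z (1 - modulus z) s0.
  move=> w wz; apply: af; rewrite -[w](subrK z) (le_lt_trans (le_normcD _ _))//.
  by rewrite -ltrBrDr.
by rewrite (cdiff_extend0 z1 Hd).
Qed.

Lemma continuous_extend0 f z : analytic f -> modulus z < 1 -> {for z, continuous (extend0 f : C -> C)}.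
Proof. by move=> /analyticP af z1; exact: cdiff_continuous (af z z1). Qed.

Section restriction.
Variables (F dF : R[i] -> R[i]).
Hypothesis HF : forall z, modulus z < 1 -> cdiff F z (dF z).
Variable f : disc R -> R[i].
Hypothesis fE : forall w, f w = F (val w).

Lemma extend0_restriction z : modulus z < 1 -> extend0 f z = F z.
Proof. by move=> /disc_exists[w <-]; rewrite extend0_val. Qed.

Lemma cdiff_restriction z : modulus z < 1 -> cdiff (extend0 f) z (dF z).
Proof.
move=> z1; apply: cdiff_eq (HF z1); exists (1 - modulus z); first by rewrite subr_gt0.
move=> w wz; rewrite extend0_restriction// -[w](subrK z) (le_lt_trans (le_normcD _ _))//.
by rewrite -ltrBrDr.
Qed.

Lemma disc_derive_restriction z : modulus z < 1 -> extend0 (disc_derive f) z = dF z.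
Proof. by move=> z1; exact: cdiff_extend0 (cdiff_restriction z1). Qed.

Lemma analytic_restriction : analytic f.
Proof. by apply/analyticP => z z1; rewrite disc_derive_restriction//; exact: cdiff_restriction. Qed.

End restriction.

Section exponent.
Variable p : R.
Hypothesis p2 : 2 <= p.

Let p0 : 0 < p. Proof. by apply: lt_le_trans p2. Qed.

Lemma powR_rootK (x : R) : 0 <= x -> (x `^ p^-1) `^ p = x.
Proof. by move=> x0; rewrite -powRrM mulVf ?powRr1// gt_eqF. Qed.

Lemma powR_root_le (x l : R) : 0 <= x -> x `^ p^-1 <= l -> x <= l `^ p.
Proof.
move=> x0 xl; rewrite -[leLHS]powR_rootK// ge0_ler_powR ?nnegrE ?powR_ge0 ?(ltW p0)//.
exact: le_trans (powR_ge0 _ _) xl.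
Qed.

Lemma root_le (x y : R) : 0 <= x -> x <= y -> x `^ p^-1 <= y `^ p^-1.
Proof.
by move=> x0 xy; rewrite ge0_ler_powR ?nnegrE ?invr_ge0 ?(ltW p0)// (le_trans x0).
Qed.

Lemma circle_mean_circ f r : analytic f -> 0 <= r -> r < 1 ->
  circle_mean p f r = ((circ (extend0 f) p r%:C) `^ p^-1)%:E.
Proof.
move=> af r0 r1; have r1' : modulus r%:C < 1 by rewrite modulus_real ger0_norm.
have cf z : modulus z < 1 -> {for z, continuous (extend0 f : C -> C)}.
  exact: continuous_extend0.
have cg := continuous_on_circle p2 cf r1'.
have zE t : (r * cos t) +i* (r * sin t) = cis t * r%:C.
  by apply: complex_ext; rewrite !complexE2 /=; ring.
rewrite /circle_mean; under eq_integral do rewrite zE.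
by rewrite -poweR_EFin; apply: (congr1 (fun x => poweR x p^-1)); exact: esym (avg_integral cg).
Qed.

(** Since the means increase with the radius ([circ_mono]), they have a finite limit at 1 exactly
    when they are bounded. *)
Lemma hardyP f : hardy p f <->
  analytic f /\ exists L, forall r, 0 <= r -> r < 1 -> circ (extend0 f) p r%:C <= L.
Proof.
split=> [[af [l Hl]]|[af [L HL]]]; split=> //.
- have mono r s : 0 <= r -> r <= s -> s < 1 -> circ (extend0 f) p r%:C <= circ (extend0 f) p s%:C.
    by apply: (circ_mono p2); exact/analyticP.
  exists (l `^ p) => r r0 r1.
  have H : ((circ (extend0 f) p r%:C `^ p^-1)%:E <= l%:E)%E.
    apply: (cvge_to_ge Hl); near=> s.
    have rs : r <= s by near: s; apply: nbhs_left_ge.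
    have s1 : s < 1 by near: s; exact: nbhs_left_lt.
    have s0 : 0 <= s by exact: le_trans rs.
    have E := circle_mean_circ af s0 s1.
    by rewrite E lee_fin; apply: root_le; [exact: circ_ge0|exact: mono].
  by rewrite lee_fin in H; exact: (powR_root_le (circ_ge0 _ _ _) H).
- pose m r := circ (extend0 f) p r%:C `^ p^-1.
  have mono r s : 0 <= r -> r <= s -> s < 1 -> circ (extend0 f) p r%:C <= circ (extend0 f) p s%:C.
    by apply: (circ_mono p2); exact/analyticP.
  have cm : cvg (m x @[x --> (1 : R)^'-]).
    apply: nondecreasing_at_left_is_cvgr.
      near=> x => a b; rewrite !in_itv/= => /andP[xa a1] /andP[xb b1] ab.
      apply: root_le; first exact: circ_ge0.
      apply: mono => //.
      by apply: le_trans (ltW xa); near: x; exact: nbhs_left_ge.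
    have ub (x : R) : 0 <= x -> has_ubound [set m y | y in `]x, (1 : R)[].
      move=> x0; exists (L `^ p^-1) => u [y /=]; rewrite in_itv/= => /andP[xy y1] <-.
      have y0 : 0 <= y by exact: le_trans x0 (ltW xy).
      by apply: root_le; [exact: circ_ge0|exact: HL].
    by near=> x; apply: ub; near: x; exact: nbhs_left_ge.
  exists (lim (m x @[x --> (1 : R)^'-])).
  have cE : (m x)%:E @[x --> (1 : R)^'-] --> (lim (m x @[x --> (1 : R)^'-]))%:E.
    by apply/fine_cvgP; split; [exact: nearW|exact: cm].
  apply: cvg_trans cE.
  apply: near_eq_cvg; near=> x.
  have x0 : 0 <= x by near: x; exact: nbhs_left_ge.
  have x1 : x < 1 by near: x; exact: nbhs_left_lt.
  exact: esym (circle_mean_circ af x0 x1).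
Unshelve. all: by end_near.
Qed.

(** The p-th power of the Bergman norm of the derivative, without the factor p/pi: it can be added
    and scaled without p-th roots. *)
Definition derivative_mass f : \bar R :=
  (\int[mu2]_(z in disk 1) (bergman_density p (extend0 (disc_derive f)) (toC z))%:E)%E.

Lemma derivative_mass_ge0 f : (0 <= derivative_mass f)%E.
Proof. by apply: integral_ge0 => z _; rewrite lee_fin bergman_density_ge0. Qed.

Lemma bergman_normE f : bergman_norm p (p - 1) (disc_derive f) =
  poweR ((p / pi)%:E * derivative_mass f)%E p^-1.
Proof.
by rewrite /bergman_norm /area_integral subrK muleA -EFinM.
Qed.

Let ppi_gt0 : 0 < p / pi.
Proof. by rewrite divr_gt0// pi_gt0. Qed.

Lemma bergman_norm_lty f :
  (bergman_norm p (p - 1) (disc_derive f) < +oo <-> derivative_mass f < +oo)%E.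
Proof.
rewrite bergman_normE; split=> H.
  have {}H := lty_poweRy (invr_neq0 (lt0r_neq0 p0)) H.
  rewrite ltey; apply/eqP => E; move: H.
  by rewrite E gt0_muley// lte_fin.
by apply: poweR_lty; rewrite lte_mul_pinfty// lee_fin ltW.
Qed.

Lemma dirichletP f : dirichlet p (p - 1) f <-> analytic f /\ (derivative_mass f < +oo)%E.
Proof.
split=> [[af [_ m]]|[af m]].
  by split; [exact: af|apply/bergman_norm_lty; exact: m].
move/bergman_norm_lty : m => m; exact: (conj af (conj (analytic_disc_derive af) m)).
Qed.

Lemma ge0_lty_EFin (x : \bar R) : (0 <= x)%E -> (x < +oo)%E -> exists2 r : R, 0 <= r & x = r%:E.
Proof. by case: x => [r r0 _||] //; exists r. Qed.

Lemma dirichlet_norm_le f (m : R) : extend0 f 0 = 0 -> (derivative_mass f <= m%:E)%E ->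
  (dirichlet_norm p (p - 1) f <= ((p / pi * m) `^ p^-1)%:E)%E.
Proof.
move=> f0; rewrite /dirichlet_norm bergman_normE f0 modulus0 add0e.
move: (derivative_mass_ge0 f); move: (derivative_mass f) => d d0 dm.
have [r r0 E] := ge0_lty_EFin d0 (le_lt_trans dm (ltry m)).
move: dm; rewrite E lee_fin -EFinM poweR_EFin lee_fin => rm.
apply: root_le; first by apply: mulr_ge0 r0; exact: ltW.
by rewrite ler_pM2l.
Qed.

Lemma le_dirichlet_norm f (e : R) : (dirichlet_norm p (p - 1) f < e%:E)%E ->
  modulus (extend0 f 0) <= e /\ (derivative_mass f <= (pi / p * e `^ p)%:E)%E.
Proof.
rewrite /dirichlet_norm => H.
have b0 : (0 <= bergman_norm p (p - 1) (disc_derive f))%E.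
  by rewrite bergman_normE poweR_ge0.
have bH : (bergman_norm p (p - 1) (disc_derive f) < e%:E)%E.
  by apply: le_lt_trans H; rewrite leeDr// lee_fin.
split; first by rewrite -lee_fin (le_trans _ (ltW H))// leeDl.
have fin : (derivative_mass f < +oo)%E by apply/bergman_norm_lty/(lt_trans bH)/ltry.
move: bH fin; rewrite bergman_normE.
move: (derivative_mass_ge0 f); move: (derivative_mass f) => d d0 bH fin.
have [r r0 E] := ge0_lty_EFin d0 fin.
move: bH; rewrite E -EFinM poweR_EFin lte_fin lee_fin => /ltW bH.
have := powR_root_le (mulr_ge0 (ltW ppi_gt0) r0) bH.
by rewrite -ler_pdivlMl// invf_div.
Qed.

Lemma hardy_dirichlet f : hardy p f -> dirichlet p (p - 1) f.
Proof.
move=> /hardyP[af [L HL]]; apply/dirichletP; split => //.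
apply: le_lt_trans (littlewood_paley p2 _ HL) _; last exact: ltry.
exact/analyticP.
Qed.

End exponent.
End disc_functions.

(** * Pointwise bounds from weighted area integrals *)

Section growth.
Context {R : realType}.
Local Notation mu := (@lebesgue_measure R).
Local Notation mu2 := ((mu \x mu)%E).
Local Notation C := (R[i]^o).
Implicit Types (F dF G dG : R[i] -> R[i]) (w : R[i]).

Lemma cdiff_affine G z w k d : k != 0 -> cdiff G (w + k * z) d ->
  cdiff (fun u => G (w + k * u)) z (d * k).
Proof.
move=> k0 dG e e0; have mk : 0 < modulus k by rewrite modulus_gt0.
have [r r0 H] := dG (e / modulus k) (divr_gt0 e0 mk).
exists (r / modulus k); first exact: divr_gt0.
move=> h; rewrite ltr_pdivlMr// => hr.
have khr : modulus (k * h) < r by rewrite normcM mulrC.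
have := H (k * h) khr.
have -> : w + k * (z + h) = w + k * z + k * h by rewrite mulrDr addrA.
have -> : e / modulus k * modulus (k * h) = e * modulus h.
  by rewrite normcM mulrA divfK// gt_eqF.
by rewrite mulrA.
Qed.

Variable p : R.
Hypothesis p2 : 2 <= p.
Let p0 : 0 < p. Proof. by apply: lt_le_trans p2. Qed.

Lemma circ_at0 F : circ F p 0%:C = modulus (F 0) `^ p.
Proof.
transitivity (avg (fun=> modulus (F 0) `^ p) : R); last exact: avg_cst.
by apply: eq_avg => t; rewrite mulr0.
Qed.

Lemma le_circ F dF z : (forall z, modulus z < 1 -> cdiff F z (dF z)) -> modulus z < 1 ->
  modulus (F 0) `^ p <= circ F p z.
Proof.
move=> HF z1.
have cF w : modulus w < 1 -> {for w, continuous (F : C -> C)}.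
  by move=> w1; exact: cdiff_continuous (HF w w1).
rewrite (circ_modulus p2 cF z1) -circ_at0.
exact: (circ_mono p2 HF (lexx 0) (modulus_ge0 z) z1).
Qed.

(** After averaging over rotations the integrand is [circ F p], which is smallest at the centre. *)
Lemma le_disk_integral F dF : (forall z, modulus z < 1 -> cdiff F z (dF z)) ->
  ((unit_area * modulus (F 0) `^ p)%:E <=
   \int[mu2]_(z in disk 1) (modulus (F (toC z)) `^ p)%:E)%E.
Proof.
move=> HF.
have cF w : modulus w < 1 -> {for w, continuous (F : C -> C)}.
  by move=> w1; exact: cdiff_continuous (HF w w1).
have mD := measurable_disk (1 : R).
have E := @integral_circular _ (disk 1) (fun z => modulus (F z) `^ p) mD.
rewrite E; first last.
- by move=> z; exact: powR_ge0.
- by move=> z z1; exact: (continuous_on_circle p2 cF z1).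
- exact: measurable_modulus_powR.
- by move=> t z; exact: disk_rotation.
apply: (@le_trans _ _ (\int[mu2]_(z in disk 1) (cst (modulus (F 0) `^ p)%:E) z)%E).
  have H := @integral_cst _ _ R mu2 _ mD (modulus (F 0) `^ p)%:E.
  apply: (@le_trans _ _ ((modulus (F 0) `^ p)%:E * mu2 (disk 1))%E); last by rewrite -H.
  by rewrite mu2_disk// expr1n mul1r -EFinM mulrC.
apply: ge0_le_integral => //.
- by move=> z _; rewrite lee_fin powR_ge0.
- apply/measurable_EFinP.
  have := measurable_circ p2 cF; apply: eq_measurable_fun => z; rewrite inE => z1.
  exact: esym (circ_modulus p2 cF z1).
- by move=> z z1; rewrite lee_fin; exact: (le_circ HF z1).
Qed.

Lemma integral_similarity (k : R * R -> \bar R) (a b d : R) : 0 < d ->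
  measurable_fun setT k -> (forall z, (0 <= k z)%E) ->
  measurable_fun setT (fun z => k (d * z.1 + a, d * z.2 + b)%R) /\
  (\int[mu2]_z k (d * z.1 + a, d * z.2 + b)%R = (d ^- 2)%:E * \int[mu2]_z k z)%E.
Proof.
move=> d0 mk k0; have [mf fI] := translation_preserves_area a b mk k0.
have m1 : measurable_fun setT (fun z : R * R => d * z.1) by exact: measurable_funM.
have m2 : measurable_fun setT (fun z : R * R => d * z.2) by exact: measurable_funM.
split; first exact: (measurable_fun_comp_pair mf m1 m2).
rewrite -fI; exact: (integral_dilation d0 mf (fun z => k0 (z.1 + a, z.2 + b))).
Qed.

(** The area sub-mean value property is applied to [G (w + d%:C * u)] on the unit disc. The image
    disc lies within radius [s], where the weight is at least [(1 - s ^+ 2)] to the power [p - 1],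
    and the change of variables costs [d ^- 2]. *)
Lemma point_bound G dG w (d s J : R) : (forall z, modulus z < 1 -> cdiff G z (dG z)) ->
  0 < d -> modulus w + d <= s -> s < 1 ->
  (\int[mu2]_(z in disk 1) (bergman_density p G (toC z))%:E <= J%:E)%E ->
  modulus (G w) `^ p <= J / (unit_area * d ^+ 2 * (1 - s ^+ 2) `^ (p - 1)).
Proof.
move=> HG d0 ws s1 GJ.
have cG z : modulus z < 1 -> {for z, continuous (G : C -> C)}.
  by move=> z1; exact: cdiff_continuous (HG z z1).
have u0 := @unit_area_gt0 R.
have s0 : 0 <= s by rewrite (le_trans _ ws)// addr_ge0// ltW.
set c := (1 - s ^+ 2) `^ (p - 1).
have c0 : 0 < c by rewrite powR_gt0// subr_gt0 expr_lt1.
pose H u := G (w + d%:C * u).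
have in_disk u : modulus u < 1 -> modulus (w + d%:C * u) < s.
  move=> u1; apply: lt_le_trans ws; apply: le_lt_trans (le_normcD _ _) _.
  by rewrite ltrD2l normcM modulus_real ger0_norm ?(ltW d0)// gtr_pMr.
have HH u : modulus u < 1 -> cdiff H u (dG (w + d%:C * u) * d%:C).
  move=> u1; apply: cdiff_affine; last by apply: HG; exact: lt_trans (in_disk u u1) s1.
  by apply/eqP => /(congr1 Re) /= /eqP; rewrite gt_eqF.
have I1 := le_disk_integral HH.
pose k (z : R * R) : \bar R := (((fun u => bergman_density p G (toC u)) \_ (disk 1)) z)%:E.
have mD := measurable_disk (1 : R).
have mk : measurable_fun setT k.
  apply/measurable_EFinP; apply/(measurable_restrictT _ mD); exact: measurable_bergman_density.
have k0 z : (0 <= k z)%E.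
  by rewrite lee_fin patchE; case: ifPn => // _; exact: bergman_density_ge0.
have [mfd dI] := integral_similarity (Re w) (Im w) d0 mk k0.
have kI : (\int[mu2]_z k z = \int[mu2]_(z in disk 1) (bergman_density p G (toC z))%:E)%E.
  by rewrite [RHS]integral_mkcond; apply: eq_integral => z _; rewrite /k !patchE; case: ifP.
have fE u : disk 1 u -> k (d * u.1 + Re w, d * u.2 + Im w) = (bergman_density p G (w + d%:C * toC u))%:E.
  move=> u1; have E : toC (d * u.1 + Re w, d * u.2 + Im w) = w + d%:C * toC u.
    by apply: complex_ext; rewrite !complexE2 /=; ring.
  have M : (d * u.1 + Re w, d * u.2 + Im w) \in disk 1.
    by rewrite inE /disk mksetE E; exact: lt_trans (in_disk _ u1) s1.
  by rewrite /k patchE M E.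
have I2 : (c%:E * \int[mu2]_(z in disk 1) (modulus (H (toC z)) `^ p)%:E <=
    \int[mu2]_(z in disk 1) k (d * z.1 + Re w, d * z.2 + Im w)%R)%E.
  have cH u : modulus u < 1 -> {for u, continuous (H : C -> C)}.
    by move=> u1; exact: cdiff_continuous (HH u u1).
  have mH := measurable_modulus_powR p2 cH.
  have EZ := @ge0_integralZl _ _ R mu2 _ mD (fun z => (modulus (H (toC z)) `^ p)%:E) _ c%:E.
  rewrite -EZ; first last.
  - by rewrite lee_fin ltW.
  - by move=> z _; rewrite lee_fin powR_ge0.
  - by apply/measurable_EFinP; exact: mH.
  apply: ge0_le_integral => //.
  - by move=> z _; rewrite mule_ge0// lee_fin ?powR_ge0// ltW.
  - by apply: emeasurable_funM => //; apply/measurable_EFinP; exact: mH.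
  - exact: (measurable_funS measurableT).
  move=> u u1; rewrite fE// -EFinM lee_fin /bergman_density ler_wpM2r ?powR_ge0//.
  have x1 := ltW (in_disk _ u1).
  have x0 := modulus_ge0 (w + d%:C * toC u).
  have s21 : s ^+ 2 <= 1 by rewrite expr_le1// ltW.
  have xs : modulus (w + d%:C * toC u) ^+ 2 <= s ^+ 2 by rewrite ler_sqr.
  rewrite ge0_ler_powR ?nnegrE ?subr_ge0 ?lerB//; first by rewrite (le_trans _ p2)// ler1n.
  exact: le_trans xs s21.
have I3 : (\int[mu2]_(z in disk 1) k (d * z.1 + Re w, d * z.2 + Im w)%R <= (d ^- 2 * J)%:E)%E.
  apply: (@le_trans _ _ (\int[mu2]_z k (d * z.1 + Re w, d * z.2 + Im w)%R)%E).
    apply: ge0_subset_integral => //.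
  by rewrite dI kI EFinM lee_wpmul2l// lee_fin invr_ge0 exprn_ge0// ltW.
have : ((c * (unit_area * modulus (G w) `^ p))%:E <= (d ^- 2 * J)%:E)%E.
  apply: le_trans I3; apply: le_trans I2; rewrite EFinM lee_pmul2l ?lte_fin//.
  by move: I1; rewrite /H mulr0 addr0.
rewrite lee_fin ler_pdivlMr ?mulr_gt0 ?exprn_gt0// => Hc.
rewrite -(@ler_pM2l _ (d ^- 2)) ?invr_gt0 ?exprn_gt0//; apply: le_trans Hc.
rewrite le_eqVlt; apply/orP; left; apply/eqP.
by field; rewrite gt_eqF.
Qed.

End growth.

Section pointwise_control.
Context {R : realType}.
Local Notation C := (R[i]^o).
Implicit Types (f g : disc R -> R[i]).
Variable p : R.
Hypothesis p2 : 2 <= p.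
Let p0 : 0 < p. Proof. by apply: lt_le_trans p2. Qed.

Lemma cdiff_disc_derive f z : analytic f -> modulus z < 1 ->
  cdiff (extend0 f) z (extend0 (disc_derive f) z).
Proof. by move=> af z1; move/analyticP: af; exact. Qed.

Lemma analyticB f g : analytic f -> analytic g -> analytic (f \- g).
Proof.
move=> af ag.
apply: (@analytic_restriction _ (fun z => extend0 f z - extend0 g z)
  (fun z => extend0 (disc_derive f) z - extend0 (disc_derive g) z)).
  by move=> z z1; apply: cdiffB; exact: cdiff_disc_derive.
by move=> w; rewrite !extend0_val.
Qed.

(** [point_bound], on discs reaching halfway from radius [r] to the boundary, gives a uniform bound
    [B * e] for the derivative; integrating from the origin adds the value at 0, which accounts for
    the 1 in [1 + B]. *)
Lemma growth_on_disk (r : R) : 0 <= r -> r < 1 -> exists2 D, 0 <= D &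
  forall f e, analytic f -> 0 < e -> (dirichlet_norm p (p - 1) f < e%:E)%E ->
    forall z, modulus z <= r -> modulus (extend0 f z) <= D * e.
Proof.
move=> r0 r1; pose d := (1 - r) / 2; pose s := (1 + r) / 2.
have d0 : 0 < d by rewrite /d; lra.
have s1 : s < 1 by rewrite /s; lra.
have s0 : 0 <= s by rewrite /s; lra.
pose X : R := unit_area * d ^+ 2 * (1 - s ^+ 2) `^ (p - 1).
have X0 : 0 < X.
  apply: mulr_gt0; first by rewrite mulr_gt0 ?unit_area_gt0 ?exprn_gt0.
  by rewrite powR_gt0// subr_gt0 expr_lt1.
pose B : R := (pi / p / X) `^ p^-1.
exists (1 + B); first by rewrite addr_ge0// powR_ge0.
move=> f e af e0 fe z zr; have z1 : modulus z < 1 by exact: le_lt_trans zr r1.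
have [f0 mf] := le_dirichlet_norm p2 fe.
have dB w : modulus w <= r -> modulus (extend0 (disc_derive f) w) <= B * e.
  move=> wr; have wds : modulus w + d <= s by rewrite /d /s; lra.
  have adf := analytic_disc_derive af.
  have H := @point_bound _ p p2 _ _ w d s (pi / p * e `^ p) (fun z => @cdiff_disc_derive _ z adf) d0 wds s1 mf.
  have x0 := modulus_ge0 (extend0 (disc_derive f) w).
  have pi0 : 0 <= pi / p :> R by rewrite divr_ge0 ?pi_ge0 ?(ltW p0).
  have yE : (pi / p * e `^ p / X) `^ p^-1 = B * e.
    have -> : pi / p * e `^ p / X = pi / p / X * e `^ p by rewrite mulrAC.
    rewrite powRM ?powR_ge0//; last by rewrite divr_ge0// ltW.
    by rewrite -powRrM mulfV ?gt_eqF// powRr1// ltW.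
  have xE : (modulus (extend0 (disc_derive f) w) `^ p) `^ p^-1 = modulus (extend0 (disc_derive f) w).
    by move: x0; move: (modulus _) => x x0; rewrite -powRrM mulfV ?gt_eqF// powRr1.
  have := root_le p2 (powR_ge0 _ _) H.
  by move: xE yE; set x := _ `^ _; set y := _ `^ _ => -> ->.
have tz t : 0 <= t <= 1 -> modulus (0 + t%:C * z) <= modulus z.
  by move=> /andP[t0 t1]; rewrite add0r normcM modulus_real ger0_norm// ler_piMl.
have M : modulus (extend0 f z - extend0 f 0) <= B * e * modulus z.
  have H1 t : 0 <= t <= 1 ->
      cdiff (extend0 f) (0 + t%:C * z) (extend0 (disc_derive f) (0 + t%:C * z)).
    by move=> /tz tz1; apply: cdiff_disc_derive => //; exact: le_lt_trans tz1 z1.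
  have H2 t : 0 <= t <= 1 -> modulus (extend0 (disc_derive f) (0 + t%:C * z) - 0) <= B * e.
    by move=> /tz tz1; rewrite subr0; apply: dB; exact: le_trans tz1 zr.
  by have := complex_mvt H1 H2; rewrite add0r mul0r subr0.
rewrite -[extend0 f z](subrK (extend0 f 0)); apply: le_trans (le_normcD _ _) _.
rewrite mulrDl mul1r addrC lerD//; apply: (le_trans M).
by rewrite ler_piMr ?mulr_ge0 ?powR_ge0 ?(ltW e0)// ltW.
Qed.

(** The tangent inequality is taken at |f|, not at |g|: the error is then at most [D * e] times the
    slope [K], which depends on [f] only, and its average [A] is a fixed constant while [g]
    approaches [f]. *)
Lemma circ_le_of_limit f (n : R) : analytic f ->
  (forall e, 0 < e -> exists g, [/\ analytic g, (dirichlet_norm p (p - 1) (g \- f)%R < e%:E)%E &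
     forall r, 0 <= r -> r < 1 -> circ (extend0 g) p r%:C <= n]) ->
  forall r, 0 <= r -> r < 1 -> circ (extend0 f) p r%:C <= n.
Proof.
move=> af H r r0 r1; have [D D0 HD] := growth_on_disk r0 r1.
have r1' : modulus r%:C < 1 by rewrite modulus_real ger0_norm.
have con (h : disc R -> R[i]) q : analytic h -> 0 < q ->
    continuous (fun t => modulus (extend0 h (cis t * r%:C)) `^ q).
  move=> ah q0 t.
  apply: (@continuous_modulus_powR _ _ (fun t => extend0 h (cis t * r%:C)) q t q0).
  apply: (@continuousC_comp _ _ (fun t => cis t * r%:C) (extend0 h) t); first exact: continuous_cisM.
  by apply: continuous_extend0 => //; rewrite normcM modulus_cis mul1r.
have q0 : 0 < p - 1 by rewrite subr_gt0 (lt_le_trans _ p2)// ltr1n.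
pose uf t := modulus (extend0 f (cis t * r%:C)) `^ p.
pose K t := p * modulus (extend0 f (cis t * r%:C)) `^ (p - 1).
have K0 t : 0 <= K t by rewrite mulr_ge0 ?powR_ge0// ltW.
have cuf : continuous uf by exact: con.
have cK : continuous K by move=> t; apply: cvgM; [exact: cvg_cst|exact: (con f (p - 1) af q0)].
pose A := avg K.
have A0 : 0 <= A by exact: avg_ge0.
have aux (k x y u v w : R) : 0 <= k -> v + k * (x - y) <= u -> y - x <= w -> v <= u + w * k.
  by nra.
have key e : 0 < e -> circ (extend0 f) p r%:C <= n + D * e * A.
  move=> e0; have [g [ag gf gn]] := H e e0.
  pose ug t := modulus (extend0 g (cis t * r%:C)) `^ p.
  have cug : continuous ug by exact: con.
  have cDK : continuous (fun t => D * e * K t).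
    by move=> t; apply: cvgM; [exact: cvg_cst|exact: cK].
  have cs : continuous (fun t => ug t + D * e * K t).
    by move=> t; apply: cvgD; [exact: cug|exact: cDK].
  have pw t : uf t <= ug t + D * e * K t.
    have zr : modulus (cis t * r%:C) <= r.
      by rewrite normcM modulus_cis mul1r modulus_real ger0_norm.
    have := HD (g \- f) e (analyticB ag af) e0 gf _ zr; rewrite extend0B => gfz.
    have p1 : 1 <= p by rewrite (le_trans _ p2)// ler1n.
    apply: (aux _ _ _ _ _ _ (K0 t) (powR_tangent p1 (modulus_ge0 (extend0 g (cis t * r%:C)))
      (modulus_ge0 (extend0 f (cis t * r%:C))))).
    apply: le_trans gfz; rewrite modulusB; apply: le_trans (modulus_dist _ _).
    exact: ler_norm.
  have E1 := avgD cug cDK; have E2 := avgZ (D * e) cK.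
  by apply: (le_trans (le_avg cuf cs pw)); rewrite E1 E2 lerD2r; exact: gn.
have DA : 0 < D * A + 1 by rewrite ltr_wpDl// mulr_ge0.
apply/ler_addgt0Pr => e e0; apply: le_trans (key _ (divr_gt0 e0 DA)) _.
rewrite lerD2l [D * _]mulrC -mulrA mulrAC ler_pdivrMr// ler_pM2l//.
by rewrite lerDl.
Qed.

End pointwise_control.

(** * Lacunary polynomials *)

Section lacunary_polynomials.
Context {R : realType}.
Local Notation mu := (@lebesgue_measure R).
Local Notation mu2 := ((mu \x mu)%E).
Local Notation C := (R[i]^o).
Implicit Types (z : R[i]) (K N n k : nat) (x r t : R).

Definition lacunary K z : R[i] := \sum_(k < K) z ^+ (2 ^ k).

Definition lacunary_derivative K z : R[i] := \sum_(k < K) (2 ^ k)%:R * z ^+ (2 ^ k).-1.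

Lemma cdiff_exp n z : cdiff (fun w => w ^+ n) z (n%:R * z ^+ n.-1).
Proof.
case: n => [|n]; first by rewrite mul0r; exact: cdiff_cst.
apply/cdiffP; have /cdiffP H := cdiff_id z.
have := @is_deriveX _ _ (id : C -> C) n.+1 (z : C) (1 : C) (1 : C) H.
have -> : (id : C -> C) ^+ n.+1 = (fun w : C => w ^+ n.+1 : C).
  by apply/funext => w; rewrite exprfctE.
by rewrite /GRing.scale/= mulr1.
Qed.

Lemma cdiff_lacunary K z : cdiff (lacunary K) z (lacunary_derivative K z).
Proof.
elim: K => [|K IH].
  rewrite /lacunary_derivative big_ord0 (_ : lacunary 0 = fun=> 0); first exact: cdiff_cst.
  by apply/funext => w; rewrite /lacunary big_ord0.
rewrite /lacunary_derivative big_ord_recr/=.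
rewrite (_ : lacunary K.+1 = fun w => lacunary K w + w ^+ (2 ^ K)).
  by apply: cdiffD; [exact: IH|exact: cdiff_exp].
by apply/funext => w; rewrite /lacunary big_ord_recr.
Qed.

Definition lacunary_majorant K x : R := \sum_(k < K) (2 ^ k)%:R * x ^+ (2 ^ k).-1.

Lemma modulus_nat n : modulus (n%:R : R[i]) = n%:R.
Proof.
have -> : (n%:R : R[i]) = (n%:R : R)%:C by rewrite rmorph_nat.
by rewrite modulus_real ger0_norm.
Qed.

Lemma modulusX z n : modulus (z ^+ n) = modulus z ^+ n.
Proof. by elim: n => [|n IH]; rewrite ?expr0 ?normc1// !exprS normcM IH. Qed.

Lemma modulus_lacunary_derivative K z :
  modulus (lacunary_derivative K z) <= lacunary_majorant K (modulus z).
Proof.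
rewrite /lacunary_derivative /lacunary_majorant.
elim: K => [|K IH]; first by rewrite !big_ord0 modulus0.
rewrite !big_ord_recr/=; apply: le_trans (le_normcD _ _) _.
by rewrite lerD// normcM modulus_nat modulusX.
Qed.

(** Geometrically, 1 - x^n is 1 - x times a sum of n powers of x, each at least x^(n-1). *)
Lemma one_subX_ge x n : 0 <= x -> x <= 1 -> n%:R * x ^+ n.-1 * (1 - x) <= 1 - x ^+ n.
Proof.
move=> x0 x1; case: n => [|n]; first by rewrite expr0 subrr !mul0r.
elim: n => [|n IH]; first by rewrite expr0 expr1 !mul1r.
have y0 : 0 <= x ^+ n by rewrite exprn_ge0.
have y1 : x ^+ n <= 1 by rewrite exprn_ile1.
move: IH; rewrite /= !exprS -!natr1; move: (x ^+ n) y0 y1 (n%:R : R) (ler0n R n) => y y0 y1 m m0 IH.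
have x10 : 0 <= 1 - x by rewrite subr_ge0.
have h1 := ler_wpM2l x0 IH.
have h2 : x * y <= 1 by rewrite mulr_ile1.
have h3 := ler_wpM2r x10 h2.
by nra.
Qed.

(** With N = 2^n, [one_subX_ge] bounds (1 - x) 2N x^(2N-1) by 2 x^N (1 - x^N) = 2 (x^N - x^(2N)), so
    the sum over dyadic exponents telescopes. *)
Lemma lacunary_majorant_le K x : 0 <= x -> x <= 1 -> (1 - x) * lacunary_majorant K x <= 2.
Proof.
move=> x0 x1.
have H n : (1 - x) * lacunary_majorant n.+1 x <= 2 * (1 - x ^+ (2 ^ n)).
  elim: n => [|n IH].
    by rewrite /lacunary_majorant big_ord_recr big_ord0/= expr0 !expr1; lra.
  rewrite /lacunary_majorant big_ord_recr/= mulrDr.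
  apply: le_trans (lerD IH (lexx _)) _.
  set N := (2 ^ n)%N; have N0 : (0 < N)%N by rewrite expn_gt0.
  have T := one_subX_ge N x0 x1.
  have -> : (2 ^ n.+1 = N + N)%N by rewrite expnS mul2n addnn.
  have -> : ((N + N).-1 = N + N.-1)%N by rewrite -subn1 -addnBA// subn1.
  have y0 : 0 <= x ^+ N by rewrite exprn_ge0.
  rewrite !exprD natrD.
  move: T y0; move: (x ^+ N) (x ^+ N.-1) (N%:R) => y w m T y0.
  have := ler_wpM2l y0 T; lra.
case: K => [|K]; first by rewrite /lacunary_majorant big_ord0 mulr0.
apply: le_trans (H K) _.
have : 0 <= x ^+ (2 ^ K) by rewrite exprn_ge0.
by lra.
Qed.

(** A Bloch bound uniform in [K]; the 4 is the 2 of [lacunary_majorant_le] times 1 + |z| <= 2. *)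
Lemma lacunary_derivative_growth K z : modulus z < 1 ->
  (1 - modulus z ^+ 2) * modulus (lacunary_derivative K z) <= 4.
Proof.
move=> z1; have z0 := modulus_ge0 z.
have := lacunary_majorant_le K z0 (ltW z1).
have := modulus_lacunary_derivative K z.
have := modulus_ge0 (lacunary_derivative K z).
move: (modulus (lacunary_derivative K z)) (lacunary_majorant K (modulus z)).
move: (modulus z) z0 z1 => x x0 x1 m s m0 ms xs.
have : (1 - x) * m <= 2 by apply: le_trans xs; rewrite ler_wpM2l// subr_ge0 ltW.
have : 0 <= (1 - x) * m by rewrite mulr_ge0// subr_ge0 ltW.
rewrite (_ : (1 - x ^+ 2) * m = (1 + x) * ((1 - x) * m)); last by ring.
by move: ((1 - x) * m) => u u0 u2; nra.
Qed.

Lemma cisX t n : cis t ^+ n = cis (n%:R * t).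
Proof.
elim: n => [|n IH]; first by rewrite expr0 mul0r cis0.
by rewrite exprS IH -cisD; congr cis; rewrite -natr1 mulrDl mul1r addrC.
Qed.

Lemma continuous_cosM n : continuous (fun t => cos (n%:R * t) : R).
Proof.
move=> t; apply: (@continuous_comp _ _ _ (fun t : R => n%:R * t) cos); last exact: continuous_cos.
by apply: cvgM; [exact: cvg_cst|exact: cvg_id].
Qed.

Lemma avg_cos_multiple n : (0 < n)%N -> avg (fun t => cos (n%:R * t) : R) = 0.
Proof.
move=> n0; have nR : n%:R != 0 :> R by rewrite pnatr_eq0 -lt0n.
apply: (@avg_FTC _ _ (fun t => n%:R^-1 * sin (n%:R * t))).
- move=> x.
  have d1 : is_derive x 1 (fun t : R => n%:R * t) n%:R.
    by have := @is_deriveZ _ _ _ (id : R -> R) n%:R x 1 1 (is_derive_id x 1); rewrite /GRing.scale/= mulr1.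
  have d2 := is_derive1_comp (is_derive_sin (n%:R * x)) d1.
  have := is_deriveZ (n%:R^-1) d2.
  rewrite /GRing.scale/= [cos _ * _]mulrC mulrA mulVf// mul1r; exact.
- exact: continuous_cosM.
- have := congr1 Im (cisX (2 * pi) n); rewrite cis2pi expr1n /= => <-.
  by rewrite !mulr0 sin0 mulr0.
Qed.

Lemma avg_cos_combination K (c : nat -> R) (m : nat -> nat) : (forall k, (k < K)%N -> (0 < m k)%N) ->
  continuous (fun t => \sum_(k < K) c k * cos ((m k)%:R * t)) /\
  avg (fun t => \sum_(k < K) c k * cos ((m k)%:R * t)) = 0.
Proof.
elim: K => [|K IH] Hm.
  rewrite (_ : (fun t => _) = fun=> 0); last by apply/funext => t; rewrite big_ord0.
  by split; [move=> t; exact: cvg_cst|exact: avg_cst].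
have [|c1 a1] := IH; first by move=> k kK; apply: Hm; exact: ltnW.
have c2 : continuous (fun t => c K * cos ((m K)%:R * t)).
  by move=> t; apply: cvgM; [exact: cvg_cst|exact: continuous_cosM].
rewrite (_ : (fun t => _) = fun t => \sum_(k < K) c k * cos ((m k)%:R * t) + c K * cos ((m K)%:R * t)); last first.
  by apply/funext => t; rewrite big_ord_recr.
split; first by move=> t; apply: cvgD; [exact: c1|exact: c2].
rewrite (avgD c1 c2) a1 add0r (avgZ _ (@continuous_cosM (m K))) avg_cos_multiple ?mulr0//.
exact: Hm.
Qed.

Lemma Re_conjX_mul t r a b : (a <= b)%N ->
  Re (conjc ((cis t * r%:C) ^+ a) * (cis t * r%:C) ^+ b) =
  r ^+ a * r ^+ b * cos ((b - a)%:R * t).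
Proof.
move=> ab; have E n : (cis t * r%:C) ^+ n = cis (n%:R * t) * (r ^+ n)%:C.
  by rewrite exprMn cisX rmorphXn.
rewrite !E natrB// mulrBl cosB !complexE2 /=; ring.
Qed.

Lemma sqr_modulusD (x y : R[i]) :
  modulus (x + y) ^+ 2 = modulus x ^+ 2 + modulus y ^+ 2 + 2 * Re (conjc x * y).
Proof. by rewrite !sqr_modulus !complexE2; ring. Qed.

(** Every exponent in [lacunary K] is below [N], so each product is a cosine of a positive multiple
    of [t]. Continuity is carried along because the induction in [lacunary_parseval] splits
    averages. *)
Lemma lacunary_cross K N r : (2 ^ K <= N)%N ->
  continuous (fun t => Re (conjc (lacunary K (cis t * r%:C)) * (cis t * r%:C) ^+ N)) /\
  avg (fun t => Re (conjc (lacunary K (cis t * r%:C)) * (cis t * r%:C) ^+ N)) = 0.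
Proof.
move=> KN.
have le k : (k < K)%N -> (2 ^ k < N)%N by move=> kK; apply: leq_trans KN; rewrite ltn_exp2l.
rewrite (_ : (fun t => _) =
  fun t => \sum_(k < K) (r ^+ (2 ^ k) * r ^+ N) * cos ((N - 2 ^ k)%:R * t)).
  apply: (@avg_cos_combination K (fun k => r ^+ (2 ^ k) * r ^+ N) (fun k => (N - 2 ^ k)%N)).
  by move=> k /le kN; rewrite subn_gt0.
apply/funext => t; rewrite /lacunary rmorph_sum mulr_suml raddf_sum; apply: eq_bigr => k _.
exact: (@Re_conjX_mul t r _ _ (ltnW (le k (ltn_ord k)))).
Qed.

Lemma lacunary_parseval K r : continuous (fun t => modulus (lacunary K (cis t * r%:C)) ^+ 2) /\
  avg (fun t => modulus (lacunary K (cis t * r%:C)) ^+ 2) = \sum_(k < K) (r ^+ (2 ^ k)) ^+ 2.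
Proof.
elim: K => [|K [IHc IH]].
  rewrite big_ord0 (_ : (fun t => _) = fun=> 0); first by split; [move=> t; exact: cvg_cst|exact: avg_cst].
  by apply/funext => t; rewrite /lacunary big_ord0 modulus0 expr0n.
have [c1 a1] := @lacunary_cross K (2 ^ K) r (leqnn _).
rewrite (_ : (fun t => _) = fun t => modulus (lacunary K (cis t * r%:C)) ^+ 2 + (r ^+ (2 ^ K)) ^+ 2 +
    2 * Re (conjc (lacunary K (cis t * r%:C)) * (cis t * r%:C) ^+ (2 ^ K))); last first.
  apply/funext => t; rewrite {1}/lacunary big_ord_recr/= sqr_modulusD; congr (_ + _ + _).
  by rewrite modulusX normcM modulus_cis mul1r modulus_real exprAC real_normK ?num_real// exprAC.
have c2 : continuous (fun t => 2 * Re (conjc (lacunary K (cis t * r%:C)) * (cis t * r%:C) ^+ (2 ^ K))).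
  by move=> t; apply: cvgM; [exact: cvg_cst|exact: c1].
have c3 : continuous (fun t => modulus (lacunary K (cis t * r%:C)) ^+ 2 + (r ^+ (2 ^ K)) ^+ 2).
  by move=> t; apply: cvgD; [exact: IHc|exact: cvg_cst].
split; first by move=> t; apply: cvgD; [exact: c3|exact: c2].
rewrite (avgD c3 c2) (avgZ _ c1) a1 mulr0 addr0 big_ord_recr/= -IH.
have c4 : continuous (fun _ : R => (r ^+ (2 ^ K)) ^+ 2) by move=> t; exact: cvg_cst.
by rewrite (avgD IHc c4) avg_cst.
Qed.

Lemma circ_lacunary K r : circ (lacunary K) 2 r%:C = \sum_(k < K) (r ^+ (2 ^ k)) ^+ 2.
Proof.
have [_ <-] := lacunary_parseval K r.
by apply: eq_avg => t; rewrite powR_mulrn.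
Qed.

Lemma circ_lacunary_le K r : 0 <= r -> r < 1 -> circ (lacunary K) 2 r%:C <= K%:R.
Proof.
move=> r0 r1; rewrite circ_lacunary.
have -> : K%:R = \sum_(k < K) (1 : R) by rewrite sumr_const card_ord.
apply: ler_sum => k _; rewrite exprn_ile1// ?exprn_ge0//.
by rewrite exprn_ile1// ltW.
Qed.

Lemma circ_lacunary_ge K : exists r, [/\ 0 <= r, r < 1 & K%:R / 2 <= circ (lacunary K) 2 r%:C].
Proof.
pose N := (2 ^ K)%N; have N0 : 0 < N%:R :> R by rewrite ltr0n expn_gt0.
have N1 : 1 <= N%:R :> R by rewrite ler1n expn_gt0.
(* By Bernoulli's inequality (1 - u)^N >= 1 - N u = 1/2. As k < K, the exponent 2^(k+1) is at most
   N, so each of the K squares is at least 1/2. *)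
pose u : R := (2 * N%:R)^-1.
have u0 : 0 < u by rewrite invr_gt0 mulr_gt0.
have uN : N%:R * u = 1 / 2 by rewrite /u; field; rewrite gt_eqF.
have r0 : 0 <= 1 - u by nra.
have r1 : 1 - u <= 1 by rewrite gerBl ltW.
exists (1 - u); split=> //; first by rewrite gtrBl.
rewrite circ_lacunary.
have -> : K%:R / 2 = \sum_(k < K) (1 / 2 : R).
  by rewrite sumr_const card_ord -[RHS]mulr_natl mul1r.
apply: ler_sum => k _; rewrite -exprM.
have bern n : 1 - n%:R * u <= (1 - u) ^+ n.
  elim: n => [|n IH]; first by rewrite expr0 mul0r subr0.
  rewrite exprS; apply: le_trans (ler_wpM2l r0 IH).
  rewrite -natr1; have := ler0n R n; nra.
apply: (@le_trans _ _ ((1 - u) ^+ N)).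
  by apply: le_trans (bern N); rewrite uN; lra.
by rewrite ler_wiXn2l// -expnSr leq_exp2l// ltn_ord.
Qed.

Variable p : R.
Hypothesis p2 : 2 <= p.

Lemma circ_lacunary_powR K : exists r, [/\ 0 <= r, r < 1 &
  (K%:R / 2) `^ (p / 2) <= circ (lacunary K) p r%:C].
Proof.
have [r [r0 r1 H]] := circ_lacunary_ge K; exists r; split; [exact: r0|exact: r1|].
have q1 : 1 <= p / 2 by rewrite ler_pdivlMr// mul1r.
have q0 : 0 <= p / 2 by exact: le_trans q1.
have c : continuous (fun t => modulus (lacunary K (cis t * r%:C)) `^ 2).
  have -> : (fun t => modulus (lacunary K (cis t * r%:C)) `^ 2) =
      (fun t => modulus (lacunary K (cis t * r%:C)) ^+ 2).
    by apply/funext => t; rewrite powR_mulrn.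
  by have [] := lacunary_parseval K r.
have A := avg_powR q1 c (fun t => powR_ge0 _ _).
apply: (@le_trans _ _ (circ (lacunary K) 2 r%:C `^ (p / 2))).
  move: (circ_ge0 2 (lacunary K) r%:C) H; move: (circ _ _ _) => x x0 H.
  by rewrite ge0_ler_powR ?nnegrE// divr_ge0.
apply: (le_trans A); rewrite le_eqVlt; apply/orP; left; apply/eqP.
have E : 2 * (p / 2) = p by field.
by apply: eq_avg => t; rewrite -powRrM E.
Qed.

(** The two densities differ by the factor ((1 - |z|^2) |g_K'|)^(p-2), which the Bloch bound
    controls. *)
Lemma density_comparison K z : modulus z < 1 ->
  bergman_density p (lacunary_derivative K) z <=
  4 `^ (p - 2) * bergman_density 2 (lacunary_derivative K) z.
Proof.
move=> z1; have H := lacunary_derivative_growth K z1; rewrite /bergman_density.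
have y0 : 0 < 1 - modulus z ^+ 2 by rewrite subr_gt0 expr_lt1 ?modulus_ge0.
have := modulus_ge0 (lacunary_derivative K z).
move: (1 - modulus z ^+ 2) y0 (modulus (lacunary_derivative K z)) H => y y0 m ym m0.
have -> : p - 1 = (p - 2) + (2 - 1) by ring.
rewrite powRD; last by apply/implyP => _; rewrite gt_eqF.
have -> : m `^ p = m `^ (p - 2) * m `^ 2.
  have pE : p = p - 2 + 2 by ring.
  rewrite {1}pE powRD//; apply/implyP => /eqP E; exfalso; move: E p2; lra.
rewrite mulrACA -powRM ?(ltW y0)//; apply: ler_wpM2r.
  by rewrite mulr_ge0 ?powR_ge0.
by rewrite ge0_ler_powR ?nnegrE ?subr_ge0 ?mulr_ge0 ?(ltW y0)//.
Qed.

Lemma cdiff_lacunary_derivative K z : exists d, cdiff (lacunary_derivative K) z d.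
Proof.
by apply: (@cdiff_derivative _ (lacunary K) _ z 1) => // w _; exact: cdiff_lacunary.
Qed.

Lemma continuous_lacunary_derivative K z : {for z, continuous (lacunary_derivative K : C -> C)}.
Proof. by have [d Hd] := cdiff_lacunary_derivative K z; exact: cdiff_continuous Hd. Qed.

Definition lacunary_constant : R := 4 `^ (p - 2) * (unit_area * 16 `^ 2 / 2).

Lemma lacunary_constant_gt0 : 0 < lacunary_constant.
Proof. by rewrite !mulr_gt0 ?powR_gt0 ?unit_area_gt0 ?invr_gt0. Qed.

Lemma lacunary_mass K :
  (\int[mu2]_(z in disk 1) (bergman_density p (lacunary_derivative K) (toC z))%:E <=
   (lacunary_constant * K%:R)%:E)%E.
Proof.
have cd z : modulus z < 1 -> {for z, continuous (lacunary_derivative K : C -> C)}.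
  by move=> _; exact: continuous_lacunary_derivative.
have mD := measurable_disk (1 : R).
have LP := @littlewood_paley _ 2 (lexx 2) _ _ (fun z _ => cdiff_lacunary K z) K%:R (@circ_lacunary_le K).
have m2 := measurable_bergman_density (lexx 2) cd.
apply: (@le_trans _ _ (\int[mu2]_(z in disk 1)
    ((4 `^ (p - 2))%:E * (bergman_density 2 (lacunary_derivative K) (toC z))%:E))%E).
  apply: ge0_le_integral => //.
  - by move=> z _; rewrite lee_fin bergman_density_ge0.
  - by apply/measurable_EFinP; exact: measurable_bergman_density.
  - by apply: emeasurable_funM => //; apply/measurable_EFinP; exact: m2.
  - by move=> z z1; rewrite -EFinM lee_fin; exact: density_comparison.
have E := @ge0_integralZl _ _ R mu2 _ mD (fun u => (bergman_density 2 (lacunary_derivative K) (toC u))%:E) _ (4 `^ (p - 2))%:E.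
rewrite E; first last.
- by rewrite lee_fin powR_ge0.
- by move=> z _; rewrite lee_fin bergman_density_ge0.
- by apply/measurable_EFinP; exact: m2.
by rewrite /lacunary_constant -mulrA EFinM lee_wpmul2l// lee_fin powR_ge0.
Qed.

End lacunary_polynomials.

(** * Perturbation by multiples of lacunary polynomials *)

Section perturbation.
Context {R : realType}.
Local Notation mu := (@lebesgue_measure R).
Local Notation mu2 := ((mu \x mu)%E).
Local Notation C := (R[i]^o).
Implicit Types (f : disc R -> R[i]) (G H : R[i] -> R[i]) (c : R) (K : nat).
Variable p : R.
Hypothesis p2 : 2 < p.

Let p2' : 2 <= p. Proof. exact: ltW. Qed.
Let p0 : 0 < p. Proof. by apply: lt_trans p2. Qed.
Let p1 : 1 <= p. Proof. by apply: le_trans p2'; rewrite ler1n. Qed.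

Definition disc_mass G : \bar R := (\int[mu2]_(z in disk 1) (bergman_density p G (toC z))%:E)%E.

Lemma eq_disc_mass G H : (forall z, modulus z < 1 -> G z = H z) -> disc_mass G = disc_mass H.
Proof.
move=> GH; apply: eq_integral => z; rewrite inE => z1.
by rewrite /bergman_density (GH _ z1).
Qed.

Lemma powRD_le (x y : R) : 0 <= x -> 0 <= y -> (x + y) `^ p <= 2 `^ p * (x `^ p + y `^ p).
Proof.
move=> x0 y0; have := powR_midpoint p1 x0 y0.
have -> : (x + y) `^ p = 2 `^ p * ((x + y) / 2) `^ p.
  rewrite -powRM//; last by rewrite divr_ge0// addr_ge0.
  by congr (_ `^ _); field.
have : 0 <= ((x + y) / 2) `^ p by exact: powR_ge0.
move=> u0 H; rewrite ler_pM2l ?powR_gt0//; lra.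
Qed.

Lemma EFin_mul_lty (a : R) (x : \bar R) : 0 <= a -> (0 <= x)%E -> (x < +oo)%E -> (a%:E * x < +oo)%E.
Proof. by move=> a0 x0 xoo; rewrite lte_mul_pinfty// lee_fin. Qed.

Lemma disc_mass_ge0 G : (0 <= disc_mass G)%E.
Proof. by apply: integral_ge0 => z _; rewrite lee_fin bergman_density_ge0. Qed.

Lemma disc_massD_lty G H : (forall z, modulus z < 1 -> {for z, continuous (G : C -> C)}) ->
  (forall z, modulus z < 1 -> {for z, continuous (H : C -> C)}) ->
  (disc_mass G < +oo)%E -> (disc_mass H < +oo)%E -> (disc_mass (fun z => G z + H z)%R < +oo)%E.
Proof.
move=> cG cH mG mH.
have mD := measurable_disk (1 : R).
have cGH z : modulus z < 1 -> {for z, continuous ((fun z => G z + H z) : C -> C)}.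
  by move=> z1; exact: (cvgD (cG z z1) (cH z z1)).
have m1 := measurable_bergman_density p2' cG.
have m2 := measurable_bergman_density p2' cH.
have m3 := measurable_bergman_density p2' cGH.
apply: (@le_lt_trans _ _ ((2 `^ p)%:E * (disc_mass G + disc_mass H))%E); last first.
  apply: EFin_mul_lty; [exact: powR_ge0|apply: adde_ge0; exact: disc_mass_ge0|].
  exact: (lte_add_pinfty mG mH).
have E1 := @ge0_integralD _ _ R mu2 _ mD (fun u => (bergman_density p G (toC u))%:E)
  (fun u => (bergman_density p H (toC u))%:E).
have E2 := @ge0_integralZl _ _ R mu2 _ mD (fun u => (bergman_density p G (toC u))%:E +
  (bergman_density p H (toC u))%:E)%E _ (2 `^ p)%:E.
rewrite -E1; first last.
- by apply/measurable_EFinP.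
- by move=> z _; rewrite lee_fin bergman_density_ge0.
- by apply/measurable_EFinP.
- by move=> z _; rewrite lee_fin bergman_density_ge0.
rewrite -E2; first last.
- by rewrite lee_fin powR_ge0.
- by move=> z _; rewrite -EFinD lee_fin addr_ge0// bergman_density_ge0.
- by apply: emeasurable_funD; apply/measurable_EFinP.
apply: ge0_le_integral => //.
- by move=> z _; rewrite lee_fin bergman_density_ge0.
- by apply/measurable_EFinP.
- by apply: emeasurable_funM => //; apply: emeasurable_funD; apply/measurable_EFinP.
move=> z _; rewrite -EFinD -EFinM lee_fin /bergman_density -mulrDr mulrCA.
apply: ler_wpM2l; first exact: powR_ge0.
apply: le_trans (powRD_le (modulus_ge0 _) (modulus_ge0 _)).
by rewrite ge0_ler_powR ?nnegrE ?modulus_ge0 ?addr_ge0 ?(ltW p0) ?modulus_ge0// le_normcD.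
Qed.

Lemma disc_massZ G c : (forall z, modulus z < 1 -> {for z, continuous (G : C -> C)}) ->
  disc_mass (fun z => c%:C * G z) = ((`|c| `^ p)%:E * disc_mass G)%E.
Proof.
move=> cG; have mD := measurable_disk (1 : R).
have m1 := measurable_bergman_density p2' cG.
have E2 := @ge0_integralZl _ _ R mu2 _ mD (fun u => (bergman_density p G (toC u))%:E) _ (`|c| `^ p)%:E.
rewrite /disc_mass -E2; first last.
- by rewrite lee_fin powR_ge0.
- by move=> z _; rewrite lee_fin bergman_density_ge0.
- by apply/measurable_EFinP.
apply: eq_integral => z _; rewrite -EFinM /bergman_density normcM modulus_real powRM ?modulus_ge0//.
by rewrite mulrCA.
Qed.

Definition perturb f c K : disc R -> R[i] := fun w => f w + c%:C * lacunary K (val w).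

Lemma extend0_perturb f c K z : modulus z < 1 ->
  extend0 (perturb f c K) z = extend0 f z + c%:C * lacunary K z.
Proof. by move=> /disc_exists[w <-]; rewrite !extend0_val. Qed.

Lemma cdiff_perturb f c K z : analytic f -> modulus z < 1 ->
  cdiff (fun z => extend0 f z + c%:C * lacunary K z) z
    (extend0 (disc_derive f) z + c%:C * lacunary_derivative K z).
Proof.
move=> af z1; apply: cdiffD; first exact: cdiff_disc_derive.
by apply: cdiffZ; exact: cdiff_lacunary.
Qed.

Lemma perturbE f c K w : perturb f c K w = extend0 f (val w) + c%:C * lacunary K (val w).
Proof. by rewrite extend0_val. Qed.

Lemma dirichlet_perturb f c K : dirichlet p (p - 1) f -> dirichlet p (p - 1) (perturb f c K).
Proof.
move=> /(dirichletP p2')[af mf]; apply/(dirichletP p2').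
have HF z (z1 : modulus z < 1) := cdiff_perturb c K af z1.
have fE := @perturbE f c K.
split; first exact: (analytic_restriction HF fE).
have -> : derivative_mass p (perturb f c K) =
    disc_mass (fun z => extend0 (disc_derive f) z + c%:C * lacunary_derivative K z).
  by apply: eq_disc_mass => z z1; exact: (disc_derive_restriction HF fE).
have cl z : modulus z < 1 -> {for z, continuous (lacunary_derivative K : C -> C)}.
  by move=> _; exact: continuous_lacunary_derivative.
have cl2 z : modulus z < 1 -> {for z, continuous ((fun z => c%:C * lacunary_derivative K z) : C -> C)}.
  by move=> z1; have [d Hd] := cdiff_lacunary_derivative K z; exact: cdiff_continuous (cdiffZ c%:C Hd).
apply: (@disc_massD_lty (extend0 (disc_derive f)) (fun z => c%:C * lacunary_derivative K z)).
- by move=> z z1; exact: (continuous_extend0 (analytic_disc_derive af) z1).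
- exact: cl2.
- exact: mf.
- rewrite (disc_massZ c cl); apply: EFin_mul_lty; [exact: powR_ge0|exact: disc_mass_ge0|].
  exact: le_lt_trans (lacunary_mass p2' K) (ltry _).
Qed.

(** The difference is a multiple of the lacunary polynomial, which vanishes at 0 because all its
    exponents are positive; only the derivative contributes. *)
Lemma perturb_norm f c K : analytic f ->
  (dirichlet_norm p (p - 1) (perturb f c K \- f)%R <=
   ((p / pi * (`|c| `^ p * (lacunary_constant p * K%:R))) `^ p^-1)%:E)%E.
Proof.
move=> af.
have HF z : modulus z < 1 ->
    cdiff (fun z => c%:C * lacunary K z) z (c%:C * lacunary_derivative K z).
  by move=> _; apply: cdiffZ; exact: cdiff_lacunary.
have fE w : (perturb f c K \- f) w = c%:C * lacunary K (val w).
  by rewrite /= /perturb addrC addKr.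
have cl z : modulus z < 1 -> {for z, continuous (lacunary_derivative K : C -> C)}.
  by move=> _; exact: continuous_lacunary_derivative.
apply: (dirichlet_norm_le p2').
  rewrite (@extend0_restriction _ (fun z => c%:C * lacunary K z) _ fE) ?modulus0// /lacunary big1 ?mulr0// => k _.
  by rewrite expr0n expn_eq0.
have -> : derivative_mass p (perturb f c K \- f) =
    disc_mass (fun z => c%:C * lacunary_derivative K z).
  by apply: eq_disc_mass => z z1; exact: (@disc_derive_restriction _ _ _ HF _ fE).
rewrite (disc_massZ c cl) EFinM; apply: lee_wpmul2l; first by rewrite lee_fin powR_ge0.
exact: lacunary_mass.
Qed.

(** Twice [c] times the polynomial is the difference of the two perturbations, so [f] drops out and
    convexity bounds the p-th mean of [c] times the polynomial by the average of the two given
    means. *)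
Lemma circ_perturb f c K r n : analytic f -> 0 <= r -> r < 1 ->
  circ (extend0 (perturb f c K)) p r%:C <= n -> circ (extend0 (perturb f (- c) K)) p r%:C <= n ->
  `|c| `^ p * circ (lacunary K) p r%:C <= n.
Proof.
move=> af r0 r1; set F1 := extend0 (perturb f c K); set F2 := extend0 (perturb f (- c) K) => H1 H2.
have r1' : modulus r%:C < 1 by rewrite modulus_real ger0_norm.
have cont F dF : (forall z, modulus z < 1 -> cdiff F z (dF z)) ->
    continuous (fun t => modulus (F (cis t * r%:C)) `^ p).
  move=> HF; apply: (continuous_on_circle p2' _ r1') => z z1.
  exact: cdiff_continuous (HF z z1).
have c1 := cont _ _ (fun z z1 => cdiff_restriction
  (fun z z1 => cdiff_perturb c K af z1) (@perturbE f c K) z1).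
have c2 := cont _ _ (fun z z1 => cdiff_restriction
  (fun z z1 => cdiff_perturb (- c) K af z1) (@perturbE f (- c) K) z1).
have c3 := cont _ _ (fun z _ => cdiff_lacunary K z).
pose u t := modulus (F1 (cis t * r%:C)) `^ p.
pose v t := modulus (F2 (cis t * r%:C)) `^ p.
pose w t := modulus (lacunary K (cis t * r%:C)) `^ p.
have cw : continuous (fun t => `|c| `^ p * w t).
  by move=> t; apply: cvgM; [exact: cvg_cst|exact: c3].
have cuv : continuous (fun t => u t + v t) by move=> t; apply: cvgD; [exact: c1|exact: c2].
have cuv2 : continuous (fun t => 2^-1 * (u t + v t)).
  by move=> t; apply: cvgM; [exact: cvg_cst|exact: cuv].
have pw t : `|c| `^ p * w t <= 2^-1 * (u t + v t).
  set z := cis t * r%:C.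
  have z1 : modulus z < 1 by rewrite normcM modulus_cis mul1r.
  rewrite /u /v /w -/z -powRM ?modulus_ge0// -modulus_real -normcM.
  have E : 2%:R * (c%:C * lacunary K z) = F1 z - F2 z.
    by rewrite /F1 /F2 !extend0_perturb// rmorphN/=; ring.
  have M : modulus (c%:C * lacunary K z) <= (modulus (F1 z) + modulus (F2 z)) / 2.
    rewrite ler_pdivlMr// mulrC -(modulus_nat 2) -normcM E.
    by apply: le_trans (le_normcD _ _) _; rewrite normcN.
  have := powR_midpoint p1 (modulus_ge0 (F1 z)) (modulus_ge0 (F2 z)).
  rewrite ler_pdivlMl//; apply: le_trans; rewrite ler_pM2l//.
  by rewrite ge0_ler_powR ?nnegrE ?modulus_ge0 ?(ltW p0)// divr_ge0// addr_ge0.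
have A := le_avg cw cuv2 pw.
have E1 := avgZ (`|c| `^ p) c3; have E2 := avgZ 2^-1 cuv; have E3 := avgD c1 c2.
rewrite E1 E2 E3 in A; apply: (le_trans A).
rewrite ler_pdivrMl// mulr_natl mulr2n; exact: lerD H1 H2.
Qed.

End perturbation.

(** * Nowhere density *)

Section nowhere_density.
Context {R : realType}.
Implicit Types (f g : disc R -> R[i]).
Variable p : R.
Hypothesis p2 : 2 < p.

Let p0 : 0 < p. Proof. by apply: lt_trans p2. Qed.

Lemma powR_archimedean (a b s : R) : 0 < a -> 0 < s -> exists2 K : nat, (0 < K)%N &
  b < a * (K%:R / 2) `^ s.
Proof.
move=> a0 s0; pose y : R := `|b| / a + 1.
have y0 : 0 < y by rewrite ltr_wpDl// divr_ge0// ltW.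
exists (Num.bound (2 * y `^ s^-1)).+1 => //.
set K := _.+1.
have KB : y `^ s^-1 <= K%:R / 2.
  rewrite ler_pdivlMr// mulrC; apply: ltW; apply: lt_le_trans (archi_boundP _) _.
    by rewrite mulr_ge0// powR_ge0.
  by rewrite ler_nat.
have : y <= (K%:R / 2) `^ s.
  have E : (y `^ s^-1) `^ s = y by rewrite -powRrM mulVf ?gt_eqF// powRr1// ltW.
  rewrite -{1}E ge0_ler_powR ?nnegrE ?powR_ge0 ?(ltW s0)// (le_trans _ KB)// powR_ge0.
rewrite -(ler_pM2l a0); apply: lt_le_trans.
rewrite /y mulrDr mulrCA mulfV ?gt_eqF// !mulr1.
by rewrite (le_lt_trans (ler_norm b))// ltrDl.
Qed.

Lemma ball_not_hardy_bounded f (e n : R) : dirichlet p (p - 1) f -> 0 < e ->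
  ~ (forall g, dirichlet p (p - 1) g -> (dirichlet_norm p (p - 1) (g \- f)%R < e%:E)%E ->
       forall r, 0 <= r -> r < 1 -> circ (extend0 g) p r%:C <= n).
Proof.
move=> df e0 Hb; have p2' := ltW p2.
have af : analytic f by case: df.
pose A : R := p / pi * lacunary_constant p.
have A0 : 0 < A by rewrite mulr_gt0 ?divr_gt0 ?pi_gt0// lacunary_constant_gt0.
pose s : R := p / 2 - 1.
have s0 : 0 < s by rewrite subr_gt0 ltr_pdivlMr// mul1r.
have ep0 : 0 < e `^ p by exact: powR_gt0.
have B0 : 0 < e `^ p / (4 * A) by rewrite divr_gt0// mulr_gt0.
(* Below, y (K/2)^(p/2) equals e^p / (4A) times (K/2)^s, so this [K] violates the bound [n]; [s] is
   positive because p > 2. *)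
have [K K0 HK] := powR_archimedean n B0 s0.
have KR0 : 0 < K%:R :> R by rewrite ltr0n.
(* The p-th power of the step [d]. By [perturb_norm] the p-th power of the distance to [f] is at
   most A K y = e^p / 2, and the factor 1/2 makes the distance strictly less than [e]. *)
pose y : R := e `^ p / (2 * A * K%:R).
have y0 : 0 < y by apply: divr_gt0 => //; apply: mulr_gt0 => //; exact: mulr_gt0.
pose d : R := y `^ p^-1.
have d0 : 0 <= d by exact: powR_ge0.
have dp : d `^ p = y by exact: (powR_rootK p2' (ltW y0)).
have close c : `|c| = d -> (dirichlet_norm p (p - 1) (perturb f c K \- f)%R < e%:E)%E.
  move=> cd; apply: (le_lt_trans (perturb_norm p2 c K af)).
  have -> : p / pi * (`|c| `^ p * (lacunary_constant p * K%:R)) = e `^ p / 2.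
    rewrite cd dp; transitivity (A * K%:R * y); first by rewrite /A; ring.
    by rewrite /y; field; rewrite !gt_eqF.
  have E : (e `^ p) `^ p^-1 = e by rewrite -powRrM mulfV ?gt_eqF// powRr1// ltW.
  rewrite lte_fin -[ltRHS]E gt0_ltr_powR ?nnegrE ?invr_gt0 ?divr_ge0 ?(ltW ep0)//.
  by rewrite ltr_pdivrMr// ltr_pMr// ltr1n.
have [r [r0 r1 Hr]] := circ_lacunary_powR p2' K.
have bnd c : `|c| = d -> circ (extend0 (perturb f c K)) p r%:C <= n.
  by move=> cd; exact: (Hb _ (dirichlet_perturb p2 c K df) (close c cd) r r0 r1).
have H1 := bnd d (ger0_norm d0).
have H2 : circ (extend0 (perturb f (- d) K)) p r%:C <= n.
  by apply: bnd; rewrite normrN ger0_norm.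
have H := circ_perturb p2 af r0 r1 H1 H2.
move: H; rewrite ger0_norm// dp => H.
have : y * (K%:R / 2) `^ (p / 2) <= n.
  by apply: le_trans H; rewrite ler_pM2l.
apply/negP; rewrite -ltNge; apply: (lt_le_trans HK).
rewrite le_eqVlt; apply/orP; left; apply/eqP.
have k0 : 0 < K%:R / 2 :> R by rewrite divr_gt0.
have -> : (K%:R / 2 : R) `^ (p / 2) = (K%:R / 2) `^ s * (K%:R / 2).
  have -> : p / 2 = s + 1 by rewrite /s subrK.
  by rewrite powRD ?powRr1 ?(ltW k0)//; apply/implyP => _; rewrite gt_eqF.
by rewrite /y; move: (_ `^ s) => x; field; rewrite !gt_eqF.
Qed.

Definition hardy_level (n : nat) : set (dirichlet_space p (p - 1)) :=
  [set f | forall r, 0 <= r -> r < 1 -> circ (extend0 f) p r%:C <= n%:R].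

(** If every ball around [f] meets the level set, [circ_le_of_limit] puts [f] into it. *)
Lemma closed_hardy_level n : closed (hardy_level n).
Proof.
have p2' := ltW p2.
rewrite -[hardy_level n]setCK; apply: open_closedC.
have H : dirichlet_open (~` hardy_level n).
  move=> f fn; apply: contrapT => Hf; apply: fn.
  apply: (circ_le_of_limit p2'); first by case: (dirichlet_funP f).
  move=> e e0; apply: contrapT => He; apply: Hf; exists e => // g fg gn; apply: He.
  by exists g; split; [case: (dirichlet_funP g)|exact: fg|exact: gn].
exact: H.
Qed.

Lemma nowhere_dense_hardy_level n : nowhere_dense (hardy_level n).
Proof.
rewrite /nowhere_dense -(closure_id _).1; last exact: closed_hardy_level.
apply/seteqP; split => // f; rewrite /interior /= nbhsE => -[U [oU Uf] UN].
have oU' : dirichlet_open U := oU.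
have [e e0 He] := oU' f Uf.
apply: (@ball_not_hardy_bounded f e n%:R (dirichlet_funP f) e0) => g dg gf.
by apply: (UN (DirichletSpace dg)); apply: He.
Qed.

End nowhere_density.

Unset Implicit Arguments.

Theorem corollary3p15 (R : realType) (p : R) (hp : 2 < p) :
  hardy p `<=` dirichlet p (p - 1) /\
  first_category [set f : dirichlet_space p (p - 1) | hardy p f].
Proof.
have p2 := ltW hp; split; first by move=> f; exact: hardy_dirichlet.
exists (@hardy_level R p); first exact: nowhere_dense_hardy_level.
apply/seteqP; split => [f /(hardyP p2)[af [L HL]]|f [n _ fn]]; last first.
  apply/(hardyP p2); split; first by case: (dirichlet_funP f).
  by exists n%:R.
exists (Num.bound `|L|) => // r r0 r1; apply: (le_trans (HL r r0 r1)).
by apply: (le_trans (ler_norm L)); apply: ltW; exact: archi_boundP.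
Qed.
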